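(* Let $\mathcal{M}$ be a nontrivial closed subspace of $H^2$. Then $\mathcal{M}$ is nearly $T^*_{z,B_n}$-invariant if and only if there exist natural numbers $r' \leq r\leq n$ and an inner function $\Theta \in H^\infty_{\mathcal{B}(\mathbb{C}^{r'},\mathbb{C}^r)}$ with $\Theta(0)=0$ such that \[ \mathcal{M} = [g_1,\ldots , g_r]_{1\times r}\, \mathcal{K}_\Theta, \] where $\{g_i\}_{i=1}^r$ is an orthonormal basis for $\mathcal{M} \ominus (\mathcal{M} \cap B_n H^2)$, and \[ \mathcal{J}(k_1, \ldots ,k_r) = g_1k_1 + \cdots + g_r k_r,\qquad (k_1, \ldots ,k_r) \in \mathcal{K}_\Theta, \] defines a unitary operator $\mathcal{J}: \mathcal{K}_\Theta \to \mathcal{M}$.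
   Context: $H^2$ is the Hardy space on the open unit disc $\mathbb{D}$, $\mathbb{T}$ is the unit circle, $T_zf=zf$ on $H^2$, and $T_z^*$ is its adjoint. Fix points $z_1,\ldots,z_n\in\mathbb{D}$ (possibly repeated) with $z_j=0$ for some $j$, and let $B_n(z)=\prod_{k=1}^n\frac{z_k-z}{1-\bar z_kz}$ be the corresponding Blaschke product, so $B_n(0)=0$. A closed subspace $\mathcal{M}\subseteq H^2$ is nearly $T^*_{z,B_n}$-invariant if $T_z^*f\in\mathcal{M}$ for all $f\in\mathcal{M}\cap B_nH^2$. ''Nontrivial'' means $\mathcal{M}\neq\{0\}$. $H^2_{\mathbb{C}^r}$ is the $\mathbb{C}^r$-valued Hardy space on $\mathbb{D}$. $H^\infty_{\mathcal{B}(\mathbb{C}^{r'},\mathbb{C}^{r})}$ is the set of bounded analytic functions on $\mathbb{D}$ with values in the bounded operators from $\mathbb{C}^{r'}$ to $\mathbb{C}^{r}$; such $\Theta$ is inner if $\Theta(z)^*\Theta(z)=I_{\mathbb{C}^{r'}}$ for a.e. $z\in\mathbb{T}$. The model space is $\mathcal{K}_\Theta=H^2_{\mathbb{C}^{r}}/\Theta H^2_{\mathbb{C}^{r'}}$, identified with the orthogonal complement of $\Theta H^2_{\mathbb{C}^{r'}}$ in $H^2_{\mathbb{C}^r}$. The row $[g_1,\ldots,g_r]$ acts on $(k_1,\ldots,k_r)$ by $g_1k_1+\cdots+g_rk_r$ (pointwise products). *)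

(* Defs.v *)
From HB Require Import structures.
From mathcomp Require Import all_boot all_order all_algebra.
From mathcomp Require Import all_classical all_reals all_analysis.
From mathcomp.real_closed Require Import complex.
Set Implicit Arguments.
Unset Strict Implicit.
Unset Printing Implicit Defensive.
Import Order.TTheory GRing.Theory Num.Theory.
Import numFieldNormedType.Exports.
Local Open Scope classical_set_scope.
Local Open Scope ring_scope.

(* R[i] itself carries no topology; declared as a numClosedFieldType it gets
   the one induced by its norm. *)
Definition Cx (R : realType) : numClosedFieldType := R[i].

Definition disc (R : realType) : Type := {z : Cx R | `|z| < 1}.

Definition disc_val (R : realType) (z : disc R) : Cx R := val z.
Coercion disc_val : disc >-> Num.ClosedField.sort.

Lemma disc0_subproof (R : realType) : `|0 : Cx R| < 1.
Proof. by rewrite normr0 ltr01. Qed.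

Definition disc0 (R : realType) : disc R := exist _ 0 (disc0_subproof R).

(* The point w when |w| < 1, and 0 otherwise. *)
Definition to_disc (R : realType) (w : Cx R) : disc R := insubd (disc0 R) w.

Definition expi (R : realType) (t : R) : Cx R := (cos t +i* sin t)%C.

(* Complex functions live on the subtype disc R, so that = is equality of
   functions on the open disc. *)
Notation dfun R := (disc R -> Cx R).
Notation dvfun R r := (disc R -> 'cV[Cx R]_r).

Section Hilbert.
Variables (R : realType) (U V : lmodType (Cx R)).

Definition linear_subspace (S : set U) : Prop :=
  S 0 /\ forall (c : Cx R) (x y : U), S x -> S y -> S (c *: x + y).

(* Norm-closed subspace S of the Hilbert space H with inner product ip. *)
Definition closed_subspace (H : set U) (ip : U -> U -> Cx R) (S : set U)
    : Prop :=
  [/\ S `<=` H, linear_subspace S &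
      forall x : U, H x ->
        (forall e : Cx R, 0 < e ->
           exists2 y, S y & sqrtC (ip (x - y) (x - y)) < e) ->
        S x].

Definition ominus (H : set U) (ip : U -> U -> Cx R) (S : set U) : set U :=
  [set x | H x /\ forall y, S y -> ip x y = 0].

Definition adjoint_spec (H : set U) (ip : U -> U -> Cx R) (T : U -> U) (y : U)
    : set U :=
  [set h | H h /\ forall x, H x -> ip (T x) y = ip x h].

Definition orthonormal_basis (ip : U -> U -> Cx R) (E : set U) (r : nat)
    (g : 'I_r -> U) : Prop :=
  [/\ forall i, E (g i),
      forall i j, ip (g i) (g j) = (i == j)%:R &
      forall x, E x -> exists c : 'I_r -> Cx R, x = \sum_i c i *: g i].

Definition unitary (K : set U) (ipK : U -> U -> Cx R)
    (M : set V) (ipM : V -> V -> Cx R) (J : U -> V) : Prop :=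
  [/\ forall (c : Cx R) (x y : U), K x -> K y ->
        J (c *: x + y) = c *: J x + J y,
      J @` K = M &
      forall x y, K x -> K y -> ipM (J x) (J y) = ipK x y].

End Hilbert.

Section Hardy.
Variable R : realType.

Definition power_series_of (f : dfun R) : set (nat -> Cx R) :=
  [set a | forall z : disc R,
     series (fun k => a k * (z : Cx R) ^+ k) @ \oo --> f z].

(* On the disc, f is analytic iff it is the sum of one power series at 0. *)
Definition analytic (f : dfun R) : Prop := exists a, power_series_of f a.

(* The Taylor coefficients at 0, when f is analytic. *)
Definition taylor (f : dfun R) : nat -> Cx R := get (power_series_of f).

Definition H2 : set (dfun R) :=
  [set f | analytic f /\ cvgn (series (fun k => `|taylor f k| ^+ 2))].

Definition ip (f g : dfun R) : Cx R :=
  limn (series (fun k => taylor f k * (taylor g k)^*)).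

Definition H2v (r : nat) : set (dvfun R r) :=
  [set F | forall i, H2 (fun z => F z i ord0)].

Definition ipv (r : nat) (F G : dvfun R r) : Cx R :=
  \sum_i ip (fun z => F z i ord0) (fun z => G z i ord0).

Definition Tz (f : dfun R) : dfun R := fun z => (z : Cx R) * f z.

Definition Tz_star (f : dfun R) : dfun R := get (adjoint_spec H2 ip Tz f).

Definition blaschke (n : nat) (a : 'I_n -> disc R) : dfun R := fun z =>
  \prod_k (((a k : Cx R) - (z : Cx R)) / (1 - (a k : Cx R)^* * (z : Cx R))).

Definition mulH2 (B : dfun R) : set (dfun R) :=
  [set (fun z => B z * h z) | h in H2].

Definition nearly_Tz_star_invariant (B : dfun R) (M : set (dfun R)) : Prop :=
  forall f, (M `&` mulH2 B) f -> M (Tz_star f).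

Definition cvnorm (r : nat) (v : 'cV[Cx R]_r) : Cx R :=
  sqrtC (\sum_i `|v i ord0| ^+ 2).

(* Operators from C^r' to C^r are r x r' matrices. *)
Definition Hinfty (r r' : nat) (Theta : disc R -> 'M[Cx R]_(r, r')) : Prop :=
  (forall i j, analytic (fun z => Theta z i j)) /\
  exists c : Cx R, forall (z : disc R) (v : 'cV[Cx R]_r'),
    cvnorm (Theta z *m v) <= c * cvnorm v.

Definition radial_limit (r r' : nat) (Theta : disc R -> 'M[Cx R]_(r, r'))
    (t : R) (W : 'M[Cx R]_(r, r')) : Prop :=
  forall i j,
    Theta (to_disc ((s%:C)%C * expi t)) i j @[s --> (1 : R)^'-] --> W i j.

Definition inner_function (r r' : nat) (Theta : disc R -> 'M[Cx R]_(r, r')) : Prop :=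
  Hinfty Theta /\
  {ae (@lebesgue_measure R), forall t : R, t \in `[0, 2 * pi] ->
     exists2 W, radial_limit Theta t W & map_mx Num.conj W^T *m W = 1%:M}.

Definition mulH2v (r r' : nat) (Theta : disc R -> 'M[Cx R]_(r, r'))
    : set (dvfun R r) :=
  [set (fun z => Theta z *m h z) | h in @H2v r'].

Definition model_space (r r' : nat) (Theta : disc R -> 'M[Cx R]_(r, r'))
    : set (dvfun R r) :=
  ominus (@H2v r) (@ipv r) (mulH2v Theta).

Definition row_apply (r : nat) (g : 'I_r -> dfun R) (k : dvfun R r) : dfun R :=
  fun z => \sum_i g i z * k z i ord0.

End Hardy.

Arguments H2 {R}.
Arguments ip {R}.
Arguments ipv {R r}.

(* Main.v *)
Require Import Defs.
From HB Require Import structures.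
From mathcomp Require Import all_boot all_order all_algebra.
From mathcomp Require Import all_classical all_reals all_analysis.
From mathcomp.real_closed Require Import complex.
From mathcomp Require Import measurable_realfun.
From mathcomp Require Import ring lra.

(** Let B be the Blaschke product and W the orthogonal complement in M of the
    multiples of B that M contains. The multiples of B are the common kernel of n bounded functionals:
    evaluate at a zero, divide by its factor, and repeat ([blaschke_functionals]).
    So W has dimension at most n ([defect_dim]); let g be an orthonormal basis of W
    and P the projection on W.

    Suppose that M is nearly invariant. For f in M the residual f - P f is a
    multiple of B, so it vanishes at 0 and its backward shift R f lies in M. Thus
    f = P f + z R f with orthogonal summands. Repeating this for R f, R^2 f and so on
    gives f = g_1 k_1 + ... + g_r k_r, where k has the m-th coefficient vector
    (<R^m f, g_i>)_i, and |f|^2 is the sum of the squared norms of the coefficient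
    vectors of k below m and of the remainder |R^m f|^2. The crucial point is that
    R^m f tends to 0 ([cshift_stable]). This holds for every finite orthonormal
    family: on the backward shifts S* g_i of the family the iterates of R are
    convolutions of the iterates of S* with contractive responses of a linear system,
    so their squared norms tend to 0 in the mean, and they decrease; modulo such
    vectors R agrees with S*, whose powers tend to 0.
    Hence f -> k is an isometry of M onto a closed subspace K, it turns R into S*, so
    that K is S*-invariant, and it maps g_i to the constant e_i ([vip_ktr],
    [ktr_cshift], [ktr_g], [ktr_closed]); its inverse is J ([row_ktr]).

    The symbol. The complement L of K is invariant under z. The matrix Theta of an
    orthonormal basis of the wandering space, the part of L orthogonal to z L, has
    model space K by the Wold decomposition ([model_space_symbol]), is contractive
    at every point of the disc ([symbol_contractive]), and vanishes at 0 since L is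
    orthogonal to constants ([symbol_at0]). It is inner: functions in H2 have radial
    limits almost everywhere, which follows from a weak type estimate of the radial
    maximal function by that of Hardy and Littlewood ([maximal_bound],
    [radial_limit_ae]); the columns of Theta have norm 1 in H2 and at most 1
    pointwise, so by the Fatou lemma their boundary values have norm 1
    ([column_unit_ae]); and a contraction with unit columns is isometric
    ([contraction_isometry]). Isometries do not decrease dimension, which bounds the
    number of wandering directions by r ([inner_dim]).

    Conversely, let J be unitary from the model space of Theta onto M. As
    Theta(0) = 0, the constants e_i lie in the model space, and J e_i = g_i. If
    f = J k is a multiple of B, it is orthogonal to every g_i, so k(0) = 0, and
    S* f = J (S* k) lies in M ([represented_nearly_invariant]). *)

Import Order.TTheory GRing.Theory Num.Theory.
Import numFieldNormedType.Exports.
Local Open Scope classical_set_scope.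
Local Open Scope ring_scope.
Set Implicit Arguments.
Unset Strict Implicit.
Unset Printing Implicit Defensive.

(** * Complex numbers, limits and series *)

Section ComplexBasics.
Variable R : realType.
Local Notation C := (Cx R).
Implicit Types x y z : C.

Definition re x : R := complex.Re x.
Definition im x : R := complex.Im x.
Definition rc (a : R) : C := (a%:C)%C.
(** The squared modulus; it is kept apart from the modulus [nr] because polynomial
    identities in real and imaginary parts prove most facts about it. *)
Definition sqn x : R := re x ^+ 2 + im x ^+ 2.
Definition nr x : R := Num.sqrt (sqn x).

Lemma cx_eq x y : re x = re y -> im x = im y -> x = y.
Proof. by case: x y => [a b] [c d]; rewrite /re /im /= => -> ->. Qed.

Lemma reD x y : re (x + y) = re x + re y. Proof. by case: x y => [a b] [c d]. Qed.
Lemma imD x y : im (x + y) = im x + im y. Proof. by case: x y => [a b] [c d]. Qed.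
Lemma reN x : re (- x) = - re x. Proof. by case: x. Qed.
Lemma imN x : im (- x) = - im x. Proof. by case: x. Qed.
Lemma reM x y : re (x * y) = re x * re y - im x * im y.
Proof. by case: x y => [a b] [c d]. Qed.
Lemma imM x y : im (x * y) = re x * im y + im x * re y.
Proof. by case: x y => [a b] [c d]. Qed.
Lemma conjE x : x^* = (x^*)%C :> C.
Proof.
have [->|x0] := eqVneq x 0; first by rewrite rmorph0; apply: cx_eq; rewrite /re /im //= oppr0.
apply: (mulfI x0); transitivity (`|x| ^+ 2); first by rewrite normCK.
exact: (sqr_normc (x : R[i]%C)).
Qed.
Lemma reJ x : re x^* = re x. Proof. by rewrite conjE; case: x. Qed.
Lemma imJ x : im x^* = - im x. Proof. by rewrite conjE; case: x. Qed.
Lemma re_rc a : re (rc a) = a. Proof. by []. Qed.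
Lemma im_rc a : im (rc a) = 0. Proof. by []. Qed.
Lemma re0 : re 0 = 0. Proof. by []. Qed.
Lemma im0 : im 0 = 0. Proof. by []. Qed.
Lemma re1 : re 1 = 1. Proof. by []. Qed.
Lemma im1 : im 1 = 0. Proof. by []. Qed.
Definition reimE := (reD, imD, reN, imN, reM, imM, reJ, imJ, re_rc, im_rc, (re0, im0, re1, im1)).

Lemma re_sum I (r : seq I) (P : pred I) (F : I -> C) :
  re (\sum_(i <- r | P i) F i) = \sum_(i <- r | P i) re (F i).
Proof. by elim/big_rec2: _ => // i a b _ <-; rewrite reD. Qed.
Lemma im_sum I (r : seq I) (P : pred I) (F : I -> C) :
  im (\sum_(i <- r | P i) F i) = \sum_(i <- r | P i) im (F i).
Proof. by elim/big_rec2: _ => // i a b _ <-; rewrite imD. Qed.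

Lemma rcD a b : rc (a + b) = rc a + rc b.
Proof. by apply: cx_eq; rewrite !reimE ?addr0. Qed.
Lemma rcN a : rc (- a) = - rc a.
Proof. by apply: cx_eq; rewrite !reimE ?oppr0. Qed.
Lemma rcM a b : rc (a * b) = rc a * rc b.
Proof. by apply: cx_eq; rewrite !reimE; ring. Qed.
Lemma rc0 : rc 0 = 0. Proof. by []. Qed.
Lemma rc1 : rc 1 = 1. Proof. by []. Qed.
Lemma rcX a n : rc (a ^+ n) = rc a ^+ n.
Proof. by elim: n => // n IH; rewrite !exprS rcM IH. Qed.
Lemma rcJ a : (rc a)^* = rc a.
Proof. by apply: cx_eq; rewrite !reimE ?oppr0. Qed.
Lemma rc_inj : injective rc. Proof. by move=> a b /(congr1 re). Qed.
Lemma rc_sum I (r : seq I) (P : pred I) (F : I -> R) :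
  rc (\sum_(i <- r | P i) F i) = \sum_(i <- r | P i) rc (F i).
Proof. by elim/big_rec2: _ => // i a b _ <-; rewrite rcD. Qed.

Lemma mulJ x : x * x^* = rc (sqn x).
Proof. by apply: cx_eq; rewrite !reimE /sqn; ring. Qed.
Lemma normrE x : `|x| = rc (nr x).
Proof. by rewrite [LHS]normc_def. Qed.
Lemma normr2E x : `|x| ^+ 2 = rc (sqn x). Proof. by rewrite normCK mulJ. Qed.
Lemma rc_le a b : (rc a <= rc b) = (a <= b). Proof. exact: lecR. Qed.
Lemma rc_lt a b : (rc a < rc b) = (a < b). Proof. exact: ltcR. Qed.
Lemma real_rcE x : x \is Num.real -> x = rc (re x).
Proof. by move=> /RRe_real. Qed.
Lemma ge0_rcE x : 0 <= x -> x = rc (re x).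
Proof. by move=> /ger0_real /real_rcE. Qed.

Lemma sqn_ge0 x : 0 <= sqn x. Proof. by rewrite addr_ge0 ?sqr_ge0. Qed.
Lemma nr_ge0 x : 0 <= nr x. Proof. exact: sqrtr_ge0. Qed.
Lemma nr2 x : nr x ^+ 2 = sqn x. Proof. by rewrite sqr_sqrtr ?sqn_ge0. Qed.
Lemma nrD x y : nr (x + y) <= nr x + nr y.
Proof. by rewrite -rc_le rcD -!normrE ler_normD. Qed.
Lemma nrN x : nr (- x) = nr x. Proof. by rewrite /nr /sqn !reimE !sqrrN. Qed.
Lemma nrB x y : nr (x - y) = nr (y - x). Proof. by rewrite -nrN opprB. Qed.
Lemma nrM x y : nr (x * y) = nr x * nr y.
Proof. by apply: rc_inj; rewrite rcM -!normrE normrM. Qed.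
Lemma nrX x n : nr (x ^+ n) = nr x ^+ n.
Proof. by apply: rc_inj; rewrite rcX -!normrE normrX. Qed.
Lemma nrJ x : nr x^* = nr x. Proof. by rewrite /nr /sqn !reimE sqrrN. Qed.
Lemma nr0 : nr 0 = 0. Proof. by rewrite /nr /sqn !reimE expr0n addr0 sqrtr0. Qed.
Lemma nr1 : nr 1 = 1. Proof. by apply: rc_inj; rewrite -normrE normr1. Qed.
Lemma nr_rc a : nr (rc a) = `|a|.
Proof. by rewrite /nr /sqn !reimE expr0n addr0 sqrtr_sqr. Qed.
Lemma nr_eq0 x : nr x = 0 -> x = 0.
Proof. by move=> h; apply/eqP; rewrite -normr_eq0 normrE h. Qed.
Lemma nr_sum I (r : seq I) (P : pred I) (F : I -> C) :
  nr (\sum_(i <- r | P i) F i) <= \sum_(i <- r | P i) nr (F i).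
Proof.
elim/big_rec2: _ => [|i a b _ h]; first by rewrite nr0.
by rewrite (le_trans (nrD _ _))// lerD2l.
Qed.
Lemma nr_re x : `|re x| <= nr x.
Proof. by rewrite -sqrtr_sqr ler_wsqrtr// lerDl sqr_ge0. Qed.
Lemma nr_im x : `|im x| <= nr x.
Proof. by rewrite -sqrtr_sqr ler_wsqrtr// lerDr sqr_ge0. Qed.
Lemma sqnM x y : sqn (x * y) = sqn x * sqn y.
Proof. by rewrite /sqn !reimE; ring. Qed.
Lemma sqnN x : sqn (- x) = sqn x. Proof. by rewrite /sqn !reimE; ring. Qed.
Lemma sqnJ x : sqn x^* = sqn x. Proof. by rewrite /sqn !reimE; ring. Qed.
Lemma sqn0 : sqn 0 = 0. Proof. by rewrite /sqn !reimE; ring. Qed.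
Lemma sqn1 : sqn 1 = 1. Proof. by rewrite /sqn !reimE; ring. Qed.
Lemma sqnX x n : sqn (x ^+ n) = sqn x ^+ n.
Proof. by elim: n => [|n IH]; rewrite ?expr0 ?sqn1// !exprS sqnM IH. Qed.
Lemma sqn_rc a : sqn (rc a) = a ^+ 2. Proof. by rewrite /sqn !reimE; ring. Qed.
Lemma sqn_eq0 x : sqn x = 0 -> x = 0.
Proof. by move=> h; apply: nr_eq0; rewrite /nr h sqrtr0. Qed.
Lemma sqnD x y : sqn (x + y) <= 2 * (sqn x + sqn y).
Proof.
rewrite /sqn !reimE -subr_ge0.
set a := re x; set b := re y; set c := im x; set d := im y.
have -> : 2 * (a ^+ 2 + c ^+ 2 + (b ^+ 2 + d ^+ 2)) - ((a + b) ^+ 2 + (c + d) ^+ 2) =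
  (a - b) ^+ 2 + (c - d) ^+ 2 by ring.
exact: addr_ge0 (sqr_ge0 _) (sqr_ge0 _).
Qed.
Lemma nr_lt_sqn x (e : R) : 0 < e -> (nr x < e) = (sqn x < e ^+ 2).
Proof. by move=> e0; rewrite -nr2 ltr_pXn2r ?nnegrE ?nr_ge0 ?ltW. Qed.
Lemma nr_le_sqn x (e : R) : 0 <= e -> (nr x <= e) = (sqn x <= e ^+ 2).
Proof. by move=> e0; rewrite -nr2 ler_pXn2r ?nnegrE ?nr_ge0. Qed.

Lemma nr_le x : nr x <= `|re x| + `|im x|.
Proof.
rewrite nr_le_sqn ?addr_ge0// /sqn -(real_normK (num_real (re x))).
rewrite -(real_normK (num_real (im x))) sqrrD addrAC lerDl mulrn_wge0//.
Qed.

Lemma cvgCP (u : nat -> C) (l : C) : (u @ \oo --> l) <->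
  forall e : R, 0 < e -> exists N, forall n, (N <= n)%N -> nr (u n - l) < e.
Proof.
split=> [/cvgrPdist_lt h e e0|h].
  have e0' : 0 < rc e by rewrite -rc0 rc_lt.
  have [N _ hN] := h _ e0'; exists N => n hn.
  by move: (hN n hn) => /=; rewrite normrE rc_lt nrB.
apply/cvgrPdist_lt => e e0.
have /ge0_rcE eE := ltW e0.
have [|N hN] := h (re e); first by rewrite -rc_lt -eE.
by exists N => // n /= hn; rewrite normrE eE rc_lt nrB hN.
Qed.

Lemma cvgRP (u : nat -> R) (l : R) : (u @ \oo --> l) <->
  forall e : R, 0 < e -> exists N, forall n, (N <= n)%N -> `|u n - l| < e.
Proof.
split=> [/cvgrPdist_lt h e e0|h].
  by have [N _ hN] := h _ e0; exists N => n hn; rewrite distrC hN.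
apply/cvgrPdist_lt => e e0.
by have [N hN] := h _ e0; exists N => // n /= hn; rewrite distrC hN.
Qed.

Lemma cvgC_reim (u : nat -> C) (l : C) :
  (u @ \oo --> l) <-> (re \o u @ \oo --> re l) /\ (im \o u @ \oo --> im l).
Proof.
split=> [/cvgCP h|[/cvgRP hr /cvgRP hi]].
  split; apply/cvgRP => e e0; have [N hN] := h e e0; exists N => n hn /=.
  - by rewrite -reN -reD (le_lt_trans (nr_re _))// hN.
  - by rewrite -imN -imD (le_lt_trans (nr_im _))// hN.
apply/cvgCP => e e0.
have e2 : 0 < e / 2 by rewrite divr_gt0.
have [N1 h1] := hr _ e2; have [N2 h2] := hi _ e2.
exists (maxn N1 N2) => n; rewrite geq_max => /andP[n1 n2].
rewrite (le_lt_trans (nr_le _))// !reimE.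
by have := h1 n n1; have := h2 n n2; rewrite /=; lra.
Qed.

Lemma cvgC_lim (u : nat -> C) (l : C) : u @ \oo --> l -> limn u = l.
Proof. by move=> h; apply: cvg_lim. Qed.
Lemma cvgC_uniq (u : nat -> C) (l l' : C) : u @ \oo --> l -> u @ \oo --> l' -> l = l'.
Proof. by move=> /cvgC_lim <- /cvgC_lim <-. Qed.

Lemma cauchyR (u : nat -> R) :
  (forall e : R, 0 < e -> exists N, forall m n, (N <= m)%N -> (N <= n)%N -> `|u m - u n| < e) ->
  exists l : R, u @ \oo --> l.
Proof.
move=> h; suff : cvgn u by move=> ?; exists (limn u).
apply: cauchy_cvg; apply: cauchy_exP => e e0; have [N hN] := h e e0.
by exists (u N); exists N => // n /= hn; apply: hN.
Qed.

Lemma cauchyC (u : nat -> C) :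
  (forall e : R, 0 < e -> exists N, forall m n, (N <= m)%N -> (N <= n)%N -> nr (u m - u n) < e) ->
  exists l : C, u @ \oo --> l.
Proof.
move=> h.
have [a ha] : exists a : R, re \o u @ \oo --> a.
  apply: cauchyR => e /h[N hN]; exists N => m n hm hn /=.
  by rewrite -reN -reD (le_lt_trans (nr_re _))// hN.
have [b hb] : exists b : R, im \o u @ \oo --> b.
  apply: cauchyR => e /h[N hN]; exists N => m n hm hn /=.
  by rewrite -imN -imD (le_lt_trans (nr_im _))// hN.
by exists (Complex a b); apply/cvgC_reim.
Qed.

Lemma seriesOE (V : zmodType) (a : nat -> V) n : series a n = \sum_(k < n) a k.
Proof. by rewrite seriesEord. Qed.
Lemma series0 (V : zmodType) (a : nat -> V) : series a 0 = 0.
Proof. by rewrite seriesOE big_ord0. Qed.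
Lemma seriesSr (V : zmodType) (a : nat -> V) n : series a n.+1 = series a n + a n.
Proof. by rewrite !seriesOE big_ord_recr. Qed.
Lemma seriesSl (V : zmodType) (a : nat -> V) n :
  series a n.+1 = a 0 + series (fun k => a k.+1) n.
Proof. by rewrite !seriesOE big_ord_recl. Qed.

Lemma bounded_series_cvg (a : nat -> R) (B : R) : (forall k, 0 <= a k) ->
  (forall n, series a n <= B) ->
  exists2 s : R, series a @ \oo --> s & forall n, series a n <= s.
Proof.
move=> a0 hB.
have nd : nondecreasing_seq (series a).
  by apply/nondecreasing_seqP => n; rewrite seriesSr lerDl.
have ub : has_ubound (range (series a)) by exists B => _ [n _ <-]; apply: hB.
exists (sup (range (series a))); first exact: nondecreasing_cvgn.
by move=> n; apply: ub_le_sup => //; exists n.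
Qed.

Lemma cvg_series_le (a : nat -> R) (s : R) : (forall k, 0 <= a k) ->
  series a @ \oo --> s -> forall n, series a n <= s.
Proof.
move=> a0 h n; have <- : limn (series a) = s by exact: cvg_lim.
apply: nondecreasing_cvgn_le; last by apply/cvg_ex; exists s.
by apply/nondecreasing_seqP => k; rewrite seriesSr lerDl.
Qed.

Lemma series_tail (V : zmodType) (a : nat -> V) m n : (m <= n)%N ->
  series a n - series a m = \sum_(m <= k < n) a k.
Proof. by move=> mn; rewrite sub_series_geq. Qed.

Lemma cauchy_tail (a : nat -> R) (s : R) : series a @ \oo --> s ->
  forall e : R, 0 < e -> exists N, forall m n, (N <= m)%N -> (m <= n)%N ->
    `|\sum_(m <= k < n) a k| < e.
Proof.
move=> /cvgRP h e e0; have [|N hN] := h (e / 2); first by rewrite divr_gt0.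
exists N => m n Nm mn; have h1 := hN m Nm; have h2 := hN n (leq_trans Nm mn).
rewrite -series_tail//; set x := series a n in h2 *; set y := series a m in h1 *.
have := ler_normB (x - s) (y - s); have -> : x - s - (y - s) = x - y by ring.
by lra.
Qed.

Lemma abs_series_cvg (a : nat -> C) (B : R) :
  (forall n, series (fun k => nr (a k)) n <= B) ->
  exists s : C, series a @ \oo --> s.
Proof.
move=> hB; have [s hs _] := bounded_series_cvg (fun k => nr_ge0 (a k)) hB.
apply: cauchyC => e e0; have [N hN] := cauchy_tail hs e0.
exists N => m n Nm Nn.
wlog mn : m n Nm Nn / (m <= n)%N.
  by move=> W; have [/W->//|/ltnW/W h] := leqP m n; rewrite nrB h.
rewrite nrB series_tail// (le_lt_trans (nr_sum _ _ _))//.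
by rewrite (le_lt_trans (ler_norm _))// hN.
Qed.

Lemma cvgR_sum n (u : 'I_n -> nat -> R) (l : 'I_n -> R) :
  (forall i, u i @ \oo --> l i) -> (fun k => \sum_i u i k) @ \oo --> \sum_i l i.
Proof.
elim: n u l => [|n IH] u l h.
  rewrite big_ord0 (_ : (fun _ => _) = fun _ => 0); first exact: cvg_cst.
  by apply/funext => k; rewrite big_ord0.
rewrite big_ord_recl (_ : (fun _ => _) = u ord0 \+ (fun k => \sum_(i < n) u (lift ord0 i) k)).
  by apply: cvgD; [exact: h | exact: IH].
by apply/funext => k; rewrite big_ord_recl.
Qed.

Lemma invS_small (e : R) : 0 < e -> exists N, forall n, (N <= n)%N -> n.+1%:R^-1 < e.
Proof.
move=> e0; have [N _ hN] := near_infty_natSinv_lt (PosNum e0).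
by exists N => n Nn; apply: hN.
Qed.

End ComplexBasics.

(** * Subspaces and Hilbert spaces *)

Section LinearSubspace.
Variables (R : realType) (U : lmodType (Cx R)) (S : set U).
Hypothesis hS : linear_subspace S.

Lemma lin0 : S 0. Proof. by case: hS. Qed.
Lemma linP c x y : S x -> S y -> S (c *: x + y). Proof. by case: hS => _; apply. Qed.
Lemma linD x y : S x -> S y -> S (x + y).
Proof. by move=> ? ?; rewrite -[x]scale1r; apply: linP. Qed.
Lemma linZ c x : S x -> S (c *: x).
Proof. by move=> ?; rewrite -[_ *: _]addr0; apply: linP => //; apply: lin0. Qed.
Lemma linN x : S x -> S (- x).
Proof. by move=> ?; rewrite -scaleN1r; apply: linZ. Qed.
Lemma linB x y : S x -> S y -> S (x - y).
Proof. by move=> ? ?; apply: linD => //; apply: linN. Qed.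
Lemma lin_sum I (r : seq I) (P : pred I) (F : I -> U) :
  (forall i, P i -> S (F i)) -> S (\sum_(i <- r | P i) F i).
Proof.
move=> h; elim/big_rec: _ => [|i x Pi Sx]; first exact: lin0.
by apply: linD => //; apply: h.
Qed.
End LinearSubspace.

Section LinearOn.
Variables (R : realType) (U V : lmodType (Cx R)) (S : set U) (K : U -> V).
Hypothesis hS : linear_subspace S.
Hypothesis hK : forall c x y, S x -> S y -> K (c *: x + y) = c *: K x + K y.

Lemma linon0 : K 0 = 0.
Proof.
have := @hK (- 1) 0 0 (lin0 hS) (lin0 hS).
by rewrite scaler0 addr0 scaleN1r addNr.
Qed.
Lemma linonZ c x : S x -> K (c *: x) = c *: K x.
Proof. by move=> Sx; rewrite -[c *: x]addr0 hK ?linon0 ?addr0//; apply: lin0. Qed.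
Lemma linonB x y : S x -> S y -> K (x - y) = K x - K y.
Proof.
move=> Sx Sy; have -> : x - y = (- 1) *: y + x by rewrite scaleN1r addrC.
by rewrite hK// scaleN1r addrC.
Qed.
Lemma linonD x y : S x -> S y -> K (x + y) = K x + K y.
Proof. by move=> Sx Sy; rewrite -[x]scale1r hK// !scale1r. Qed.
Lemma linon_sum n (c : 'I_n -> Cx R) (x : 'I_n -> U) : (forall i, S (x i)) ->
  K (\sum_i c i *: x i) = \sum_i c i *: K (x i).
Proof.
elim: n c x => [|n IH] c x Sx; first by rewrite !big_ord0 linon0.
rewrite !big_ord_recl hK ?IH//.
by apply: (lin_sum hS) => i _; apply: (linZ hS).
Qed.
End LinearOn.

Section HilbertTheory.
Variables (R : realType) (U : lmodType (Cx R)).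
Local Notation C := (Cx R).

(** Norms are taken as real numbers, while the inner product is complex. *)
Definition sqnorm (ip : U -> U -> C) (x : U) : R := re (ip x x).
Definition hnorm (ip : U -> U -> C) (x : U) : R := Num.sqrt (sqnorm ip x).

(** Inner product axioms are only required on the carrier, outside of which
    the values of the inner product are arbitrary. *)
Record hilbert (H : set U) (ip : U -> U -> C) : Prop := Hilbert {
  hilbert_lin : linear_subspace H;
  hilbert_ipP : forall c x y z, H x -> H y -> H z ->
    ip (c *: x + y) z = c * ip x z + ip y z;
  hilbert_ipC : forall x y, H x -> H y -> ip y x = (ip x y)^*;
  hilbert_ge0 : forall x, H x -> 0 <= sqnorm ip x;
  hilbert_def : forall x, H x -> sqnorm ip x = 0 -> x = 0;
  hilbert_complete : forall u : nat -> U, (forall n, H (u n)) ->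
    (forall e : R, 0 < e -> exists N, forall m n, (N <= m)%N -> (N <= n)%N ->
       sqnorm ip (u m - u n) < e) ->
    exists2 x, H x & forall e : R, 0 < e -> exists N, forall n, (N <= n)%N ->
       sqnorm ip (u n - x) < e }.

Variables (H : set U) (ip : U -> U -> C).
Hypothesis hH : hilbert H ip.
Local Notation nsq := (sqnorm ip).
Local Notation hn := (hnorm ip).
Let HL := hilbert_lin hH.

Lemma ipDl x y z : H x -> H y -> H z -> ip (x + y) z = ip x z + ip y z.
Proof. by move=> ? ? ?; rewrite -[x]scale1r (hilbert_ipP hH)// mul1r scale1r. Qed.
Lemma ip0l z : H z -> ip 0 z = 0.
Proof.
move=> Hz; have := ipDl (lin0 HL) (lin0 HL) Hz.
by rewrite addr0 => /eqP; rewrite -subr_eq0 opprD addrA subrr sub0r oppr_eq0 => /eqP.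
Qed.
Lemma ipZl c x z : H x -> H z -> ip (c *: x) z = c * ip x z.
Proof.
move=> ? ?; rewrite -[c *: x]addr0 (hilbert_ipP hH)// ?ip0l ?addr0//.
exact: (lin0 HL).
Qed.
Lemma ipNl x z : H x -> H z -> ip (- x) z = - ip x z.
Proof. by move=> ? ?; rewrite -scaleN1r ipZl// mulN1r. Qed.
Lemma ipBl x y z : H x -> H y -> H z -> ip (x - y) z = ip x z - ip y z.
Proof. by move=> ? ? ?; rewrite ipDl ?ipNl//; apply: (linN HL). Qed.
Lemma ip_suml I (r : seq I) (P : pred I) (F : I -> U) z : H z ->
  (forall i, P i -> H (F i)) ->
  ip (\sum_(i <- r | P i) F i) z = \sum_(i <- r | P i) ip (F i) z.
Proof.
move=> Hz h; elim: r => [|a r IH]; first by rewrite !big_nil ip0l.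
rewrite !big_cons; case: ifP => // Pa; rewrite ipDl ?IH//; first exact: h.
exact: (lin_sum HL).
Qed.
Lemma ipC x y : H x -> H y -> ip y x = (ip x y)^*. Proof. exact: (hilbert_ipC hH). Qed.
Lemma ipDr x y z : H x -> H y -> H z -> ip z (x + y) = ip z x + ip z y.
Proof.
move=> ? ? ?; rewrite (ipC (x := x + y))// ?ipDl// ?rmorphD/= -?ipC//; exact: (linD HL).
Qed.
Lemma ipZr c x z : H x -> H z -> ip z (c *: x) = c^* * ip z x.
Proof.
move=> ? ?; rewrite (ipC (x := c *: x))// ?ipZl// ?rmorphM/= -?ipC//; exact: (linZ HL).
Qed.
Lemma ip0r z : H z -> ip z 0 = 0.
Proof. by move=> ?; rewrite ipC ?ip0l ?rmorph0//; apply: (lin0 HL). Qed.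
Lemma ipNr x z : H x -> H z -> ip z (- x) = - ip z x.
Proof. by move=> ? ?; rewrite -scaleN1r ipZr// rmorphN rmorph1 mulN1r. Qed.
Lemma ipBr x y z : H x -> H y -> H z -> ip z (x - y) = ip z x - ip z y.
Proof. by move=> ? ? ?; rewrite ipDr ?ipNr//; apply: (linN HL). Qed.
Lemma ip_sumr I (r : seq I) (P : pred I) (F : I -> U) z : H z ->
  (forall i, P i -> H (F i)) ->
  ip z (\sum_(i <- r | P i) F i) = \sum_(i <- r | P i) ip z (F i).
Proof.
move=> Hz h; elim: r => [|a r IH]; first by rewrite !big_nil ip0r.
rewrite !big_cons; case: ifP => // Pa; rewrite ipDr ?IH//; first exact: h.
exact: (lin_sum HL).
Qed.

Lemma nsq_ge0 x : H x -> 0 <= nsq x. Proof. exact: (hilbert_ge0 hH). Qed.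
Lemma ip_nsq x : H x -> ip x x = rc (nsq x).
Proof.
move=> Hx; apply: cx_eq; rewrite ?im_rc//.
have := congr1 (@im R) (ipC Hx Hx); rewrite imJ => /eqP.
by rewrite -addr_eq0 -mulr2n mulrn_eq0 => /eqP.
Qed.
Lemma nsqZ c x : H x -> nsq (c *: x) = sqn c * nsq x.
Proof.
move=> Hx; apply: rc_inj; rewrite -ip_nsq; last exact: (linZ HL).
rewrite ipZl// ?ipZr// ?ip_nsq// ?mulrA ?mulJ ?rcM//; exact: (linZ HL).
Qed.
Lemma nsqN x : H x -> nsq (- x) = nsq x.
Proof. by move=> Hx; rewrite -scaleN1r nsqZ// sqnN sqn1 mul1r. Qed.
Lemma nsqD x y : H x -> H y -> nsq (x + y) = nsq x + nsq y + 2 * re (ip x y).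
Proof.
move=> Hx Hy; have Hxy := linD HL Hx Hy.
rewrite {1}/sqnorm ipDl// !ipDr// !reD (ipC Hx Hy) reJ -/(nsq x) -/(nsq y); ring.
Qed.
Lemma nsqB x y : H x -> H y -> nsq (x - y) = nsq x + nsq y - 2 * re (ip x y).
Proof.
by move=> Hx Hy; rewrite nsqD// ?nsqN// ?ipNr// ?reN ?mulrN//; apply: (linN HL).
Qed.
Lemma nsq0 : nsq 0 = 0.
Proof. by rewrite /sqnorm ip0l//; apply: (lin0 HL). Qed.
Lemma nsqBC x y : H x -> H y -> nsq (x - y) = nsq (y - x).
Proof. by move=> ? ?; rewrite -nsqN ?opprB//; apply: (linB HL). Qed.
Lemma nsqD_le x y : H x -> H y -> nsq (x + y) <= 2 * (nsq x + nsq y).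
Proof.
move=> Hx Hy; have := nsq_ge0 (linB HL Hx Hy).
by rewrite nsqB// nsqD//; lra.
Qed.

Lemma cauchy_schwarz x y : H x -> H y -> sqn (ip x y) <= nsq x * nsq y.
Proof.
move=> Hx Hy; set c := ip x y.
pose z := rc (nsq y) *: x - c *: y.
have Hz : H z by apply: (linB HL); apply: (linZ HL).
have := nsq_ge0 Hz; rewrite nsqB ?nsqZ//; try exact: (linZ HL).
rewrite ipZl// ?ipZr//; try exact: (linZ HL).
rewrite sqn_rc -/c [c^* * c]mulrC mulJ -rcM re_rc => h.
have [y0|y0] := eqVneq (nsq y) 0.
  have -> : y = 0 by apply: (hilbert_def hH).
  by rewrite /c (hilbert_def hH Hy y0) ip0r// sqn0 nsq0 mulr0.
have {}y0 : 0 < nsq y by rewrite lt_def y0 nsq_ge0.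
by rewrite -subr_ge0 -(pmulr_rge0 _ y0); move: h; nra.
Qed.

Lemma ip_nsq0 x y : H x -> H y -> nsq y = 0 -> ip x y = 0.
Proof.
move=> Hx Hy y0; apply: sqn_eq0; apply/eqP; rewrite eq_le sqn_ge0 andbT.
by rewrite (le_trans (cauchy_schwarz Hx Hy))// y0 mulr0.
Qed.

Lemma hn_ge0 x : 0 <= hn x. Proof. exact: sqrtr_ge0. Qed.
Lemma hn2 x : H x -> hn x ^+ 2 = nsq x. Proof. by move=> ?; rewrite sqr_sqrtr ?nsq_ge0. Qed.
Lemma hn_lt x (e : R) : H x -> 0 < e -> (hn x < e) = (nsq x < e ^+ 2).
Proof. by move=> Hx e0; rewrite -hn2// ltr_pXn2r ?nnegrE ?hn_ge0 ?ltW. Qed.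
Lemma nr_ip x y : H x -> H y -> nr (ip x y) <= hn x * hn y.
Proof.
move=> Hx Hy; rewrite nr_le_sqn ?mulr_ge0 ?hn_ge0// exprMn !hn2//.
exact: cauchy_schwarz.
Qed.
Lemma hnD x y : H x -> H y -> hn (x + y) <= hn x + hn y.
Proof.
move=> Hx Hy; have Hxy := linD HL Hx Hy.
rewrite -(@ler_pXn2r _ 2)// ?nnegrE ?hn_ge0 ?addr_ge0 ?hn_ge0//.
rewrite hn2// nsqD// sqrrD !hn2//.
have := nr_ip Hx Hy; have := nr_re (ip x y); have := ler_norm (re (ip x y)).
by lra.
Qed.

(** Approximation in the complex-valued norm amounts to approximation in the real
    squared norm. *)
Lemma closedP S : closed_subspace H ip S <->
  [/\ S `<=` H, linear_subspace S & forall x, H x ->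
     (forall e : R, 0 < e -> exists2 y, S y & nsq (x - y) < e) -> S x].
Proof.
split=> -[SH Sl Sc]; split=> // x Hx h; apply: Sc => // e e0.
  have eE := ge0_rcE (ltW e0); have re_gt0 : 0 < re e by rewrite -rc_lt -eE.
  have [y Sy hy] := h (re e ^+ 2) (exprn_gt0 2 re_gt0).
  exists y => //; have Hxy : H (x - y) by apply: (linB HL) => //; apply: SH.
  rewrite -(@ltr_pXn2r _ 2)// ?nnegrE; last 2 first.
  - by rewrite sqrtC_ge0 ip_nsq// -rc0 rc_le nsq_ge0.
  - exact: ltW.
  by rewrite sqrtCK ip_nsq// eE -rcX rc_lt.
have [|y Sy hy] := h (rc (Num.sqrt e)); first by rewrite -rc0 rc_lt sqrtr_gt0.
exists y => //; have Hxy : H (x - y) by apply: (linB HL) => //; apply: SH.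
move: hy; rewrite -(@ltr_pXn2r _ 2)// ?nnegrE; last 2 first.
- by rewrite sqrtC_ge0 ip_nsq// -rc0 rc_le nsq_ge0.
- by rewrite -rc0 rc_le sqrtr_ge0.
by rewrite sqrtCK ip_nsq// -rcX rc_lt sqr_sqrtr// ltW.
Qed.

Lemma closed_sub S : closed_subspace H ip S -> S `<=` H. Proof. by case. Qed.
Lemma closed_lin S : closed_subspace H ip S -> linear_subspace S. Proof. by case. Qed.

Lemma complete_closed S (u : nat -> U) : closed_subspace H ip S ->
  (forall n, S (u n)) ->
  (forall e : R, 0 < e -> exists N, forall m n, (N <= m)%N -> (N <= n)%N ->
     nsq (u m - u n) < e) ->
  exists2 x, S x & forall e : R, 0 < e -> exists N, forall n, (N <= n)%N ->
     nsq (u n - x) < e.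
Proof.
move=> /closedP[SH Sl Sc] Su /(hilbert_complete hH (fun n => SH _ (Su n)))[x Hx hx].
exists x => //; apply: Sc => // e /hx[N hN]; exists (u N) => //.
by rewrite nsqBC//; [exact: hN | exact: SH].
Qed.

(** The orthogonal projection: a minimizing sequence of the distance is Cauchy
    by the parallelogram law. *)
Lemma projection S x : closed_subspace H ip S -> H x ->
  exists2 y, S y & forall s, S s -> ip (x - y) s = 0.
Proof.
move=> Sc Hx; have SH := closed_sub Sc; have Sl := closed_lin Sc.
pose D := [set nsq (x - s) | s in S].
have D0 : lbound D 0 by move=> _ [s Ss <-]; apply/nsq_ge0/(linB HL) => //; apply: SH.
have Dinf : has_inf D.
  by split; [exists (nsq (x - 0)), 0 => //; apply: lin0 | exists 0].
set d := inf D.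
have dle s : S s -> d <= nsq (x - s) by move=> Ss; apply: ge_inf; [exists 0 | exists s].
have ex n : exists s, S s /\ nsq (x - s) < d + n.+1%:R^-1.
  have [_ [s Ss <-] hs] := inf_adherent (divr_gt0 ltr01 (ltr0Sn R n)) Dinf.
  by exists s; rewrite -[_^-1]mul1r.
have [u hu] := choice ex.
have Hu n : H (u n) by apply: SH; case: (hu n).
have [y Sy hy] : exists2 y, S y & forall e : R, 0 < e -> exists N, forall n, (N <= n)%N ->
     nsq (u n - y) < e.
  apply: complete_closed => // [n|e e0]; first by case: (hu n).
  have e4 : 0 < e / 4 by lra.
  have [N hN] := invS_small e4.
  exists N => m n Nm Nn.
  pose z := 2^-1 *: (u m + u n) : U.
  have Sz : S z by apply/(linZ Sl)/(linD Sl); [case: (hu m) | case: (hu n)].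
  have Hz := SH _ Sz.
  have E : nsq (u m - u n) = 2 * nsq (x - u m) + 2 * nsq (x - u n) - 4 * nsq (x - z).
    have zE : 4 * nsq (x - z) = nsq ((x - u m) + (x - u n)).
      have -> : (x - u m) + (x - u n) = 2 *: (x - z).
        rewrite scalerBr /z scalerA divff ?pnatr_eq0// scale1r.
        by rewrite addrACA -opprD -mulr2n scaler_nat.
      rewrite nsqZ; last exact: (linB HL).
      by congr (_ * _); rewrite -[2 : C]/(1 + 1 : C) /sqn !reimE; ring.
    have umE : u m - u n = (x - u n) - (x - u m).
      by rewrite opprB [RHS]addrC addrA subrK.
    rewrite zE umE; have Hm := linB HL Hx (Hu m); have Hn := linB HL Hx (Hu n).
    set p := x - u m in Hm *; set q := x - u n in Hn *.
    by rewrite (nsqB Hn Hm) (nsqD Hm Hn) (ipC Hm Hn) reJ; ring.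
  have := dle _ Sz; have [_] := hu m; have [_] := hu n; rewrite {}E.
  have := hN m Nm; have := hN n Nn.
  set a1 := n.+1%:R^-1; set a2 := m.+1%:R^-1.
  by lra.
have Hy := SH _ Sy; have Hxy := linB HL Hx Hy.
have yd : nsq (x - y) <= d.
  have d0 : 0 <= d by apply: lb_le_inf => //; case: Dinf.
  have : hn (x - y) <= Num.sqrt d.
    rewrite leNgt; apply/negP => dy.
    pose e := hn (x - y) - Num.sqrt d; have e0 : 0 < e by rewrite subr_gt0.
    have [N1 h1] := hy _ (exprn_gt0 2 (divr_gt0 e0 (ltr0Sn R 1))).
    have e1 : 0 < (Num.sqrt d + e / 2) ^+ 2 - d.
      have -> : (Num.sqrt d + e / 2) ^+ 2 - d = Num.sqrt d * e + e ^+ 2 / 4.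
        by rewrite sqrrD sqr_sqrtr//; field.
      by rewrite ltr_wpDl ?mulr_ge0 ?sqrtr_ge0 ?ltW// divr_gt0// exprn_gt0.
    have [N2 h2] := invS_small e1.
    pose n := maxn N1 N2.
    have Hn := linB HL Hx (Hu n); have Hny := linB HL (Hu n) Hy.
    have : hn (x - y) < (Num.sqrt d + e / 2) + e / 2.
      have -> : x - y = (x - u n) + (u n - y) by rewrite addrA subrK.
      rewrite (le_lt_trans (hnD _ _))// ltrD//; rewrite hn_lt//.
      + have [_] := hu n; have := h2 n (leq_maxr _ _); set a1 := n.+1%:R^-1; lra.
      + by rewrite ltr_wpDl ?sqrtr_ge0// divr_gt0.
      + exact: h1 (leq_maxl _ _).
      + by rewrite divr_gt0.
    by rewrite /e; lra.
  rewrite -(@ler_pXn2r _ 2)// ?nnegrE ?hn_ge0 ?sqrtr_ge0//.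
  by rewrite hn2// sqr_sqrtr.
exists y => // s Ss; have Hs := SH _ Ss.
have [s0|s0] := eqVneq (nsq s) 0; first exact: ip_nsq0.
have {}s0 : 0 < nsq s by rewrite lt_def s0 nsq_ge0.
set c := ip (x - y) s; apply: sqn_eq0.
pose a := rc (nsq s)^-1 * c.
have Sz : S (y + a *: s) by apply: (linD Sl) => //; apply: (linZ Sl).
have := le_trans yd (dle _ Sz).
have Has : H (a *: s) by apply: (linZ HL).
rewrite opprD addrA (nsqB Hxy Has).
rewrite nsqZ// ipZr// -/c /a sqnM sqn_rc rmorphM/= rcJ -[_ * c^* * c]mulrA [c^* * c]mulrC mulJ -rcM re_rc.
have -> : (nsq s)^-1 ^+ 2 * sqn c * nsq s = (nsq s)^-1 * sqn c.
  by field; rewrite gt_eqF.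
have k0 : 0 < (nsq s)^-1 by rewrite invr_gt0.
have := sqn_ge0 c; set q := sqn c => q0 h.
have : 0 <= (nsq s)^-1 * q by rewrite mulr_ge0// ltW.
have {}h : (nsq s)^-1 * q <= 0 by lra.
by rewrite pmulr_rle0// in h => _; apply/eqP; rewrite eq_le h q0.
Qed.

End HilbertTheory.

(** * Orthonormal families *)

Section Orthonormal.
Variables (R : realType) (U : lmodType (Cx R)).
Local Notation C := (Cx R).
Variables (H : set U) (ip : U -> U -> C).
Hypothesis hH : hilbert H ip.
Local Notation nsq := (sqnorm ip).
Let HL := hilbert_lin hH.

Definition orthonormal r (g : 'I_r -> U) :=
  (forall i, H (g i)) /\ forall i j, ip (g i) (g j) = (i == j)%:R.

Definition onproj r (g : 'I_r -> U) x := \sum_i ip x (g i) *: g i.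

Section Family.
Variables (r : nat) (g : 'I_r -> U).
Hypothesis og : orthonormal g.
Let Hg i : H (g i). Proof. by case: og. Qed.

Lemma span_in (c : 'I_r -> C) : H (\sum_i c i *: g i).
Proof. by apply: (lin_sum HL) => i _; apply: (linZ HL). Qed.

Lemma ip_span (c : 'I_r -> C) j : ip (\sum_i c i *: g i) (g j) = c j.
Proof.
rewrite (ip_suml hH)//; last by move=> i _; apply: (linZ HL).
rewrite (bigD1 j)//= big1 => [|i ij]; rewrite (ipZl hH)//; case: og => _ ->.
  by rewrite eqxx mulr1 addr0.
by rewrite (negbTE ij) mulr0.
Qed.

Lemma nsq_span (c : 'I_r -> C) : nsq (\sum_i c i *: g i) = \sum_i sqn (c i).
Proof.
apply: rc_inj; rewrite -(ip_nsq hH); last exact: span_in.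
rewrite (ip_sumr hH); [|exact: span_in|by move=> i _; apply: (linZ HL)].
rewrite rc_sum; apply: eq_bigr => i _.
by rewrite (ipZr hH)// ?ip_span ?[_^* * _]mulrC ?mulJ//; apply: span_in.
Qed.

Lemma onproj_in x : H (onproj g x). Proof. exact: span_in. Qed.

Lemma ip_onproj x j : ip (onproj g x) (g j) = ip x (g j).
Proof. exact: ip_span. Qed.

Lemma ip_onres x j : H x -> ip (x - onproj g x) (g j) = 0.
Proof. by move=> Hx; rewrite (ipBl hH)// ?ip_onproj ?subrr//; apply: onproj_in. Qed.

(** The residual is orthogonal to the span, so this is the theorem of Pythagoras. *)
Lemma nsq_onres x : H x -> nsq (x - onproj g x) = nsq x - \sum_i sqn (ip x (g i)).
Proof.
move=> Hx; have Hp := onproj_in x; rewrite (nsqB hH)// [nsq (onproj g x)]nsq_span.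
have -> : re (ip x (onproj g x)) = \sum_i sqn (ip x (g i)).
  rewrite (ip_sumr hH)//; last by move=> i _; apply: (linZ HL).
  rewrite re_sum; apply: eq_bigr => i _.
  by rewrite (ipZr hH)// [_^* * _]mulrC mulJ.
by ring.
Qed.

Lemma onprojP c x y : H x -> H y -> onproj g (c *: x + y) = c *: onproj g x + onproj g y.
Proof.
move=> Hx Hy; rewrite /onproj scaler_sumr -big_split; apply: eq_bigr => i _ /=.
by rewrite (hilbert_ipP hH)// scalerDl scalerA.
Qed.

End Family.

(** Sizes of orthonormal families are bounded, so there is a maximal one. It spans,
    since a nonzero residual could be normalised and added to it. *)
Lemma orthonormal_basis_exists W n : W `<=` H -> linear_subspace W ->
  (forall m (g : 'I_m -> U), (forall i, W (g i)) -> orthonormal g -> (m <= n)%N) ->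
  exists r (g : 'I_r -> U), (r <= n)%N /\ orthonormal_basis ip W g.
Proof.
move=> WH Wl hn.
pose P r := exists g : 'I_r -> U, (forall i, W (g i)) /\ orthonormal g.
have P0 : P 0.
  by exists (fun _ => 0); split=> [[]//|]; split=> [[]//|[]//].
have [r [Pr Pr1]] : exists r, P r /\ ~ P r.+1.
  apply: contrapT => h.
  have PP k : P k.
    by elim: k => // k IH; apply: contrapT => nP; apply: h; exists k.
  by have [g [Wg og]] := PP n.+1; have := hn _ _ Wg og; rewrite ltnn.
case: Pr => g [Wg og]; exists r, g; split; first exact: hn og.
split=> //; first by case: og.
move=> x Wx; exists (fun i => ip x (g i)); apply/eqP; rewrite -subr_eq0; apply/eqP.
set v := x - _; apply: contrapT => /eqP v0; apply: Pr1.
have Hx := WH _ Wx.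
have Wv : W v by apply: (linB Wl) => //; apply: (lin_sum Wl) => i _; apply: (linZ Wl).
have Hv := WH _ Wv.
have nv0 : 0 < nsq v.
  rewrite lt_def (nsq_ge0 hH)// andbT; apply: contra v0 => /eqP.
  by move=> /(hilbert_def hH Hv) ->.
pose c := rc (Num.sqrt (nsq v))^-1.
have cv : nsq (c *: v) = 1.
  by rewrite (nsqZ hH)// sqn_rc exprVn sqr_sqrtr ?ltW// mulVf ?gt_eqF.
pose w := c *: v; have Ww : W w by apply: (linZ Wl).
have wg j : ip w (g j) = 0.
  by rewrite (ipZl hH)// ?(ip_onres og)// ?mulr0//; case: og.
have gw j : ip (g j) w = 0.
  by rewrite (ipC hH (WH _ Ww)) ?wg ?rmorph0//; case: og.
pose g' (i : 'I_r.+1) := if unlift ord_max i is Some j then g j else w.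
exists g'; have Wg' i : W (g' i) by rewrite /g'; case: (unlift _ _).
split=> //; split=> [i|i j]; first exact: WH.
rewrite /g'; case: (unliftP ord_max i) => [i' ->|->];
  case: (unliftP ord_max j) => [j' ->|->].
- by case: og => _ ->; rewrite (inj_eq lift_inj).
- by rewrite gw eq_sym (negbTE (neq_lift _ _)).
- by rewrite wg (negbTE (neq_lift _ _)).
- by rewrite eqxx (ip_nsq hH) ?cv//; apply: WH.
Qed.

Lemma ominus_lin M S : M `<=` H -> S `<=` H -> linear_subspace M ->
  linear_subspace (ominus M ip S).
Proof.
move=> MH SH Ml; split; first by split=> [|y /SH Hy]; [apply: lin0 | rewrite (ip0l hH)].
move=> c x y [Mx hx] [My hy]; split; first exact: (linP Ml).
by move=> z Sz; rewrite (hilbert_ipP hH) ?hx ?hy ?mulr0 ?addr0//; auto.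
Qed.

Lemma ominus_split M N x : closed_subspace H ip N -> N `<=` M -> M `<=` H ->
  linear_subspace M -> M x -> exists y, N y /\ ominus M ip N (x - y).
Proof.
move=> Nc NM MH Ml Mx; have [y Ny hy] := projection hH Nc (MH _ Mx).
by exists y; split=> //; split=> //; apply: (linB Ml) => //; apply: NM.
Qed.

End Orthonormal.

Section Polarization.
Variables (R : realType) (U V : lmodType (Cx R)).
Local Notation C := (Cx R).
Variables (H : set U) (ip : U -> U -> C) (H' : set V) (ip' : V -> V -> C).
Hypotheses (hH : hilbert H ip) (hH' : hilbert H' ip').

(** Comparing the norms of c x + y for c = 1 and c = i recovers the real and the
    imaginary part of the inner product. *)
Lemma polarization (S : set U) (K : U -> V) : S `<=` H -> linear_subspace S ->
  (forall x, S x -> H' (K x)) ->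
  (forall c x y, S x -> S y -> K (c *: x + y) = c *: K x + K y) ->
  (forall x, S x -> sqnorm ip' (K x) = sqnorm ip x) ->
  forall x y, S x -> S y -> ip' (K x) (K y) = ip x y.
Proof.
move=> SH Sl KH Kl Kn x y Sx Sy.
have key c : re (c * ip' (K x) (K y)) = re (c * ip x y).
  have Hx := SH _ Sx; have Hy := SH _ Sy; have Sc := linZ Sl c Sx.
  have := Kn _ (linP Sl c Sx Sy); rewrite Kl//.
  rewrite (nsqD hH') ?(nsqD hH)//; last 3 first.
  - exact: SH.
  - exact: (linZ (hilbert_lin hH') c (KH _ Sx)).
  - exact: KH.
  rewrite !(nsqZ hH) ?(nsqZ hH')// ?Kn// ?(ipZl hH) ?(ipZl hH')//; auto.
  by move=> h; lra.
have := key 1; rewrite !mul1r => h1; have := key (Complex 0 1).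
rewrite !reM /= /im /re /= !mul0r !mul1r !sub0r => /oppr_inj h2.
exact: cx_eq.
Qed.
End Polarization.

(** * Power series on the disc *)

Section PowerSeries.
Variable R : realType.
Local Notation C := (Cx R).
Implicit Types (a b : nat -> C) (f g : disc R -> C) (z : disc R).

Lemma disc_nr z : nr (z : C) < 1.
Proof.
have h : `|(z : C)| < 1 by exact: valP z.
by rewrite -rc_lt -normrE rc1.
Qed.
Lemma disc_sqn z : sqn (z : C) < 1.
Proof. by rewrite -nr2 expr_lt1 ?nr_ge0// disc_nr. Qed.

Lemma disc_ex (x : C) : nr x < 1 -> exists z : disc R, z = x :> C.
Proof.
move=> h; have h' : `|x| < 1 by rewrite normrE -rc1 rc_lt.
by exists (exist _ x h').
Qed.

Lemma geo_le (q : R) n : 0 <= q -> q < 1 -> series (fun k => q ^+ k) n <= (1 - q)^-1.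
Proof.
move=> q0 q1; have q1' : 0 < 1 - q by rewrite subr_gt0.
rewrite -[leRHS]mul1r ler_pdivlMr// mulrC.
have -> : (1 - q) * series (fun k => q ^+ k) n = 1 - q ^+ n.
  elim: n => [|n IH]; first by rewrite series0 mulr0 expr0 subrr.
  by rewrite seriesSr mulrDr IH exprSr; ring.
by rewrite gerBl exprn_ge0.
Qed.

Lemma geo_lim (q : R) : 0 <= q -> q < 1 -> (fun n => q ^+ n) @ \oo --> (0 : R).
Proof. by move=> q0 q1; apply: cvg_expr; rewrite ger0_norm. Qed.

Lemma ps_abs a (B : R) z : (forall k, nr (a k) <= B) ->
  exists s : C, series (fun k => a k * (z : C) ^+ k) @ \oo --> s.
Proof.
move=> hB; have B0 : 0 <= B by rewrite (le_trans (nr_ge0 (a 0)))// hB.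
apply: (@abs_series_cvg R _ (B * (1 - nr (z : C))^-1)) => n.
rewrite (@le_trans _ _ (B * series (fun k => nr (z : C) ^+ k) n))//; last first.
  by rewrite ler_wpM2l// geo_le ?nr_ge0 ?disc_nr.
rewrite !seriesOE mulr_sumr ler_sum// => k _.
by rewrite nrM nrX ler_wpM2r// exprn_ge0// nr_ge0.
Qed.

Definition fn a : disc R -> C := fun z => limn (series (fun k => a k * (z : C) ^+ k)).

Lemma fnP a (B : R) : (forall k, nr (a k) <= B) -> power_series_of (fn a) a.
Proof.
move=> hB z; have [s hs] := ps_abs z hB.
by rewrite /fn (cvgC_lim hs).
Qed.

Lemma cvgCD (u v : nat -> C) (x y : C) : u @ \oo --> x -> v @ \oo --> y ->
  (fun n => u n + v n) @ \oo --> x + y.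
Proof.
move=> /cvgC_reim[hu hu'] /cvgC_reim[hv hv']; apply/cvgC_reim; rewrite reD imD; split.
  by rewrite (_ : _ \o _ = (@re R \o u) \+ (@re R \o v)); [apply: cvgD|apply/funext => n /=; rewrite reD].
by rewrite (_ : _ \o _ = (@im R \o u) \+ (@im R \o v)); [apply: cvgD|apply/funext => n /=; rewrite imD].
Qed.
Lemma cvgCM (u v : nat -> C) (x y : C) : u @ \oo --> x -> v @ \oo --> y ->
  (fun n => u n * v n) @ \oo --> x * y.
Proof.
move=> /cvgC_reim[hu hu'] /cvgC_reim[hv hv']; apply/cvgC_reim; rewrite reM imM; split.
  rewrite (_ : _ \o _ = (@re R \o u) \* (@re R \o v) \- (@im R \o u) \* (@im R \o v)).
    by apply: cvgB; apply: cvgM.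
  by apply/funext => n /=; rewrite reM.
rewrite (_ : _ \o _ = (@re R \o u) \* (@im R \o v) \+ (@im R \o u) \* (@re R \o v)).
  by apply: cvgD; apply: cvgM.
by apply/funext => n /=; rewrite imM.
Qed.
Lemma cvgCc (x : C) : (fun _ : nat => x) @ \oo --> x.
Proof. by apply/cvgCP => e e0; exists 0%N => n _; rewrite subrr nr0. Qed.
Lemma cvgCB (u v : nat -> C) (x y : C) : u @ \oo --> x -> v @ \oo --> y ->
  (fun n => u n - v n) @ \oo --> x - y.
Proof.
move=> hu hv; have h := cvgCD hu (cvgCM (@cvgCc (- 1)) hv).
rewrite mulN1r in h; apply: cvg_trans h; apply: near_eq_cvg.
by apply: nearW => n; rewrite mulN1r.
Qed.
Lemma cvgCZ c (u : nat -> C) (x : C) : u @ \oo --> x -> (fun n => c * u n) @ \oo --> c * x.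
Proof. by move=> h; exact: (cvgCM (@cvgCc c) h). Qed.
Lemma cvgC_sum n (u : 'I_n -> nat -> C) (l : 'I_n -> C) :
  (forall i, u i @ \oo --> l i) -> (fun k => \sum_i u i k) @ \oo --> \sum_i l i.
Proof.
elim: n u l => [|n IH] u l h.
  rewrite big_ord0 (_ : (fun _ => _) = fun _ => 0); first exact: cvgCc.
  by apply/funext => k; rewrite big_ord0.
rewrite big_ord_recl (_ : (fun _ => _) = (fun k => u ord0 k + \sum_(i < n) u (lift ord0 i) k)).
  by apply: cvgCD; [exact: h | exact: IH].
by apply/funext => k; rewrite big_ord_recl.
Qed.
Lemma cvgCS (u : nat -> C) (x : C) : (fun n => u n.+1) @ \oo --> x <-> u @ \oo --> x.
Proof.
split=> /cvgCP h; apply/cvgCP => e /h[N hN].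
  by exists N.+1 => -[//|n] /hN.
by exists N => n Nn; apply: hN; apply: leqW.
Qed.

Lemma seriesP (c : C) a b n :
  series (fun k => c * a k + b k) n = c * series a n + series b n.
Proof. by rewrite !seriesOE big_split mulr_sumr. Qed.

Lemma psP (c : C) f g a b : power_series_of f a -> power_series_of g b ->
  power_series_of (c *: f + g) (fun k => c * a k + b k).
Proof.
move=> ha hb z.
have -> : (c *: f + g) z = c * f z + g z by [].
have -> : series (fun k => (c * a k + b k) * (z : C) ^+ k) =
    (fun n => c * series (fun k => a k * (z : C) ^+ k) n + series (fun k => b k * (z : C) ^+ k) n).
  apply/funext => n; rewrite -seriesP; congr (series _ n); apply/funext => k; ring.
by apply: cvgCD; [apply: cvgCZ; apply: ha | apply: hb].
Qed.

(** The terms of a series converging at a point of modulus x are bounded there. *)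
Lemma ps_bound f a (x : R) : power_series_of f a -> 0 <= x -> x < 1 ->
  exists2 B : R, 0 <= B & forall k, nr (a k) * x ^+ k <= B.
Proof.
move=> ha x0 x1; have [z zx] : exists z : disc R, z = rc x :> C.
  by apply: disc_ex; rewrite nr_rc ger0_norm.
have /cvgCP/(_ 1 ltr01)[N hN] := ha z.
have [B0 hB0] : exists B0 : R, forall k, (k < N)%N -> nr (a k) * x ^+ k <= B0.
  exists (\sum_(k < N) nr (a k) * x ^+ k) => k kN.
  rewrite (bigD1 (Ordinal kN))//= lerDl sumr_ge0// => i _.
  by rewrite mulr_ge0 ?nr_ge0 ?exprn_ge0.
exists (`|B0| + 2) => [|k]; first by rewrite addr_ge0.
have [kN|Nk] := ltnP k N.
  by rewrite (le_trans (hB0 _ kN))// (le_trans (ler_norm _))// lerDl.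
have := hN _ Nk; have := hN _ (leqW Nk); rewrite seriesSr.
set s := series _ _ => h1 h2.
have -> : nr (a k) * x ^+ k = nr (a k * (z : C) ^+ k).
  by rewrite nrM nrX zx nr_rc ger0_norm.
set w := _ * _ in h1 *.
have := nrD (s + w - f z) (f z - s); rewrite [nr (f z - s)]nrB.
have -> : s + w - f z + (f z - s) = w by ring.
by have := normr_ge0 B0; lra.
Qed.

(** The terms past the first are at most B 2^k x^k at a point of modulus x, so their
    sum is of order x, and x may tend to 0. *)
Lemma ps_head0 a : (forall z, (z : C) != 0 ->
  series (fun k => a k * (z : C) ^+ k) @ \oo --> (0 : C)) -> a 0 = 0.
Proof.
move=> ha; pose f z : C := if (z : C) == 0 then a 0 else 0.
have fa : power_series_of f a.
  move=> z; rewrite /f; have [z0|z0] := eqVneq (z : C) 0; last exact: ha.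
  rewrite z0; apply/cvgCS; rewrite (_ : (fun n => _) = fun _ => a 0); first exact: cvgCc.
  apply/funext => n; rewrite seriesSl expr0 mulr1 seriesOE big1 ?addr0// => i _.
  by rewrite exprS mul0r mulr0.
have [B B0 hB] := @ps_bound _ _ 2^-1 fa ltac:(by rewrite invr_ge0) ltac:(lra).
apply: nr_eq0; apply/eqP; rewrite eq_le nr_ge0 andbT; apply/ler_addgt0Pr => e e0.
rewrite add0r.
have [x [x0 x1 xe]] : exists x : R, [/\ 0 < x, x <= 4^-1 & 4 * B * x <= e / 2].
  have D1 : 0 < B + 1 by rewrite ltr_wpDl.
  have q0 : 0 < e / (8 * (B + 1)) by rewrite divr_gt0// mulr_gt0.
  exists (Num.min 4^-1 (e / (8 * (B + 1)))); split.
  - by rewrite lt_min q0 invr_gt0 ltr0n.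
  - by rewrite ge_min lexx.
  - have -> : e / 2 = 4 * (B + 1) * (e / (8 * (B + 1))) by field; rewrite gt_eqF.
    by rewrite ler_pM ?mulr_ge0// ?le_min ?(ltW q0) ?invr_ge0 ?ler0n//;
      [rewrite ler_pM2l ?ltr0n// lerDl|rewrite ge_min lexx orbT].
have [z zx] : exists z : disc R, z = rc x :> C.
  by apply: disc_ex; rewrite nr_rc gtr0_norm//; lra.
have z0 : (z : C) != 0.
  by apply/eqP => /(congr1 (@re R)); rewrite zx re_rc re0 => x00; rewrite x00 ltxx in x0.
have e2 : 0 < e / 2 by lra.
have /cvgCP/(_ _ e2)[N hN] := ha z z0; have := hN N.+1 (leqnSn N).
rewrite subr0 seriesSl expr0 mulr1; set s := series _ N.
have hs : nr s <= 4 * B * x.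
  rewrite /s seriesOE (le_trans (nr_sum _ _ _))//.
  apply: (@le_trans _ _ (2 * B * x * series (fun k => 2^-1 ^+ k) N)).
    rewrite seriesOE mulr_sumr ler_sum// => k _.
    rewrite nrM nrX zx nr_rc gtr0_norm//.
    apply: (@le_trans _ _ (B * 2 ^+ k.+1 * x ^+ k.+1)).
      rewrite ler_wpM2r ?exprn_ge0 ?(ltW x0)//.
      by have := hB k.+1; rewrite exprVn -ler_pdivlMr ?invr_gt0 ?exprn_gt0// invrK.
    have -> : B * 2 ^+ k.+1 * x ^+ k.+1 = 2 * B * x * (2 * x) ^+ k.
      by rewrite !exprS exprMn; ring.
    rewrite ler_wpM2l ?mulr_ge0 ?(ltW x0)//.
    by rewrite lerXn2r ?nnegrE ?mulr_ge0 ?invr_ge0 ?(ltW x0)//; lra.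
  have := @geo_le 2^-1 N ltac:(by rewrite invr_ge0) ltac:(lra).
  have -> : (1 - 2^-1)^-1 = 2 :> R by field.
  have -> : 4 * B * x = 2 * B * x * 2 by ring.
  by move=> h; rewrite ler_wpM2l ?mulr_ge0 ?(ltW x0).
have := nrD (a 0 + s) (- s); rewrite addrK nrN; lra.
Qed.

(** The leading coefficient is the limit at 0, and the series may be divided by z
    away from 0. *)
Lemma ps_zero a : power_series_of (fun _ => 0 : C) a -> a = fun _ => 0.
Proof.
move=> ha; apply/funext => k.
have {ha} : forall z, (z : C) != 0 -> series (fun k => a k * (z : C) ^+ k) @ \oo --> (0 : C).
  by move=> z _; exact: ha.
elim: k a => [|k IH] a ha; first exact: ps_head0.
apply: (IH (fun k => a k.+1)) => z z0; have a0 := ps_head0 ha.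
have h := (cvgCS _ _).2 (ha z z0); have := @cvgCZ (z : C)^-1 _ _ h; rewrite mulr0 => h'.
rewrite (_ : series _ = fun n => (z : C)^-1 * series (fun k => a k * (z : C) ^+ k) n.+1)//.
apply/funext => n; rewrite seriesSl a0 mul0r add0r !seriesOE mulr_sumr.
by apply: eq_bigr => i _; rewrite exprS mulrCA mulKf.
Qed.

Lemma ps_uniq f a b : power_series_of f a -> power_series_of f b -> a = b.
Proof.
move=> ha hb; have h := @psP (- 1) f f a b ha hb.
have z0 : -1 *: f + f = (fun _ => 0 : C) by rewrite scaleN1r addNr.
rewrite z0 in h; have /ps_zero h0 := h; apply/funext => k.
by have /(congr1 (@^~ k)) /= := h0; rewrite mulN1r addrC => /subr0_eq.
Qed.

(** Opaque copies of the Taylor coefficients, the inner product and the Hardy space: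
    their definitions choose a power series, and conversion must not compare such
    choices at two different functions. *)
Fact coef_sig : {c : (disc R -> C) -> nat -> C | c = @taylor R}.
Proof. by exists (@taylor R). Qed.
Definition coef := sval coef_sig.
Lemma coef_taylor : @taylor R = coef. Proof. by rewrite /coef (svalP coef_sig). Qed.

Fact hip_sig : {c : (disc R -> C) -> (disc R -> C) -> C | c = @ip R}.
Proof. by exists (@ip R). Qed.
Definition hip := sval hip_sig.
Lemma hip_ip : @ip R = hip. Proof. by rewrite /hip (svalP hip_sig). Qed.
Lemma hipE f g : hip f g = limn (series (fun k => coef f k * (coef g k)^*)).
Proof. by rewrite -hip_ip /ip coef_taylor. Qed.

Fact hardy_sig : {S : set (disc R -> C) | S = @H2 R}.
Proof. by exists (@H2 R). Qed.
Definition hardy := sval hardy_sig.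
Lemma hardy_H2 : @H2 R = hardy. Proof. by rewrite /hardy (svalP hardy_sig). Qed.

Lemma coefE f a : power_series_of f a -> coef f = a.
Proof.
move=> ha; rewrite -coef_taylor; apply: (ps_uniq (f := f)) => //.
exact: (getPex (P := power_series_of f) (ex_intro _ a ha)).
Qed.

Lemma coefP f : analytic f -> power_series_of f (coef f).
Proof. by move=> [a ha]; rewrite (coefE ha). Qed.

End PowerSeries.
Arguments cvgCZ {R} c {u x} _.
Arguments cvgCc {R} x.
Arguments psP {R} c {f g a b} _ _.

(** * The Hardy space *)

Section HardySpace.
Variable R : realType.
Local Notation C := (Cx R).
Implicit Types (a b : nat -> C) (f g : disc R -> C) (z : disc R).
Local Notation H2 := (@hardy R).
Local Notation ip := (@hip R).
Local Notation nsq := (sqnorm ip).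

Definition l2 a := exists B : R, forall n, series (fun k => sqn (a k)) n <= B.

Lemma sqn_series_ge a k n : (k < n)%N -> sqn (a k) <= series (fun k => sqn (a k)) n.
Proof.
move=> kn; rewrite seriesOE (bigD1 (Ordinal kn))//= lerDl sumr_ge0// => i _.
exact: sqn_ge0.
Qed.

Lemma l2_bdd a : l2 a -> exists B : R, forall k, nr (a k) <= B.
Proof.
move=> [B hB]; exists (1 + B) => k.
have := le_trans (sqn_series_ge a (ltnSn k)) (hB _); rewrite -nr2.
have := nr_ge0 (a k); nra.
Qed.

Lemma l2P (c : C) a b : l2 a -> l2 b -> l2 (fun k => c * a k + b k).
Proof.
move=> [A hA] [B hB]; exists (2 * (sqn c * A + B)) => n.
rewrite (@le_trans _ _ (2 * (sqn c * series (fun k => sqn (a k)) n + series (fun k => sqn (b k)) n)))//.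
  rewrite !seriesOE !mulr_sumr -big_split mulr_sumr ler_sum// => i _ /=.
  by rewrite (le_trans (sqnD _ _))// sqnM.
by rewrite ler_pM2l// lerD// ler_wpM2l// sqn_ge0.
Qed.

Lemma fn_l2 a : l2 a -> power_series_of (fn a) a.
Proof. by move=> /l2_bdd[B hB]; apply: fnP hB. Qed.

Lemma H2E f : H2 f <-> exists2 a, l2 a & power_series_of f a.
Proof.
rewrite -hardy_H2; split=> [[[a ha] /cvg_ex[l hl]]|[a [B hB] ha]].
  exists a => //; rewrite coef_taylor (coefE ha) in hl; exists (re l) => n.
  have [hl' _] := (cvgC_reim _ _).1 hl.
  apply: (cvg_series_le (fun k => sqn_ge0 (a k))).
  rewrite (_ : series _ = @re R \o series (fun k => `|a k| ^+ 2))//.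
  apply/funext => m /=; rewrite !seriesOE re_sum; apply: eq_bigr => i _.
  by rewrite normr2E re_rc.
split; first by exists a.
rewrite coef_taylor (coefE ha).
have [s hs _] := bounded_series_cvg (fun k => sqn_ge0 (a k)) hB.
apply/cvg_ex; exists (rc s); apply/cvgC_reim; split.
  rewrite (_ : _ \o _ = series (fun k => sqn (a k)))//.
  apply/funext => m /=; rewrite !seriesOE re_sum; apply: eq_bigr => i _.
  by rewrite normr2E re_rc.
rewrite (_ : _ \o _ = fun _ => 0); first exact: cvg_cst.
apply/funext => m /=; rewrite !seriesOE im_sum big1// => i _.
by rewrite normr2E.
Qed.

Lemma H2_analytic f : H2 f -> analytic f. Proof. by rewrite -hardy_H2 => -[]. Qed.
Lemma H2_ps f : H2 f -> power_series_of f (coef f). Proof. by move=> /H2_analytic/coefP. Qed.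
Lemma H2_l2 f : H2 f -> l2 (coef f).
Proof. by move=> /H2E[a ha fa]; rewrite (coefE fa). Qed.
Lemma H2_fn a : l2 a -> H2 (fn a).
Proof. by move=> ha; apply/H2E; exists a => //; apply: fn_l2. Qed.
Lemma coef_fn a : l2 a -> coef (fn a) = a.
Proof. by move=> ha; apply/coefE/fn_l2. Qed.
Lemma ps_fun f g a : power_series_of f a -> power_series_of g a -> f = g.
Proof. by move=> hf hg; apply/funext => z; apply: cvgC_uniq (hf z) (hg z). Qed.
Lemma H2_eq f g : H2 f -> H2 g -> coef f = coef g -> f = g.
Proof. by move=> /H2_ps hf /H2_ps hg e; apply: (ps_fun hf); rewrite e. Qed.

Lemma coef_lin c f g : analytic f -> analytic g ->
  coef (c *: f + g) = fun k => c * coef f k + coef g k.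
Proof. by move=> /coefP hf /coefP hg; apply: coefE; apply: psP. Qed.

Lemma ps0 : power_series_of (0 : disc R -> C) (fun _ => 0).
Proof.
move=> z; rewrite (_ : series _ = fun _ => 0); first exact: cvgCc.
by apply/funext => n; rewrite seriesOE big1// => i _; rewrite mul0r.
Qed.
Lemma coef0 : coef (0 : disc R -> C) = fun _ => 0.
Proof. exact: coefE ps0. Qed.

Lemma H2_lin : linear_subspace H2.
Proof.
split=> [|c f g /H2E[a la ha] /H2E[b lb hb]].
  apply/H2E; exists (fun _ => 0); last exact: ps0.
  by exists 0 => n; rewrite seriesOE big1// => i _; rewrite sqn0.
apply/H2E; exists (fun k => c * a k + b k); first exact: l2P.
exact: psP.
Qed.

Lemma l2_ip_cvg a b : l2 a -> l2 b ->
  exists s : C, series (fun k => a k * (b k)^*) @ \oo --> s.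
Proof.
move=> [A hA] [B hB]; apply: (@abs_series_cvg R _ (A + B)) => n.
rewrite (le_trans _ (lerD (hA n) (hB n)))// !seriesOE -big_split ler_sum// => i _ /=.
rewrite nrM nrJ -!nr2; have := sqr_ge0 (nr (a i) - nr (b i)).
have := nr_ge0 (a i); have := nr_ge0 (b i); nra.
Qed.

Lemma ip_cvg f g : H2 f -> H2 g ->
  series (fun k => coef f k * (coef g k)^*) @ \oo --> ip f g.
Proof.
move=> /H2_l2 hf /H2_l2 hg; have [s hs] := l2_ip_cvg hf hg.
by rewrite hipE (cvgC_lim hs).
Qed.

Lemma nsq_cvg f : H2 f -> series (fun k => sqn (coef f k)) @ \oo --> nsq f.
Proof.
move=> hf; have /cvgC_reim[+ _] := ip_cvg hf hf.
rewrite (_ : _ \o _ = series (fun k => sqn (coef f k)))//.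
apply/funext => m /=; rewrite !seriesOE re_sum; apply: eq_bigr => i _.
by rewrite mulJ re_rc.
Qed.

Lemma nsq_series f n : H2 f -> series (fun k => sqn (coef f k)) n <= nsq f.
Proof. by move=> /nsq_cvg h; apply: cvg_series_le h n => k; apply: sqn_ge0. Qed.

Lemma sqn_coef f k : H2 f -> sqn (coef f k) <= nsq f.
Proof. by move=> hf; rewrite (le_trans (sqn_series_ge _ (ltnSn k)))// nsq_series. Qed.

Lemma cvgR_le (u : nat -> R) (l B : R) : u @ \oo --> l -> (forall n, u n <= B) -> l <= B.
Proof.
move=> hu hB; have <- : limn u = l by exact: cvg_lim.
by apply: limr_le; [apply/cvg_ex; exists l | apply: nearW].
Qed.

Lemma nsq_le f (B : R) : H2 f -> (forall n, series (fun k => sqn (coef f k)) n <= B) -> nsq f <= B.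
Proof. by move=> /nsq_cvg h hB; apply: cvgR_le h hB. Qed.

Lemma cvg_sqn (u : nat -> C) (x : C) : u @ \oo --> x -> @sqn R \o u @ \oo --> sqn x.
Proof.
move=> /cvgC_reim[hr hi]; rewrite /sqn.
rewrite (_ : _ \o _ = (@re R \o u) \* (@re R \o u) \+ (@im R \o u) \* (@im R \o u)).
  by apply: cvgD; apply: cvgM.
by apply/funext.
Qed.

Lemma cvg_series_sqn (u : nat -> nat -> C) (x : nat -> C) K :
  (forall k, (fun n => u n k) @ \oo --> x k) ->
  (fun n => series (fun k => sqn (u n k)) K) @ \oo --> series (fun k => sqn (x k)) K.
Proof.
move=> h; elim: K => [|K IH].
  by rewrite (_ : (fun n => _) = fun _ => 0) ?series0; [exact: cvg_cst|apply/funext => n; rewrite series0].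
rewrite seriesSr (_ : (fun n => _) = (fun n => series (fun k => sqn (u n k)) K) \+ (fun n => sqn (u n K))).
  by apply: cvgD => //; apply: cvg_sqn (h K).
by apply/funext => n /=; rewrite seriesSr.
Qed.

Lemma coefB f g : H2 f -> H2 g -> coef (f - g) = fun k => coef f k - coef g k.
Proof.
move=> /H2_analytic hf /H2_analytic hg.
have -> : f - g = (- 1 : C) *: g + f by rewrite scaleN1r addrC.
rewrite (@coef_lin (- 1) g f hg hf); apply/funext => k.
by rewrite mulN1r addrC.
Qed.

Lemma cvg_ipJ a b (s : C) : series (fun k => a k * (b k)^*) @ \oo --> s ->
  series (fun k => b k * (a k)^*) @ \oo --> s^*.
Proof.
move=> /cvgC_reim[hr hi]; apply/cvgC_reim; rewrite reJ imJ; split.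
  have -> : @re R \o series (fun k => b k * (a k)^*) = @re R \o series (fun k => a k * (b k)^*).
    apply/funext => n; rewrite /= !seriesOE !re_sum; apply: eq_bigr => k _.
    by rewrite !reimE; ring.
  exact: hr.
have -> : @im R \o series (fun k => b k * (a k)^*) = \- (@im R \o series (fun k => a k * (b k)^*)).
  apply/funext => n; rewrite /= !seriesOE !im_sum -sumrN; apply: eq_bigr => k _.
  by rewrite !reimE; ring.
exact: (cvgN hi).
Qed.

(** Completeness is that of square summable sequences: coefficients converge one by
    one, and the bound on partial sums of the differences survives the limit. *)
Lemma H2_hilbert : hilbert H2 ip.
Proof.
split; first exact: H2_lin.
- move=> c f g h Hf Hg Hh.
  have Hcfg : H2 (c *: f + g) by apply: (linP H2_lin).
  apply: (cvgC_uniq (ip_cvg Hcfg Hh)).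
  have e := cvgCD (cvgCZ c (ip_cvg Hf Hh)) (ip_cvg Hg Hh).
  rewrite (_ : series _ = (fun n => c * series (fun k => coef f k * (coef h k)^*) n +
     series (fun k => coef g k * (coef h k)^*) n))//.
  apply/funext => n; rewrite -seriesP; congr (series _ n); apply/funext => k.
  by rewrite coef_lin ?mulrDl ?mulrA//; apply: H2_analytic.
- by move=> f g Hf Hg; apply: (cvgC_uniq (ip_cvg Hg Hf)); apply/cvg_ipJ/ip_cvg.
- move=> f Hf; apply: le_trans (nsq_series 0 Hf); by rewrite series0.
- move=> f Hf f0; apply: H2_eq => //; first by case: H2_lin.
  rewrite coef0; apply/funext => k; apply: sqn_eq0; apply/eqP.
  by rewrite eq_le sqn_ge0 andbT -f0 sqn_coef.
move=> u Hu hC.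
have Huv m n : H2 (u m - u n) by exact: (linB H2_lin).
have /choice[x hx] k : exists x : C, (fun n => coef (u n) k) @ \oo --> x.
  apply: cauchyC => e e0; have [N hN] := hC _ (exprn_gt0 2 e0).
  exists N => m n Nm Nn; rewrite nr_lt_sqn// (le_lt_trans _ (hN _ _ Nm Nn))//.
  by have := sqn_coef k (Huv m n); rewrite coefB.
have close e : 0 < e -> exists N, forall n, (N <= n)%N -> forall K,
    series (fun k => sqn (coef (u n) k - x k)) K <= e.
  move=> e0; have [N hN] := hC _ e0; exists N => n Nn K.
  have lim : (fun m => series (fun k => sqn (coef (u n) k - coef (u (m + N)%N) k)) K) @ \oo -->
      series (fun k => sqn (coef (u n) k - x k)) K.
    apply: cvg_series_sqn => k; apply: cvgCB; first exact: cvgCc.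
    have /cvgCP h := hx k; apply/cvgCP => d /h[M hM]; exists M => m Mm.
    by apply: hM; rewrite (leq_trans Mm)// leq_addr.
  apply: cvgR_le lim _ => m; have Nm := leq_addl m N.
  rewrite (le_trans _ (ltW (hN _ _ Nn Nm)))//.
  by have := nsq_series K (Huv n (m + N)%N); rewrite coefB.
have lx : l2 x.
  have [N hN] := close 1 ltr01.
  have := @l2P (-1) _ _ (ex_intro _ 1 (hN N (leqnn N))) (H2_l2 (Hu N)).
  by congr l2; apply/funext => k; ring.
exists (fn x); first exact: H2_fn.
move=> e e0; have e2 : 0 < e / 2 by lra.
have [N hN] := close _ e2; exists N => n Nn.
have Hd : H2 (u n - fn x) by apply: (linB H2_lin) => //; apply: H2_fn.
rewrite (@le_lt_trans _ _ (e / 2))//; last by lra.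
apply: nsq_le => // K; rewrite coefB//; last exact: H2_fn.
by rewrite coef_fn//; apply: hN.
Qed.

(** The kernel function at z has the coefficients conj(z)^k. *)
Lemma repro_kernel z : exists k : disc R -> C, [/\ H2 k,
  forall f, H2 f -> f z = ip f k, 0 < nsq k & nsq k <= (1 - sqn (z : C))^-1].
Proof.
have bd n : series (fun k => sqn ((z : C) ^+ k)^*) n <= (1 - sqn (z : C))^-1.
  rewrite (le_trans _ (geo_le n _ (disc_sqn z))) ?sqn_ge0//.
  by rewrite !seriesOE ler_sum// => i _; rewrite sqnJ sqnX.
have lz : l2 (fun k => ((z : C) ^+ k)^*) by exists (1 - sqn (z : C))^-1.
have Hk := H2_fn lz; exists (fn (fun k => ((z : C) ^+ k)^*)); split=> // [f Hf||].
- have h : series (fun k => coef f k * (z : C) ^+ k) @ \oo --> f z := @H2_ps f Hf z.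
  have h' := ip_cvg Hf Hk; rewrite coef_fn// in h'.
  have E : (fun j => coef f j * ((z : C) ^+ j)^*^*) = fun j => coef f j * (z : C) ^+ j.
    by apply/funext => j; rewrite conjCK.
  by rewrite E in h'; apply: cvgC_uniq h h'.
- apply: lt_le_trans (sqn_coef 0 Hk); rewrite coef_fn// expr0 rmorph1 sqn1.
  exact: ltr01.
- by apply: nsq_le => // n; rewrite coef_fn.
Qed.

(** The Cauchy-Schwarz inequality against the kernel function. *)
Lemma eval_bound f z : H2 f -> sqn (f z) <= nsq f / (1 - sqn (z : C)).
Proof.
move=> Hf; have [k [Hk rep _ kz]] := repro_kernel z; rewrite rep//.
rewrite (le_trans (cauchy_schwarz H2_hilbert Hf Hk))// ler_wpM2l//.
exact: (nsq_ge0 H2_hilbert).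
Qed.

(** The backward shift. *)
Definition bshift f : disc R -> C := fn (fun k => coef f k.+1).

Lemma l2S a : l2 a -> l2 (fun k => a k.+1).
Proof.
move=> [B hB]; exists B => n; apply: le_trans (hB n.+1).
by rewrite seriesSl lerDr sqn_ge0.
Qed.

Lemma H2_bshift f : H2 f -> H2 (bshift f).
Proof. by move=> /H2_l2/l2S/H2_fn. Qed.
Lemma coef_bshift f : H2 f -> coef (bshift f) = fun k => coef f k.+1.
Proof. by move=> /H2_l2/l2S/coef_fn. Qed.

Lemma bshiftP c f g : H2 f -> H2 g -> bshift (c *: f + g) = c *: bshift f + bshift g.
Proof.
move=> Hf Hg; have Hcfg : H2 (c *: f + g) by apply: (linP H2_lin).
apply: H2_eq; rewrite ?coef_bshift//; first exact: H2_bshift.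
  by apply: (linP H2_lin); apply: H2_bshift.
rewrite !coef_lin ?coef_bshift//; apply: H2_analytic => //; exact: H2_bshift.
Qed.

(** The coefficients of z f. *)
Definition shift_seq a : nat -> C := fun k => if k is k'.+1 then a k' else 0.

Lemma ps_Tz f a : power_series_of f a -> power_series_of (Tz f) (shift_seq a).
Proof.
move=> ha z; apply/cvgCS; rewrite /Tz.
rewrite (_ : (fun n => _) = fun n => (z : C) * series (fun k => a k * (z : C) ^+ k) n).
  by apply: cvgCZ; apply: ha.
apply/funext => n; rewrite seriesSl /= mul0r add0r !seriesOE mulr_sumr.
by apply: eq_bigr => k _; rewrite exprS; ring.
Qed.

Lemma coef_Tz f : analytic f -> coef (Tz f) = shift_seq (coef f).
Proof. by move=> /coefP h; apply: coefE; apply: ps_Tz. Qed.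

Lemma H2_Tz f : H2 f -> H2 (Tz f).
Proof.
move=> /H2E[a [B hB] ha]; apply/H2E; exists (shift_seq a); last exact: ps_Tz.
by exists B => -[|n]; rewrite ?seriesSl /= ?sqn0 ?add0r// (le_trans _ (hB 0%N))// !series0.
Qed.

Lemma bshift_Tz f : H2 f -> bshift (Tz f) = f.
Proof.
move=> Hf; have HT := H2_Tz Hf; apply: H2_eq => //; first exact: H2_bshift.
by rewrite coef_bshift// coef_Tz//; apply: H2_analytic.
Qed.

Lemma nsq_split f : H2 f -> nsq f = sqn (coef f 0) + nsq (bshift f).
Proof.
move=> Hf; have h1 := nsq_cvg Hf; have h2 := nsq_cvg (H2_bshift Hf).
rewrite coef_bshift// in h2.
have : (fun n => series (fun k => sqn (coef f k)) n.+1) @ \oo --> nsq f.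
  have /cvgRP h := h1; apply/cvgRP => e /h[N hN]; exists N => n Nn.
  by apply: hN; apply: leqW.
rewrite (_ : (fun n => _) = cst (sqn (coef f 0)) \+ series (fun k => sqn (coef f k.+1))).
  move=> h3; have h4 := cvgD (cvg_cst (sqn (coef f 0)) (F := \oo)) h2.
  by rewrite -(cvg_lim _ h3)// -(cvg_lim _ (h4 _ _)).
by apply/funext => n /=; rewrite seriesSl.
Qed.

Lemma coef_at0 f : analytic f -> coef f 0 = f (disc0 R).
Proof.
move=> /coefP/(_ (disc0 R)) h; apply: cvgC_uniq h.
apply/cvgCS; rewrite (_ : (fun n => _) = fun _ => coef f 0); first exact: cvgCc.
apply/funext => n; rewrite seriesSl expr0 mulr1 seriesOE big1 ?addr0// => i _.
by rewrite exprS mul0r mulr0.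
Qed.

Lemma Tz_bshift f : H2 f -> coef f 0 = 0 -> Tz (bshift f) = f.
Proof.
move=> Hf f0; apply: H2_eq => //; first exact/H2_Tz/H2_bshift.
rewrite coef_Tz; last exact/H2_analytic/H2_bshift.
by rewrite coef_bshift//; apply/funext => -[|k].
Qed.

(** Both series have the same partial sums, up to a shift of the index. *)
Lemma ip_Tz f g : analytic f -> analytic g -> H2 g -> ip (Tz f) g = ip f (bshift g).
Proof.
move=> hf hg Hg; rewrite !hipE coef_Tz// coef_bshift//.
set u := series (fun k => coef f k * _).
have E : (fun n => series (fun k => shift_seq (coef f) k * (coef g k)^*) n.+1) = u.
  by apply/funext => n; rewrite seriesSl /= mul0r add0r.
by congr (get _); apply/funext => l; apply/propext; rewrite -E cvgCS.
Qed.

Lemma Tz_starE f : H2 f -> Tz_star f = bshift f.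
Proof.
move=> Hf; rewrite /Tz_star hip_ip hardy_H2.
have spec : adjoint_spec H2 ip (@Tz R) f (bshift f).
  split; first exact: H2_bshift.
  by move=> x Hx; apply: ip_Tz => //; apply: H2_analytic.
have [Hs hs] := getPex (P := adjoint_spec H2 ip (@Tz R) f) (ex_intro _ _ spec).
case: spec => Hb hb; set s := get _ in Hs hs *.
apply/eqP; rewrite -subr_eq0; apply/eqP/(hilbert_def H2_hilbert).
  exact: (linB H2_lin).
have Hd : H2 (s - bshift f) by exact: (linB H2_lin).
by rewrite /sqnorm (ipBr H2_hilbert)// -hs// -hb// subrr.
Qed.

Lemma const_ps (w : C) : power_series_of (fun _ : disc R => w) (fun k => if k is 0 then w else 0).
Proof.
move=> z; apply/cvgCS; rewrite (_ : (fun n => _) = fun _ => w); first exact: cvgCc.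
apply/funext => n; rewrite seriesSl expr0 mulr1 seriesOE big1 ?addr0// => i _.
by rewrite mul0r.
Qed.

Lemma const_H2 (w : C) : H2 (fun _ : disc R => w).
Proof.
apply/H2E; exists (fun k => if k is 0 then w else 0); last exact: (@const_ps w).
exists (sqn w) => -[|n]; first by rewrite series0 sqn_ge0.
by rewrite seriesSl seriesOE big1 ?addr0// => i _; rewrite sqn0.
Qed.

End HardySpace.
Arguments const_ps {R} w.

(** * Strong stability of the compressed backward shift *)

Section StrongStability.
Variable R : realType.
Local Notation C := (Cx R).
Implicit Types (f h : disc R -> C).
Local Notation H2 := (@hardy R).
Local Notation ip := (@hip R).
Local Notation nsq := (sqnorm ip).
Let hH := H2_hilbert R.
Let HL := hilbert_lin hH.

Lemma nsq_bshift f : H2 f -> nsq (bshift f) <= nsq f.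
Proof. by move=> Hf; rewrite (nsq_split Hf) lerDr sqn_ge0. Qed.

Lemma H2_iter_bshift n f : H2 f -> H2 (iter n (@bshift R) f).
Proof. by move=> Hf; elim: n => //= n; apply: H2_bshift. Qed.

Lemma coef_iter_bshift n f k : H2 f -> coef (iter n (@bshift R) f) k = coef f (n + k).
Proof.
move=> Hf; elim: n k => // n IH k /=.
by rewrite coef_bshift ?IH ?addnS//; apply: H2_iter_bshift.
Qed.

Lemma nsq_iter_bshift n f : H2 f ->
  nsq f = series (fun k => sqn (coef f k)) n + nsq (iter n (@bshift R) f).
Proof.
move=> Hf; elim: n => [|n IH]; first by rewrite series0 add0r.
rewrite {1}IH seriesSr -addrA; congr (_ + _).
rewrite (nsq_split (H2_iter_bshift n Hf)) coef_iter_bshift// addn0.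
by congr (_ + nsq _); rewrite -iterS.
Qed.

(** The n-th backward shift drops the first n terms of a convergent series. *)
Lemma bshift_stable f (e : R) : H2 f -> 0 < e ->
  exists N, forall n, (N <= n)%N -> nsq (iter n (@bshift R) f) < e.
Proof.
move=> Hf e0; have /cvgRP/(_ e e0)[N hN] := nsq_cvg Hf.
exists N => n /hN; rewrite distrC (nsq_iter_bshift n Hf) addrC addKr.
exact: le_lt_trans (ler_norm _).
Qed.

Lemma sqn_sum n (x : 'I_n -> C) : sqn (\sum_i x i) <= 2 ^+ n * \sum_i sqn (x i).
Proof.
elim: n x => [|n IH] x; first by rewrite !big_ord0 sqn0 mulr0.
rewrite !big_ord_recr /= (le_trans (sqnD _ _))// exprS -mulrA ler_pM2l// mulrDr.
rewrite lerD// ler_peMl ?sqn_ge0//; apply: exprn_ege1; lra.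
Qed.

Variables (r : nat) (g : 'I_r -> disc R -> C).
Hypothesis og : orthonormal H2 ip g.
Let Hg i : H2 (g i). Proof. by case: og. Qed.

(** The part of h orthogonal to the family, shifted back. On a nearly invariant
    subspace with the basis g of its defect space, the part of f orthogonal to g
    vanishes at 0, so f is its projection on g plus z times this function. *)
Definition cshift h := bshift (h - onproj ip g h).

Lemma H2_onres h : H2 h -> H2 (h - onproj ip g h).
Proof. by move=> Hh; apply: (linB HL) => //; apply: onproj_in. Qed.

Lemma H2_cshift h : H2 h -> H2 (cshift h).
Proof. by move=> Hh; apply/H2_bshift/H2_onres. Qed.

Lemma H2_iter_cshift n h : H2 h -> H2 (iter n cshift h).
Proof. by move=> Hh; elim: n => //= n; apply: H2_cshift. Qed.

Lemma cshiftP c f h : H2 f -> H2 h -> cshift (c *: f + h) = c *: cshift f + cshift h.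
Proof.
move=> Hf Hh; rewrite /cshift -bshiftP; try exact: H2_onres.
congr (bshift _); rewrite (onprojP hH og)//.
by rewrite scalerBr opprD addrACA.
Qed.

Lemma iter_cshiftP n c f h : H2 f -> H2 h ->
  iter n cshift (c *: f + h) = c *: iter n cshift f + iter n cshift h.
Proof.
by move=> Hf Hh; elim: n => //= n ->; rewrite cshiftP//; apply: H2_iter_cshift.
Qed.

Lemma cshiftE h : H2 h -> cshift h = bshift h - \sum_i ip h (g i) *: bshift (g i).
Proof.
move=> Hh; rewrite /cshift -(linon_sum HL (@bshiftP R))//.
have -> : h - onproj ip g h = (- 1 : C) *: onproj ip g h + h by rewrite scaleN1r addrC.
by rewrite bshiftP ?scaleN1r 1?addrC//; apply: onproj_in.
Qed.

Lemma nsq_cshift h : H2 h -> nsq (cshift h) <= nsq h - \sum_i sqn (ip h (g i)).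
Proof.
by move=> Hh; rewrite -(nsq_onres hH og Hh) nsq_bshift//; apply: H2_onres.
Qed.

Lemma nsq_iter_cshift n k h : H2 h -> nsq (iter (n + k) cshift h) <= nsq (iter k cshift h).
Proof.
move=> Hh; elim: n => //= n; apply: le_trans.
rewrite (le_trans (nsq_cshift (H2_iter_cshift _ Hh)))// gerBl.
by apply: sumr_ge0 => i _; apply: sqn_ge0.
Qed.

(** Convolution with the response of the j-th output to the i-th input is a
    contraction of square summable sequences. The state s of the linear system
    driven by the input v loses at least the energy which is put out. *)
Lemma response_contraction i j (v : nat -> C) K :
  series (fun N => sqn (\sum_(l < N)
     v (N - l.+1)%N * ip (iter l cshift (bshift (g i))) (g j))) K <=
  series (fun N => sqn (v N)) K.
Proof.
pose b := bshift (g i); have Hb : H2 b by apply: H2_bshift.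
pose s := fix s N := if N is N'.+1 then cshift (s N') + v N' *: b else 0.
have Hs N : H2 (s N).
  elim: N => [|N IH] /=; first exact: (lin0 HL).
  by apply: (linD HL); [apply: H2_cshift | apply: (linZ HL)].
have sE N : s N = \sum_(l < N) v (N - l.+1)%N *: iter l cshift b.
  elim: N => [|N IH]; first by rewrite big_ord0.
  rewrite big_ord_recl /= subSS subn0 addrC; congr (_ + _).
  have HI l : H2 (iter l cshift b) by exact: H2_iter_cshift.
  by rewrite IH (linon_sum HL cshiftP)//; apply: eq_bigr => l _; rewrite subSS.
have energy N : nsq (s N.+1) + \sum_k sqn (ip (s N) (g k)) <= nsq (s N) + sqn (v N).
  have Hr := H2_onres (Hs N); have Hv := linZ HL (v N) (Hg i).
  have -> : s N.+1 = bshift (s N - onproj ip g (s N) + v N *: g i).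
    by rewrite (linonD (@bshiftP R))// (linonZ HL (@bshiftP R)).
  have h := nsq_bshift (linD HL Hr Hv); rewrite (nsqD hH)// in h.
  rewrite (ipZr hH)// (ip_onres hH og)// mulr0 re0 mulr0 addr0 in h.
  rewrite (nsq_onres hH og)// (nsqZ hH)// in h.
  have gi1 : nsq (g i) = 1 by rewrite /sqnorm; case: og => _ ->; rewrite eqxx.
  by rewrite gi1 mulr1 in h; lra.
suff : nsq (s K) + series (fun N => \sum_k sqn (ip (s N) (g k))) K <=
    series (fun N => sqn (v N)) K.
  apply: le_trans; rewrite ler_wpDl ?(nsq_ge0 hH)// !seriesOE ler_sum// => N _.
  have <- : ip (s N) (g j) = \sum_(l < N) v (N - l.+1)%N * ip (iter l cshift b) (g j).
    rewrite sE (ip_suml hH)//; last by move=> l _; apply/(linZ HL)/H2_iter_cshift.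
    by apply: eq_bigr => l _; rewrite (ipZl hH)//; apply: H2_iter_cshift.
  rewrite (bigD1 j)//=.
  by rewrite lerDl; apply: sumr_ge0 => k _; apply: sqn_ge0.
elim: K => [|K IH]; first by rewrite !series0 /= addr0 (nsq0 hH).
by rewrite !seriesSr; have := energy K; lra.
Qed.

(** Unrolling the recursion: each step is a backward shift minus a combination of the
    shifted family with the coefficients of the current iterate on the family. *)
Lemma coef_iter_cshift n h t : H2 h ->
  coef (iter n cshift h) t = coef h (n + t) -
    \sum_j \sum_(l < n) ip (iter l cshift h) (g j) * coef (g j) (n - l + t)%N.
Proof.
move=> Hh; elim: n t => [|n IH] t.
  by rewrite big1 ?subr0// => j _; rewrite big_ord0.
have HI := H2_iter_cshift n Hh.
have coef_sum (c : 'I_r -> C) k : coef (\sum_j c j *: bshift (g j)) k =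
    \sum_j c j * coef (g j) k.+1.
  have lin d x y : H2 x -> H2 y -> (fun f => coef f k : C^o) (d *: x + y) =
      d *: (fun f => coef f k : C^o) x + (fun f => coef f k : C^o) y.
    by move=> Hx Hy; rewrite coef_lin//; apply: H2_analytic.
  have := linon_sum HL lin c (fun j => H2_bshift (Hg j)) => /= ->.
  by apply: eq_bigr => j _; rewrite coef_bshift.
rewrite iterS cshiftE// coefB; last 2 first.
- exact: H2_bshift.
- by apply: (lin_sum HL) => j _; apply/(linZ HL)/H2_bshift.
rewrite coef_sum coef_bshift// IH addSnnS -addrA -opprD; congr (_ - _).
rewrite -big_split; apply: eq_bigr => j _ /=.
rewrite big_ord_recr /= subSnn add1n; congr (_ + _); apply: eq_bigr => l _.
by rewrite subSn ?addSnnS// ltnW.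
Qed.

Lemma cesaro_small (u : nat -> R) (e : R) : 0 < e -> (forall n, 0 <= u n) ->
  (forall d : R, 0 < d -> exists N, forall n, (N <= n)%N -> u n < d) ->
  exists N, forall n, (N <= n)%N -> series u n <= e * n%:R.
Proof.
move=> e0 u0 hu; have e2 : 0 < e / 2 by lra.
have [N hN] := hu _ e2.
have hS n : series u n <= series u N + e / 2 * n%:R.
  elim: n => [|n IH]; first by rewrite series0 mulr0 addr0 seriesOE sumr_ge0.
  have [nN|Nn] := ltnP n N.
    rewrite (@le_trans _ _ (series u N))//; last by rewrite lerDl mulr_ge0// ltW.
    have : nondecreasing_seq (series u).
      by apply/nondecreasing_seqP => k; rewrite seriesSr lerDl.
    exact.
  rewrite seriesSr -[n.+1%:R]natr1 mulrDr mulr1 addrA lerD//.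
  exact/ltW/hN.
have [M hM] : exists M, series u N / (e / 2) <= M%:R :> R.
  exists (Num.bound (series u N / (e / 2))); apply/ltW/archi_boundP.
  by rewrite divr_ge0 ?(ltW e2)// seriesOE sumr_ge0.
exists M => n Mn; rewrite (le_trans (hS n))//.
have : series u N <= e / 2 * n%:R.
  by rewrite mulrC -ler_pdivrMr// (le_trans hM)// ler_nat.
lra.
Qed.

(** The iterates on the shifted family are convolutions of the iterates of the
    backward shift, which tend to 0, with contractions. So the means of their
    squared norms tend to 0, and these norms decrease. *)
Lemma cshift_null_family i (e : R) : 0 < e ->
  exists N, nsq (iter N cshift (bshift (g i))) < e.
Proof.
move=> e0; pose b := bshift (g i); have Hb : H2 b by apply: H2_bshift.
pose sg N := \sum_j nsq (iter N.+1 (@bshift R) (g j)).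
pose D : R := 2 * (1 + 2 ^+ r).
have D0 : 0 < D by rewrite /D; have := exprn_ge0 r (ler0n R 2); lra.
have tail j N T : series (fun t => sqn (coef (g j) (N + t).+1)) T <= nsq (iter N.+1 (@bshift R) (g j)).
  have := nsq_series T (H2_iter_bshift N.+1 (Hg j)).
  congr (series _ T <= _); apply/funext => t.
  by rewrite coef_iter_bshift// addSn.
have main K : \sum_(N < K) nsq (iter N cshift b) <= D * series sg K.
  have bd T : \sum_(N < K) series (fun t => sqn (coef (iter N cshift b) t)) T <= D * series sg K.
    have pt t : \sum_(N < K) sqn (coef (iter N cshift b) t) <=
        2 * (\sum_(N < K) sqn (coef (g i) (N + t).+1) +
             2 ^+ r * \sum_j \sum_(N < K) sqn (coef (g j) (N + t).+1)).
      rewrite (@le_trans _ _ (2 * (\sum_(N < K) sqn (coef (g i) (N + t).+1) +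
        2 ^+ r * \sum_j \sum_(N < K) sqn (\sum_(l < N) coef (g j) (N - l.+1 + t).+1 *
           ip (iter l cshift b) (g j)))))//.
        rewrite exchange_big mulr_sumr -big_split mulr_sumr ler_sum// => N _ /=.
        rewrite coef_iter_cshift// coef_bshift// (le_trans (sqnD _ _))//.
        rewrite ler_pM2l// lerD2l// sqnN (le_trans (sqn_sum _))// ler_pM2l ?exprn_gt0//.
        rewrite le_eqVlt; apply/orP; left; apply/eqP; apply: eq_bigr => j _; congr sqn.
        by apply: eq_bigr => l _; rewrite mulrC -addSn -subSn ?subSS.
      rewrite ler_pM2l// lerD2l ler_pM2l ?exprn_gt0// ler_sum// => j _.
      have := response_contraction i j (fun N => coef (g j) (N + t).+1) K.
      by rewrite !seriesOE.
    under eq_bigr do rewrite seriesOE.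
    rewrite exchange_big/=; apply: le_trans; first by apply: ler_sum => t _; exact: pt.
    rewrite -mulr_sumr /D -mulrA ler_pM2l// big_split/= mulrDl mul1r lerD//.
      rewrite exchange_big seriesOE ler_sum// => N _ /=.
      rewrite /sg (bigD1 i)//= -[leLHS]addr0 lerD//.
        by have := tail i N T; rewrite seriesOE.
      by apply: sumr_ge0 => j _; apply/(nsq_ge0 hH)/H2_bshift/H2_iter_bshift.
    rewrite -mulr_sumr ler_pM2l ?exprn_gt0// exchange_big /=.
    under eq_bigr do rewrite exchange_big.
    rewrite exchange_big seriesOE ler_sum// => N _ /=; rewrite ler_sum// => j _.
    by have := tail j N T; rewrite seriesOE.
  have lim : (fun T => \sum_(N < K) series (fun t => sqn (coef (iter N cshift b) t)) T) @ \oo -->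
      \sum_(N < K) nsq (iter N cshift b).
    by apply: cvgR_sum => N; apply/nsq_cvg/H2_iter_cshift.
  exact: cvgR_le lim bd.
have sg0 N : 0 <= sg N.
  by apply: sumr_ge0 => j _; apply/(nsq_ge0 hH)/H2_bshift/H2_iter_bshift.
have sgl d : 0 < d -> exists N, forall n, (N <= n)%N -> sg n < d.
  move=> d0; have d1 : 0 < d / r.+1%:R by rewrite divr_gt0.
  have /choice[M hM] j : exists N, forall n, (N <= n)%N ->
      nsq (iter n.+1 (@bshift R) (g j)) < d / r.+1%:R.
    by have [N hN] := bshift_stable (Hg j) d1; exists N => n Nn; apply: hN; apply: leqW.
  exists (\max_j M j) => n hn.
  rewrite (@le_lt_trans _ _ (\sum_(j < r) d / r.+1%:R))//.
    by apply: ler_sum => j _; apply/ltW/hM; apply: leq_trans hn; apply: leq_bigmax.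
  rewrite sumr_const card_ord -[X in X < _]mulr_natr -mulrA gtr_pMr// mulrC ltr_pdivrMr//.
  by rewrite mul1r ltr_nat.
have De : 0 < e / D / 2 by rewrite !divr_gt0.
have [N hN] := cesaro_small De sg0 sgl.
exists N.+1; rewrite -(@ltr_pM2r _ N.+1%:R)//.
have := main N.+1; have := hN N.+1 (leqnSn N).
have : nsq (iter N.+1 cshift b) * N.+1%:R <= \sum_(n < N.+1) nsq (iter n cshift b).
  rewrite mulr_natr (_ : _ *+ _ = \sum_(n < N.+1) nsq (iter N.+1 cshift b)).
    apply: ler_sum => n _.
    by have := nsq_iter_cshift (N.+1 - n) n Hb; rewrite subnK ?(ltnW (ltn_ord n)).
  by rewrite sumr_const card_ord.
move=> h1 h2 h3; apply: le_lt_trans h1 _; apply: le_lt_trans h3 _.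
rewrite (@le_lt_trans _ _ (D * (e / D / 2 * N.+1%:R)))// ?ler_pM2l//.
have -> : D * (e / D / 2 * N.+1%:R) = e * N.+1%:R / 2 by field; rewrite gt_eqF.
have : 0 < e * N.+1%:R by rewrite mulr_gt0.
by set q := e * _; lra.
Qed.

(** As the norms of the iterates decrease, one small iterate suffices. *)
Definition cnull h := forall e : R, 0 < e -> exists N, nsq (iter N cshift h) < e.

Lemma cnullP c f h : H2 f -> H2 h -> cnull f -> cnull h -> cnull (c *: f + h).
Proof.
move=> Hf Hh nf nh e e0; pose d := e / (4 * (1 + sqn c)).
have c0 : 0 < 1 + sqn c by rewrite ltr_wpDr ?sqn_ge0.
have d0 : 0 < d by rewrite divr_gt0// mulr_gt0.
have e4 : 0 < e / 4 by lra.
have [N1 h1] := nf d d0; have [N2 h2] := nh _ e4.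
exists (N1 + N2)%N; rewrite iter_cshiftP//.
have HI n x : H2 x -> H2 (iter n cshift x) by exact: H2_iter_cshift.
rewrite (le_lt_trans (nsqD_le hH (linZ HL c (HI _ _ Hf)) (HI _ _ Hh)))//.
rewrite (nsqZ hH); last exact: HI.
have k1 : nsq (iter (N1 + N2) cshift f) < d.
  by rewrite addnC; apply: le_lt_trans h1; apply: nsq_iter_cshift.
have k2 : nsq (iter (N1 + N2) cshift h) < e / 4.
  by apply: le_lt_trans h2; apply: nsq_iter_cshift.
have k3 : sqn c * nsq (iter (N1 + N2) cshift f) <= sqn c * d.
  by rewrite ler_wpM2l ?sqn_ge0// ltW.
have k4 : (1 + sqn c) * d = e / 4.
  by rewrite /d; field; rewrite gt_eqF.
by move: k1 k2 k3 k4; lra.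
Qed.

(** Modulo the null vectors, among which are the shifts of the family, the
    compression is the backward shift, whose powers tend to 0. *)
Lemma cshift_stable h : H2 h -> cnull h.
Proof.
move=> Hh.
have null0 : cnull 0.
  move=> e e0; exists 0%N; by rewrite /= (nsq0 hH).
have key m : exists k, [/\ H2 k, cnull k & iter m cshift h = iter m (@bshift R) h + k].
  elim: m => [|m [k [Hk nk E]]].
    by exists 0; split; [exact: (lin0 HL)|exact: null0|rewrite addr0].
  have Hm := H2_iter_bshift m Hh; set x := iter m (@bshift R) h in Hm E *.
  pose w := \sum_j ip x (g j) *: bshift (g j).
  have [Hw nw] : H2 w /\ cnull w.
    rewrite /w; elim/big_rec: _ => [|j y _ [Hy ny]]; first by split; [exact: (lin0 HL)|].
    have Hb := H2_bshift (Hg j).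
    split; first by apply: (linP HL).
    by apply: cnullP => //; apply: cshift_null_family.
  exists ((- 1 : C) *: w + cshift k); split.
  - by apply: (linP HL) => //; apply: H2_cshift.
  - apply: cnullP => //; first exact: H2_cshift.
    move=> e e0; have [N hN] := nk _ e0; exists N; rewrite -iterSr.
    exact: le_lt_trans (nsq_iter_cshift 1 N Hk) hN.
  rewrite !iterS E (linonD cshiftP)// cshiftE// scaleN1r addrA.
  by congr (_ - _ + _).
move=> e e0; have e4 : 0 < e / 4 by lra.
have [m hm] := bshift_stable Hh e4.
have [k [Hk nk E]] := key m; have [N hN] := nk _ e4.
exists (N + m)%N; rewrite iterD E.
have Hx := H2_iter_bshift m Hh; set x := iter m (@bshift R) h in Hx E *.
have -> : x + k = 1 *: x + k by rewrite scale1r.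
rewrite iter_cshiftP// scale1r.
have HI y : H2 y -> H2 (iter N cshift y) by exact: H2_iter_cshift.
rewrite (le_lt_trans (nsqD_le hH (HI _ Hx) (HI _ Hk)))//.
have := nsq_iter_cshift N 0 Hx; rewrite addn0 /=.
by have := hm m (leqnn m); rewrite -/x; move: hN; lra.
Qed.

End StrongStability.

(** * Multiples of a Blaschke product *)

Section Neumann.
Variables (R : realType) (U : lmodType (Cx R)) (H : set U) (ip : U -> U -> Cx R).
Hypothesis hH : hilbert H ip.
Local Notation C := (Cx R).
Local Notation nsq := (sqnorm ip).
Local Notation hn := (hnorm ip).
Let HL := hilbert_lin hH.

Lemma hnZ (c : C) x : H x -> hn (c *: x) = nr c * hn x.
Proof. by move=> Hx; rewrite /hnorm (nsqZ hH)// sqrtrM ?sqn_ge0. Qed.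

(** The fixed point of d = u + c T d, by iteration from 0. *)
Lemma neumann (T : U -> U) (c : C) u : (forall x, H x -> H (T x)) ->
  (forall d x y, H x -> H y -> T (d *: x + y) = d *: T x + T y) ->
  (forall x, H x -> nsq (T x) <= nsq x) -> nr c < 1 -> H u ->
  exists d, [/\ H d, d - c *: T d = u & hn d <= hn u / (1 - nr c)].
Proof.
move=> TH Tl Tc c1 Hu; set q := nr c; have q0 : 0 <= q by apply: nr_ge0.
have q1 : 0 < 1 - q by rewrite subr_gt0.
have Th x : H x -> hn (T x) <= hn x by move=> Hx; apply/ler_wsqrtr/Tc.
pose x := fix x n := if n is n'.+1 then u + c *: T (x n') else 0.
have Hx n : H (x n).
  elim: n => [|n IH] /=; first exact: (lin0 HL).
  by apply: (linD HL) => //; apply/(linZ HL)/TH.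
have step m n : hn (x m.+1 - x n.+1) <= q * hn (x m - x n).
  have Hd := linB HL (Hx m) (Hx n).
  have -> : x m.+1 - x n.+1 = c *: T (x m - x n).
    by rewrite /= (linonB Tl)// scalerBr opprD addrACA subrr add0r.
  by rewrite hnZ ?ler_wpM2l ?Th//; apply: TH.
have le n : hn (x n) <= hn u / (1 - q).
  elim: n => [|n IH]; first by rewrite /= /hnorm (nsq0 hH) sqrtr0 divr_ge0 ?hn_ge0 ?(ltW q1).
  rewrite (le_trans (hnD hH Hu (linZ HL c (TH _ (Hx n)))))// hnZ; last exact: TH.
  have : q * hn (T (x n)) <= q * (hn u / (1 - q)).
    by rewrite ler_wpM2l// (le_trans (Th _ (Hx n))).
  have {2}-> : hn u / (1 - q) = hn u + q * (hn u / (1 - q)) by field; rewrite gt_eqF.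
  by rewrite -/q lerD2l.
have close m n : hn (x (n + m)%N - x m) <= q ^+ m * (hn u / (1 - q)).
  elim: m => [|m IH]; first by rewrite addn0 subr0 expr0 mul1r.
  by rewrite addnS (le_trans (step _ _))// exprS -mulrA ler_wpM2l.
set B := hn u / (1 - q) in le close.
have B0 : 0 <= B by rewrite divr_ge0 ?hn_ge0 ?(ltW q1).
have qB e : 0 < e -> exists N, forall m n, (N <= m)%N -> (N <= n)%N -> hn (x m - x n) < e.
  move=> e0; have /cvgRP/(_ (e / (B + 1)))[|N hN] := geo_lim q0 c1.
    by rewrite divr_gt0// ltr_wpDl.
  exists N => m n Nm Nn.
  wlog mn : m n Nm Nn / (n <= m)%N.
    move=> W; have [/W->//|/ltnW/W h] := leqP n m.
    by rewrite /hnorm (nsqBC hH)//; apply: h.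
  rewrite -(subnK mn) (le_lt_trans (close _ _))//.
  have := hN n Nn; rewrite subr0 ger0_norm ?exprn_ge0// ltr_pdivlMr ?ltr_wpDl//.
  apply: le_lt_trans; rewrite ler_wpM2l ?exprn_ge0//; lra.
have [|d Hd hd] := hilbert_complete hH Hx.
  move=> e e0; have s0 : 0 < Num.sqrt e by rewrite sqrtr_gt0.
  have [N hN] := qB _ s0; exists N => m n Nm Nn.
  have := hN _ _ Nm Nn; rewrite (hn_lt hH)//; last exact: (linB HL).
  by rewrite sqr_sqrtr// ltW.
have hd' e : 0 < e -> exists N, forall n, (N <= n)%N -> hn (x n - d) < e.
  move=> e0; have [N hN] := hd _ (exprn_gt0 2 e0); exists N => n /hN.
  by rewrite (hn_lt hH)//; apply: (linB HL).
have Hw : H (d - c *: T d - u).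
  by apply: (linB HL) => //; apply: (linB HL) => //; apply/(linZ HL)/TH.
have fix_ : d - c *: T d - u = 0.
  apply: (hilbert_def hH) => //; apply/eqP; rewrite eq_le (nsq_ge0 hH)// andbT.
  rewrite -(hn2 hH)//; suff : hn (d - c *: T d - u) <= 0.
    have := hn_ge0 ip (d - c *: T d - u) => h1 h2.
    by rewrite (_ : hn _ = 0) ?expr0n//; apply/eqP; rewrite eq_le h1 h2.
  apply/ler_addgt0Pr => e e0; rewrite add0r.
  have e2 : 0 < e / 2 by lra.
  have [N hN] := hd' _ e2.
  have h1 := hN N (leqnn N); have h2 := hN N.+1 (leqnSn N).
  have Hd1 := linB HL (Hx N) Hd; have Hd2 := linB HL (Hx N.+1) Hd.
  have -> : d - c *: T d - u = - (x N.+1 - d) + c *: T (x N - d).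
    by rewrite (linonB Tl)// scalerBr /= opprB opprD !addrA subrK addrAC.
  rewrite (le_trans (hnD hH (linN HL Hd2) (linZ HL c (TH _ Hd1))))//.
  rewrite hnZ; last exact: TH.
  rewrite {1}/hnorm (nsqN hH)// -/(hn _).
  have : q * hn (T (x N - d)) <= 1 * (e / 2).
    rewrite ler_pM ?hn_ge0 ?(ltW c1)//.
    by rewrite (le_trans (Th _ Hd1))// ltW.
  by rewrite -/q; move: h2; lra.
exists d; split=> //; first by apply/eqP; rewrite -subr_eq0; apply/eqP.
apply/ler_addgt0Pr => e e0; have [N hN] := hd' _ e0.
have Hd1 := linB HL Hd (Hx N).
have -> : d = x N + (d - x N) by rewrite addrC subrK.
rewrite (le_trans (hnD hH (Hx N) Hd1))// lerD//.
by rewrite ltW// /hnorm (nsqBC hH)//; apply: hN.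
Qed.
End Neumann.

Section Blaschke.
Variable R : realType.
Local Notation C := (Cx R).
Implicit Types (f h u v : disc R -> C) (z al : disc R).
Local Notation H2 := (@hardy R).
Local Notation ip := (@hip R).
Local Notation nsq := (sqnorm ip).
Local Notation hn := (hnorm ip).
Let hH := H2_hilbert R.
Let HL := hilbert_lin hH.

Definition bfactor al : disc R -> C := fun z => ((al : C) - (z : C)) / (1 - (al : C)^* * (z : C)).

Lemma bfactor_den al z : 1 - (al : C)^* * (z : C) != 0.
Proof.
apply/eqP => /eqP; rewrite subr_eq0 => /eqP/(congr1 (@nr R)); rewrite nr1 nrM nrJ => e.
have := disc_nr al; have := disc_nr z; have := nr_ge0 (z : C); have := nr_ge0 (al : C).
by nra.
Qed.

Lemma nsq_Tz f : H2 f -> nsq (Tz f) = nsq f.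
Proof.
move=> Hf; rewrite (nsq_split (H2_Tz Hf)) bshift_Tz// coef_Tz ?sqn0 ?add0r//.
exact: H2_analytic.
Qed.

Lemma TzP c f h : Tz (c *: f + h) = c *: Tz f + Tz h.
Proof. by apply/funext => z; rewrite /Tz /= mulrDr mulrCA. Qed.

Lemma bshift_at f z : H2 f -> (z : C) * bshift f z = f z - coef f 0.
Proof.
move=> Hf; have Hb := H2_bshift Hf; have Hc := const_H2 (coef f 0).
have -> : f z - coef f 0 = (f - (fun _ => coef f 0)) z by [].
suff <- : Tz (bshift f) = f - (fun _ => coef f 0) by [].
apply: H2_eq; [exact: H2_Tz|exact: (linB HL)|].
rewrite coef_Tz; last exact: H2_analytic.
rewrite coef_bshift// coefB// (coefE (const_ps _)).
by apply/funext => -[|k] /=; rewrite ?subrr ?subr0.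
Qed.

(** Multiplication by z is isometric, so its eigenvalues would have modulus 1. *)
Lemma Tz_eigen (al : C) u : nr al < 1 -> H2 u -> Tz u = al *: u -> u = 0.
Proof.
move=> a1 Hu /(congr1 nsq); rewrite nsq_Tz// (nsqZ hH)// => e.
apply: (hilbert_def hH) => //; apply/eqP; move/eqP: e.
rewrite -subr_eq0 -[X in X - _]mul1r -mulrBl mulf_eq0 => /orP[|//].
by rewrite subr_eq0 eq_sym -nr2 lt_eqF// expr_lt1// nr_ge0.
Qed.

Lemma bfactor_inj al u v : H2 u -> H2 v ->
  (forall z, bfactor al z * u z = bfactor al z * v z) -> u = v.
Proof.
move=> Hu Hv h; have Hd := linB HL Hu Hv.
apply/eqP; rewrite -subr_eq0; apply/eqP; apply: Tz_eigen (disc_nr al) Hd _.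
apply/funext => z; rewrite /Tz.
have -> : (u - v) z = u z - v z by [].
have -> : ((al : C) *: (u - v)) z = (al : C) * (u z - v z) by [].
have := h z; rewrite /bfactor !(mulrAC _ (_^-1)) => /(mulIf (invr_neq0 (bfactor_den al z))) e.
apply/eqP; rewrite -subr_eq0 -mulrBl; apply/eqP.
have -> : ((z : C) - (al : C)) * (u z - v z) = ((al : C) - (z : C)) * v z - ((al : C) - (z : C)) * u z.
  by move: (u z) (v z) => x y; ring.
by rewrite e subrr.
Qed.

(** The quotient solves the equation d - al S* d = S* f for the backward shift
    S*, which is a Neumann series. *)
Lemma bfactor_divide al f : H2 f -> exists h, [/\ H2 h,
  forall z, f z - f al = bfactor al z * h z & hn h <= 2 * (hn f / (1 - nr (al : C)))].
Proof.
move=> Hf.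
have [d [Hd dE dn]] := neumann hH (@H2_bshift R) (@bshiftP R) (@nsq_bshift R)
  (disc_nr al) (H2_bshift Hf).
have eqz z : ((z : C) - (al : C)) * d z = f z - coef f 0 - (al : C) * coef d 0.
  have := congr1 (fun k => (z : C) * k z) dE; rewrite /= bshift_at//.
  have -> : (d - (al : C) *: bshift d) z = d z - (al : C) * bshift d z by [].
  rewrite mulrBr mulrCA bshift_at// => e.
  rewrite -[f z - _]e.
  by move: (d z) (coef d 0) => x y; ring.
pose h := (- 1 : C) *: (d - (al : C)^* *: Tz d).
have HTd := H2_Tz Hd.
have Hh1 : H2 (d - (al : C)^* *: Tz d) by apply: (linB HL) => //; apply: (linZ HL).
exists h; split.
- exact: (linZ HL).
- move=> z; have ea := eqz al; rewrite subrr mul0r in ea.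
  have -> : f z - f al = ((z : C) - (al : C)) * d z.
    rewrite eqz; apply/eqP; rewrite -subr_eq0; apply/eqP.
    have -> : f z - f al - (f z - coef f 0 - (al : C) * coef d 0) =
      - (f al - coef f 0 - (al : C) * coef d 0).
      by move: (f z) (f al) (coef f 0) (coef d 0) => x y w t; ring.
    by rewrite -ea oppr0.
  have -> : h z = (- 1) * (d z - (al : C)^* * ((z : C) * d z)) by [].
  rewrite /bfactor; have := bfactor_den al z.
  move: (al : C) (z : C) (d z) => x y w hne.
  by field.
- rewrite /h (hnZ hH)// nrN nr1 mul1r.
  rewrite (le_trans (hnD hH Hd (linN HL (linZ HL (al : C)^* HTd))))//.
  have -> : hn (- ((al : C)^* *: Tz d)) = nr (al : C) * hn d.
    rewrite {1}/hnorm (nsqN hH) -/(hn _); last exact: (linZ HL).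
    by rewrite (hnZ hH)// nrJ /hnorm nsq_Tz.
  have dn' : hn d <= hn f / (1 - nr (al : C)).
    rewrite (le_trans dn)// ler_wpM2r ?invr_ge0 ?subr_ge0 ?(ltW (disc_nr al))//.
    exact/ler_wsqrtr/nsq_bshift.
  have := disc_nr al; have := nr_ge0 (al : C); have := hn_ge0 ip d.
  by nra.
Qed.

(** Division by 1 - conj(al) z is again a Neumann series, now for multiplication by z. *)
Lemma bfactor_H2 al h : H2 h -> H2 (fun z => bfactor al z * h z).
Proof.
move=> Hh.
have c1 : nr (al : C)^* < 1 by rewrite nrJ disc_nr.
have Tc x : H2 x -> nsq (Tz x) <= nsq x by move=> Hx; rewrite nsq_Tz.
have [v [Hv vE _]] := neumann hH (@H2_Tz R) (fun c x y _ _ => TzP c x y) Tc c1 Hh.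
have -> : (fun z => bfactor al z * h z) = (al : C) *: v + (- 1 : C) *: Tz v.
  apply/funext => z; rewrite -vE.
  have -> : (v - (al : C)^* *: Tz v) z = v z - (al : C)^* * ((z : C) * v z) by [].
  have -> : ((al : C) *: v + (-1 : C) *: Tz v) z = (al : C) * v z + (- 1) * ((z : C) * v z) by [].
  rewrite /bfactor; have := bfactor_den al z; move: (al : C) (z : C) (v z) => x y w hne.
  by field.
by apply: (linP HL) => //; apply/(linZ HL)/H2_Tz.
Qed.

Lemma blaschkeS n (a : 'I_n.+1 -> disc R) z :
  blaschke a z = bfactor (a ord0) z * blaschke (fun k => a (lift ord0 k)) z.
Proof. by rewrite /blaschke big_ord_recl. Qed.

Lemma blaschke_H2 n (a : 'I_n -> disc R) h : H2 h -> H2 (fun z => blaschke a z * h z).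
Proof.
elim: n a => [|n IH] a Hh.
  by rewrite (_ : (fun z => _) = h)//; apply/funext => z; rewrite /blaschke big_ord0 mul1r.
rewrite (_ : (fun z => _) = fun z => bfactor (a ord0) z *
   (blaschke (fun k => a (lift ord0 k)) z * h z)); first exact/bfactor_H2/IH.
by apply/funext => z; rewrite blaschkeS mulrA.
Qed.

Lemma mulH2P (B : disc R -> C) f : mulH2 B f <-> exists2 h, H2 h & f = fun z => B z * h z.
Proof. by rewrite /mulH2 hardy_H2; split=> [[h Hh <-]|[h Hh ->]]; exists h. Qed.

(** The multiples of a Blaschke product are the common kernel of n bounded
    functionals: evaluate at one zero, divide by its factor, and repeat. *)
Lemma blaschke_functionals n (a : 'I_n -> disc R) :
  exists E : (disc R -> C) -> 'I_n -> C,
  [/\ forall c f h j, H2 f -> H2 h -> E (c *: f + h) j = c * E f j + E h j,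
      exists B : R, forall f j, H2 f -> nr (E f j) <= B * hn f &
      forall f, H2 f -> mulH2 (blaschke a) f <-> forall j, E f j = 0].
Proof.
elim: n a => [|n IH] a.
  exists (fun _ _ => 0); split; [by move=> ? ? ? []|by exists 0 => ? []|].
  move=> f Hf; split=> [_ []//|_]; apply/mulH2P; exists f => //.
  by apply/funext => z; rewrite /blaschke big_ord0 mul1r.
pose al := a ord0; pose a' k := a (lift ord0 k).
have [E' [El [B hB] Ek]] := IH a'.
(* D is division by the factor of the first zero after subtracting the value there. *)
have /choice[D hD] f : exists h, H2 f -> [/\ H2 h,
  forall z, f z - f al = bfactor al z * h z & hn h <= 2 * (hn f / (1 - nr (al : C)))].
  have [Hf|nf] := pselect (H2 f); last by exists 0.
  by have [h hh] := bfactor_divide al Hf; exists h.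
have Dl c f h : H2 f -> H2 h -> D (c *: f + h) = c *: D f + D h.
  move=> Hf Hh; have Hs := linP HL c Hf Hh.
  have [H1 E1 _] := hD _ Hf; have [H2' E2 _] := hD _ Hh; have [H3 E3 _] := hD _ Hs.
  apply: (@bfactor_inj al) => //; first exact: (linP HL).
  move=> z; rewrite -E3.
  have -> : bfactor al z * (c *: D f + D h) z = c * (bfactor al z * D f z) + bfactor al z * D h z.
    by rewrite mulrCA -mulrDr.
  rewrite -E1 -E2.
  have e w : (c *: f + h) w = c * f w + h w by [].
  by rewrite !e; move: (f z) (f al) (h z) (h al) => x y w t; ring.
exists (fun f j => if unlift ord0 j is Some k then E' (D f) k else f al); split.
- move=> c f h j Hf Hh; case: unliftP => [k _|_] //.
  by have [H1 _ _] := hD _ Hf; have [H2' _ _] := hD _ Hh; rewrite Dl// El.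
- pose q := (1 - nr (al : C))^-1.
  have q0 : 0 <= q by rewrite invr_ge0 subr_ge0 ltW// disc_nr.
  pose p := (1 - sqn (al : C))^-1.
  have p0 : 0 <= p by rewrite invr_ge0 subr_ge0 ltW// disc_sqn.
  exists (`|B| * (2 * q) + Num.sqrt p) => f j Hf; have hf0 := hn_ge0 ip f.
  have [H1 _ D1] := hD _ Hf.
  rewrite mulrDl; case: unliftP => [k _|_].
    rewrite ler_wpDr ?mulr_ge0 ?sqrtr_ge0// (le_trans (hB _ _ H1))//.
    rewrite (@le_trans _ _ (`|B| * hn (D f)))//.
      by rewrite ler_wpM2r ?hn_ge0// ler_norm.
    rewrite -mulrA ler_wpM2l// (le_trans D1)// -mulrA ler_pM2l//.
    by rewrite mulrC.
  rewrite ler_wpDl ?mulr_ge0//.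
  rewrite /nr /hnorm -sqrtrM// ler_wsqrtr// mulrC.
  exact: eval_bound.
move=> f Hf; have [H1 E1 _] := hD _ Hf; split.
  move=> /mulH2P[h Hh fE].
  have fa : f al = 0.
    by rewrite fE blaschkeS {1}/bfactor subrr !mul0r.
  have De : D f = fun z => blaschke a' z * h z.
    apply: (@bfactor_inj al) => //; first exact: blaschke_H2.
    by move=> z; rewrite -E1 fa subr0 {1}fE blaschkeS mulrA.
  move=> j; case: unliftP => [k _|_] //.
  have [h1 _] := Ek _ H1; apply: h1; rewrite De; apply/mulH2P; by exists h.
move=> h; have fa : f al = 0 by have := h ord0; rewrite unlift_none.
have : mulH2 (blaschke a') (D f).
  by apply/(Ek _ H1) => k; have := h (lift ord0 k); rewrite liftK.
move=> /mulH2P[g Hg DE]; apply/mulH2P; exists g => //; apply/funext => z.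
by rewrite blaschkeS -mulrA; have := E1 z; rewrite fa subr0 DE.
Qed.

End Blaschke.

(** * The vector-valued Hardy space *)

Section VectorHardy.
Variables (R : realType) (r : nat).
Local Notation C := (Cx R).
Implicit Types (F G : disc R -> 'cV[C]_r) (f : 'I_r -> disc R -> C) (z : disc R).
Local Notation H2 := (@hardy R).
Local Notation ip := (@hip R).
Local Notation nsq := (sqnorm ip).
Let hH := H2_hilbert R.
Let HL := hilbert_lin hH.

Definition vcomp F (i : 'I_r) : disc R -> C := fun z => F z i ord0.
Definition mkv f : disc R -> 'cV[C]_r := fun z => \col_i f i z.

Lemma vcomp_mkv f i : vcomp (mkv f) i = f i.
Proof. by apply/funext => z; rewrite /vcomp /mkv mxE. Qed.
Lemma vcompP c F G i : vcomp (c *: F + G) i = c *: vcomp F i + vcomp G i.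
Proof. by apply/funext => z; rewrite /vcomp !mxE. Qed.
Lemma vcomp0 i : vcomp 0 i = 0.
Proof. by apply/funext => z; rewrite /vcomp mxE. Qed.
Lemma vcompB F G i : vcomp (F - G) i = vcomp F i - vcomp G i.
Proof. by apply/funext => z; rewrite /vcomp !mxE. Qed.
Lemma vcomp_eq F G : (forall i, vcomp F i = vcomp G i) -> F = G.
Proof.
move=> h; apply/funext => z; apply/matrixP => i j; rewrite ord1.
by have := congr1 (@^~ z) (h i).
Qed.

(** Opaque copies, for the same reason as in the scalar case. *)
Fact vhardy_sig : {S : set (disc R -> 'cV[C]_r) | S = @H2v R r}.
Proof. by exists (@H2v R r). Qed.
Definition vhardy := sval vhardy_sig.
Lemma vhardy_H2v : @H2v R r = vhardy. Proof. by rewrite /vhardy (svalP vhardy_sig). Qed.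
Fact vip_sig : {p : (disc R -> 'cV[C]_r) -> (disc R -> 'cV[C]_r) -> C | p = @ipv R r}.
Proof. by exists (@ipv R r). Qed.
Definition vip := sval vip_sig.
Lemma vip_ipv : @ipv R r = vip. Proof. by rewrite /vip (svalP vip_sig). Qed.

Lemma vhardyP F : vhardy F <-> forall i, H2 (vcomp F i).
Proof. by rewrite -vhardy_H2v /H2v hardy_H2. Qed.
Lemma vhardy_comp F i : vhardy F -> H2 (vcomp F i).
Proof. by move=> /vhardyP. Qed.
Lemma vhardy_mkv f : (forall i, H2 (f i)) -> vhardy (mkv f).
Proof. by move=> h; apply/vhardyP => i; rewrite vcomp_mkv. Qed.
Lemma vipE F G : vip F G = \sum_i ip (vcomp F i) (vcomp G i).
Proof. by rewrite -vip_ipv /ipv hip_ip. Qed.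

Local Notation vnsq := (sqnorm vip).
Lemma vnsqE F : vnsq F = \sum_i nsq (vcomp F i).
Proof. by rewrite /sqnorm vipE re_sum. Qed.

Lemma vnsq_comp F i : vhardy F -> nsq (vcomp F i) <= vnsq F.
Proof.
move=> HF; rewrite vnsqE (bigD1 i)//= lerDl sumr_ge0// => j _.
by apply/(nsq_ge0 hH)/vhardy_comp.
Qed.

Lemma vhardy_hilbert : hilbert vhardy vip.
Proof.
split.
- split=> [|c F G HF HG]; first by apply/vhardyP => i; rewrite vcomp0; apply: (lin0 HL).
  by apply/vhardyP => i; rewrite vcompP; apply: (linP HL); apply: vhardy_comp.
- move=> c F G K HF HG HK; rewrite !vipE mulr_sumr -big_split; apply: eq_bigr => i _ /=.
  by rewrite vcompP (hilbert_ipP hH)//; apply: vhardy_comp.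
- move=> F G HF HG; rewrite !vipE rmorph_sum; apply: eq_bigr => i _.
  by apply: (ipC hH); apply: vhardy_comp.
- by move=> F HF; rewrite vnsqE sumr_ge0// => i _; apply/(nsq_ge0 hH)/vhardy_comp.
- move=> F HF F0; apply: vcomp_eq => i; rewrite vcomp0; apply: (hilbert_def hH).
    exact: vhardy_comp.
  apply/eqP; rewrite eq_le (nsq_ge0 hH) ?andbT; last exact: vhardy_comp.
  by rewrite -F0 vnsq_comp.
move=> u Hu hC.
have /choice[f hf] i : exists y : disc R -> C, H2 y /\ forall e : R, 0 < e -> exists N, forall n, (N <= n)%N ->
    nsq (vcomp (u n) i - y) < e.
  have [|e e0|y Hy hy] := hilbert_complete hH (u := fun n => vcomp (u n) i).
  - by move=> n; apply: vhardy_comp.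
  - have [N hN] := hC _ e0; exists N => m n Nm Nn.
    rewrite -vcompB; apply: le_lt_trans (hN _ _ Nm Nn); apply: vnsq_comp.
    apply/vhardyP => j; rewrite vcompB; apply: (linB HL); exact: vhardy_comp.
  - by exists y.
exists (mkv f); first by apply: vhardy_mkv => i; case: (hf i).
move=> e e0; have d0 : 0 < e / r.+1%:R by rewrite divr_gt0.
have /choice[N hN] i : exists N, forall n, (N <= n)%N ->
    nsq (vcomp (u n) i - f i) < e / r.+1%:R by case: (hf i) => _; apply.
exists (\max_i N i) => n hn; rewrite vnsqE.
rewrite (@le_lt_trans _ _ (\sum_(j < r) e / r.+1%:R))//.
  apply: ler_sum => j _; rewrite vcompB vcomp_mkv; apply/ltW/hN.
  by apply: leq_trans hn; apply: leq_bigmax.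
rewrite sumr_const card_ord -[X in X < _]mulr_natr -mulrA gtr_pMr// mulrC ltr_pdivrMr//.
by rewrite mul1r ltr_nat.
Qed.
Let hV := vhardy_hilbert.
Let VL := hilbert_lin hV.

Definition vTz F : disc R -> 'cV[C]_r := fun z => (z : C) *: F z.
Definition vbshift F := mkv (fun i => bshift (vcomp F i)).

Lemma vcomp_vTz F i : vcomp (vTz F) i = Tz (vcomp F i).
Proof. by apply/funext => z; rewrite /vcomp /vTz mxE. Qed.
Lemma vcomp_vbshift F i : vcomp (vbshift F) i = bshift (vcomp F i).
Proof. exact: vcomp_mkv. Qed.
Lemma vTz_in F : vhardy F -> vhardy (vTz F).
Proof. by move=> /vhardyP h; apply/vhardyP => i; rewrite vcomp_vTz; apply: H2_Tz. Qed.
Lemma vbshift_in F : vhardy F -> vhardy (vbshift F).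
Proof. by move=> /vhardyP h; apply/vhardyP => i; rewrite vcomp_vbshift; apply: H2_bshift. Qed.
Lemma vbshiftP c F G : vhardy F -> vhardy G ->
  vbshift (c *: F + G) = c *: vbshift F + vbshift G.
Proof.
move=> /vhardyP HF /vhardyP HG; apply: vcomp_eq => i.
by rewrite vcompP !vcomp_vbshift vcompP bshiftP.
Qed.
Lemma vbshift_vTz F : vhardy F -> vbshift (vTz F) = F.
Proof.
by move=> /vhardyP h; apply: vcomp_eq => i; rewrite vcomp_vbshift vcomp_vTz bshift_Tz.
Qed.
Lemma vTz_vbshift F : vhardy F -> F (disc0 R) = 0 -> vTz (vbshift F) = F.
Proof.
move=> /vhardyP h F0; apply: vcomp_eq => i; rewrite vcomp_vTz vcomp_vbshift.
apply: Tz_bshift => //; rewrite coef_at0; last exact: H2_analytic.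
by rewrite /vcomp F0 mxE.
Qed.
Lemma vip_vTz F G : (forall i, analytic (vcomp F i)) -> vhardy G ->
  vip (vTz F) G = vip F (vbshift G).
Proof.
move=> aF /vhardyP HG; rewrite !vipE; apply: eq_bigr => i _.
by rewrite vcomp_vTz vcomp_vbshift ip_Tz//; apply: H2_analytic.
Qed.

Lemma ip_const (w : C) (f : disc R -> C) : analytic f ->
  ip f (fun _ => w) = f (disc0 R) * w^*.
Proof.
move=> hf; rewrite hipE (coefE (const_ps w)); apply: cvgC_lim; apply/cvgCS.
rewrite (_ : (fun n => _) = fun _ => f (disc0 R) * w^*); first exact: cvgCc.
apply/funext => n; rewrite seriesSl -coef_at0// seriesOE big1 ?addr0// => i _.
by rewrite rmorph0 mulr0.
Qed.

Definition vconst (w : 'cV[C]_r) : disc R -> 'cV[C]_r := fun _ => w.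
Lemma vconst_in w : vhardy (vconst w).
Proof. by apply/vhardyP => i; apply: const_H2. Qed.

Lemma vip_const F w : (forall i, analytic (vcomp F i)) ->
  vip F (vconst w) = \sum_i F (disc0 R) i ord0 * (w i ord0)^*.
Proof. by move=> h; rewrite vipE; apply: eq_bigr => i _; rewrite ip_const. Qed.

End VectorHardy.
Arguments vip {R r} _ _.

(** * The transform of a nearly invariant subspace *)

Section NearlyInvariant.
Variables (R : realType) (r : nat) (g : 'I_r -> disc R -> Cx R) (M : set (disc R -> Cx R)).
Local Notation C := (Cx R).
Implicit Types (f h : disc R -> C) (z : disc R).
Local Notation H2 := (@hardy R).
Local Notation ip := (@hip R).
Local Notation nsq := (sqnorm ip).
Local Notation H2r := (@vhardy R r).
Let hH := H2_hilbert R.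
Let HL := hilbert_lin hH.
Let hV := vhardy_hilbert R r.
Let VL := hilbert_lin hV.
Hypothesis og : orthonormal H2 ip g.
Hypothesis Mc : closed_subspace H2 ip M.
Hypothesis gM : forall i, M (g i).
Hypothesis RM : forall f, M f -> M (cshift g f).
Hypothesis RT : forall f, M f -> Tz (cshift g f) = f - onproj ip g f.
Let MH := closed_sub Mc.
Let ML := closed_lin Mc.
Local Notation Rop := (cshift g).

Lemma iterM n f : M f -> M (iter n Rop f).
Proof. by move=> Mf; elim: n => //= n; apply: RM. Qed.

(** The coefficients of f along the family, then those of the compressed backward
    shift of f, and so on: f = sum_i g_i (k_i0 + k_i1 z + ...). *)
Definition kseq f (i : 'I_r) (m : nat) : C := ip (iter m Rop f) (g i).
Definition ktr f : disc R -> 'cV[C]_r := mkv (fun i => fn (kseq f i)).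

(** The two summands of f = P f + z R f are orthogonal, and multiplication by z is
    isometric. *)
Lemma nsq_cshiftM f : M f -> nsq f = \sum_i sqn (ip f (g i)) + nsq (Rop f).
Proof.
move=> Mf; have Hf := MH Mf.
rewrite -[nsq (Rop f)]nsq_Tz; last exact: H2_cshift.
by rewrite RT// (nsq_onres hH og)// addrC subrK.
Qed.

Lemma nsq_iterM n f : M f ->
  nsq f = series (fun m => \sum_i sqn (kseq f i m)) n + nsq (iter n Rop f).
Proof.
move=> Mf; elim: n => [|n IH]; first by rewrite series0 add0r.
by rewrite {1}IH seriesSr -addrA; congr (_ + _); apply/nsq_cshiftM/iterM.
Qed.

Lemma kseq_l2 f i : M f -> l2 (kseq f i).
Proof.
move=> Mf; exists (nsq f) => n; rewrite (nsq_iterM n Mf) -[leLHS]addr0 lerD//.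
  rewrite !seriesOE ler_sum// => m _; rewrite (bigD1 i)//= lerDl sumr_ge0// => j _.
  exact: sqn_ge0.
exact/(nsq_ge0 hH)/MH/iterM.
Qed.

Lemma ktr_in f : M f -> H2r (ktr f).
Proof. by move=> Mf; apply: vhardy_mkv => i; apply/H2_fn/kseq_l2. Qed.

Lemma coef_ktr f i : M f -> coef (vcomp (ktr f) i) = kseq f i.
Proof. by move=> Mf; rewrite vcomp_mkv coef_fn//; apply: kseq_l2. Qed.

(** The iterated energy balance leaves the norm of the iterates of the compression as
    a remainder, and these tend to 0. *)
Lemma vnsq_ktr f : M f -> sqnorm vip (ktr f) = nsq f.
Proof.
move=> Mf; have Hk := ktr_in Mf.
have lim : series (fun m => \sum_i sqn (kseq f i m)) @ \oo --> sqnorm vip (ktr f).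
  rewrite vnsqE.
  have -> : series (fun m => \sum_i sqn (kseq f i m)) =
     fun n => \sum_i series (fun m => sqn (coef (vcomp (ktr f) i) m)) n.
    apply/funext => n; rewrite seriesOE exchange_big; apply: eq_bigr => i _ /=.
    by rewrite coef_ktr// seriesOE.
  have h i := nsq_cvg (vhardy_comp i Hk).
  exact: (cvgR_sum h).
have lim' : series (fun m => \sum_i sqn (kseq f i m)) @ \oo --> nsq f.
  apply/cvgRP => e e0; have [N hN] := cshift_stable og (MH Mf) e0.
  exists N => n Nn; rewrite distrC {1}(nsq_iterM n Mf) addrC addKr.
  rewrite ger0_norm; last exact/(nsq_ge0 hH)/MH/iterM.
  by rewrite -(subnK Nn) (le_lt_trans (nsq_iter_cshift og _ _ (MH Mf))).
by rewrite -(cvg_lim _ lim)// -(cvg_lim _ lim').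
Qed.

Lemma ktrP c f h : M f -> M h -> ktr (c *: f + h) = c *: ktr f + ktr h.
Proof.
move=> Mf Mh; have Mc' := linP ML c Mf Mh; apply: vcomp_eq => i; rewrite vcompP.
have H1 := vhardy_comp i (ktr_in Mf); have H3 := vhardy_comp i (ktr_in Mh).
apply: H2_eq; [exact/vhardy_comp/ktr_in|exact: (linP HL)|].
rewrite coef_lin ?coef_ktr//; try exact: H2_analytic.
apply/funext => m; rewrite /kseq (iter_cshiftP og)//; try exact: MH.
by rewrite (hilbert_ipP hH)//; [exact/MH/iterM|exact/MH/iterM|exact/MH/gM].
Qed.

Lemma ktr_cshift f : M f -> ktr (Rop f) = vbshift (ktr f).
Proof.
move=> Mf; have MR := RM Mf; apply: vcomp_eq => i; rewrite vcomp_vbshift.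
have H1 := vhardy_comp i (ktr_in Mf).
apply: H2_eq; [exact/vhardy_comp/ktr_in|exact: H2_bshift|].
by rewrite coef_bshift// !coef_ktr//; apply/funext => m; rewrite /kseq iterSr.
Qed.

(** The residual of a member of the family is 0, so only its first coefficients survive. *)
Lemma ktr_g i : ktr (g i) = vconst (delta_mx i ord0).
Proof.
apply: vcomp_eq => j; apply: H2_eq; [exact/vhardy_comp/ktr_in|exact: const_H2|].
have -> : vcomp (vconst (delta_mx i ord0)) j = fun _ => (j == i)%:R :> C.
  by apply/funext => z; rewrite /vcomp /vconst mxE eqxx andbT.
rewrite coef_ktr// (coefE (const_ps _)).
have Rg : Rop (g i) = 0.
  have Pg : onproj ip g (g i) = g i.
    rewrite /onproj (bigD1 i)//= big1 => [|k ki]; last first.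
      by case: og => _ ->; rewrite eq_sym (negbTE ki) scale0r.
    by case: og => _ ->; rewrite eqxx scale1r addr0.
  by rewrite /cshift Pg subrr; apply: (linon0 HL (@bshiftP R)).
apply/funext => -[|m]; rewrite /kseq; first by case: og => _ ->; rewrite eq_sym.
rewrite iterSr Rg (_ : iter m Rop 0 = 0); first by rewrite (ip0l hH)//; exact/MH/gM.
by elim: m => //= m ->; apply: (linon0 HL (cshiftP og)).
Qed.

Lemma ktr_expand f z n : M f ->
  f z = \sum_i g i z * series (fun m => kseq f i m * (z : C) ^+ m) n + (z : C) ^+ n * iter n Rop f z.
Proof.
move=> Mf; elim: n => [|n IH].
  by rewrite expr0 mul1r big1 ?add0r// => i _; rewrite series0 mulr0.
have Mn := iterM n Mf; set y := iter n Rop f in Mn IH.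
have e : y z = \sum_i kseq f i n * g i z + (z : C) * Rop y z.
  have := congr1 (@^~ z) (RT Mn); rewrite /Tz => ->.
  have -> : (y - onproj ip g y) z = y z - onproj ip g y z by [].
  have -> : onproj ip g y z = \sum_i kseq f i n * g i z.
    by rewrite /onproj fct_sumE; apply: eq_bigr => i _.
  by rewrite addrC subrK.
rewrite IH e iterS -/y mulrDr addrA exprSr mulrA; congr (_ + _).
rewrite mulr_sumr -big_split; apply: eq_bigr => i _ /=.
by rewrite seriesSr mulrDr; congr (_ + _); rewrite mulrCA mulrA mulrC.
Qed.

(** The remainder of the expansion after n steps is z^n times an iterate of the
    compression, whose value at z tends to 0 with its norm. *)
Lemma row_ktr f : M f -> row_apply g (ktr f) = f.
Proof.
move=> Mf; apply/funext => z.
have lim : (fun n => \sum_i g i z * series (fun m => kseq f i m * (z : C) ^+ m) n) @ \oo -->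
    row_apply g (ktr f) z.
  have h i : (fun n => g i z * series (fun m => kseq f i m * (z : C) ^+ m) n) @ \oo -->
      g i z * ktr f z i ord0.
    apply: cvgCZ; rewrite /ktr /mkv mxE.
    exact: (@fn_l2 _ _ (kseq_l2 i Mf) z).
  by apply: cvgC_sum.
apply: cvgC_uniq lim _; apply/cvgCP => e e0.
pose B := 1 - sqn (z : C); have B0 : 0 < B by rewrite subr_gt0 disc_sqn.
have e1 : 0 < e ^+ 2 * B by rewrite mulr_gt0// exprn_gt0.
have [N hN] := cshift_stable og (MH Mf) e1.
exists N => n Nn; have E := ktr_expand z n Mf.
rewrite {1}E opprD addrA subrr sub0r nrN nr_lt_sqn// sqnM.
have Hn := MH (iterM n Mf).
rewrite (@le_lt_trans _ _ (1 * (nsq (iter n Rop f) / B)))//.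
  rewrite ler_pM ?sqn_ge0//; last exact: eval_bound.
  by rewrite sqnX exprn_ile1 ?sqn_ge0// ltW// disc_sqn.
rewrite mul1r ltr_pdivrMr//; apply: le_lt_trans hN.
by rewrite -(subnK Nn); apply: (nsq_iter_cshift og); apply: MH.
Qed.

Lemma vip_ktr f h : M f -> M h -> vip (ktr f) (ktr h) = ip f h.
Proof.
exact: (polarization hH hV MH ML ktr_in ktrP vnsq_ktr).
Qed.

(** An isometric image of a complete space is complete. *)
Lemma ktr_closed : closed_subspace H2r vip (ktr @` M).
Proof.
apply/(closedP hV); split.
- by move=> _ [f Mf <-]; apply: ktr_in.
- split=> [|c _ _ [f Mf <-] [h Mh <-]].
    by exists 0; [exact: (lin0 ML)|exact: (linon0 ML ktrP)].
  by exists (c *: f + h); [exact: (linP ML)|exact: ktrP].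
move=> X HX hX.
have ex n : exists f, M f /\ sqnorm vip (X - ktr f) < n.+1%:R^-1.
  have [|_ [f Mf <-] hf] := hX n.+1%:R^-1; first by rewrite invr_gt0.
  by exists f.
have [u hu] := choice ex.
have Mu n : M (u n) by case: (hu n).
have Hk n := ktr_in (Mu n).
have cau e : 0 < e -> exists N, forall m n, (N <= m)%N -> (N <= n)%N -> nsq (u m - u n) < e.
  move=> e0; have e4 : 0 < e / 4 by lra.
  have [N hN] := invS_small e4; exists N => m n Nm Nn.
  rewrite -vnsq_ktr; last exact: (linB ML).
  rewrite (linonB ktrP)//.
  have -> : ktr (u m) - ktr (u n) = (X - ktr (u n)) + - (X - ktr (u m)).
    by rewrite opprB [RHS]addrC addrA subrK.
  have H1 := linB VL HX (Hk n); have H3 := linB VL HX (Hk m).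
  rewrite (le_lt_trans (nsqD_le hV H1 (linN VL H3)))// (nsqN hV)//.
  have [_] := hu m; have [_] := hu n; have := hN m Nm; have := hN n Nn.
  by set a1 := n.+1%:R^-1; set a2 := m.+1%:R^-1; lra.
have [f Mf hf] := complete_closed hH Mc Mu cau.
exists f => //; apply/eqP; rewrite -subr_eq0; apply/eqP/(hilbert_def hV).
  by apply: (linB VL) => //; apply: ktr_in.
have Hf := ktr_in Mf.
apply/eqP; rewrite eq_le (nsq_ge0 hV) ?andbT; last exact: (linB VL).
apply/ler_addgt0Pr => e e0; rewrite add0r; have e4 : 0 < e / 4 by lra.
have [N1 h1] := hf _ e4; have [N2 h2] := invS_small e4.
pose n := maxn N1 N2.
have -> : ktr f - X = - (X - ktr (u n)) + - (ktr (u n) - ktr f).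
  by rewrite !opprB [RHS]addrC addrA subrK.
have H1 := linB VL HX (Hk n); have H3 := linB VL (Hk n) Hf.
rewrite (le_trans (nsqD_le hV (linN VL H1) (linN VL H3)))// !(nsqN hV)//.
rewrite -(linonB ktrP)// vnsq_ktr; last exact: (linB ML).
have [_] := hu n; have := h1 n (leq_maxl _ _); have := h2 n (leq_maxr _ _).
by set a1 := n.+1%:R^-1; lra.
Qed.

End NearlyInvariant.

(** * The Beurling-Lax theorem with an explicit symbol *)

Section BeurlingLax.
Variables (R : realType) (r : nat) (K : set (disc R -> 'cV[Cx R]_r)).
Local Notation C := (Cx R).
Implicit Types (F G y k : disc R -> 'cV[C]_r) (z : disc R).
Local Notation H2 := (@hardy R).
Local Notation ip := (@hip R).
Local Notation H2r := (@vhardy R r).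
Local Notation vnsq := (sqnorm (@vip R r)).
Let hH := H2_hilbert R.
Let hV := vhardy_hilbert R r.
Let VL := hilbert_lin hV.
Hypothesis Kc : closed_subspace H2r vip K.
Hypothesis KS : forall F, K F -> K (vbshift F).
Let KH := closed_sub Kc.
Let KL := closed_lin Kc.

Definition perp F := H2r F /\ forall k, K k -> vip F k = 0.
(** For the complement L of K, these are the elements of L orthogonal to z L: to be
    orthogonal to z L means that the backward shift lies in K. *)
Definition wandering F := perp F /\ K (vbshift F).

Lemma vanalytic F i : H2r F -> analytic (vcomp F i).
Proof. by move=> HF; apply/H2_analytic/vhardy_comp. Qed.

Lemma vip_vTz2 F G : H2r F -> H2r G -> vip (vTz F) (vTz G) = vip F G.
Proof.
move=> HF HG; rewrite vip_vTz ?vbshift_vTz//; last exact: vTz_in.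
by move=> i; apply: vanalytic.
Qed.

Lemma perp_vTz F : perp F -> perp (vTz F).
Proof.
move=> [HF hF]; split=> [|k Kk]; first exact: vTz_in.
by rewrite vip_vTz ?hF//; [exact: KS|move=> i; exact: vanalytic|exact: KH].
Qed.

Lemma perp_lin : linear_subspace perp.
Proof.
split=> [|c F G [HF hF] [HG hG]].
  by split=> [|k /KH Hk]; [exact: (lin0 VL)|rewrite (ip0l hV)].
split=> [|k Kk]; first exact: (linP VL).
by rewrite (hilbert_ipP hV) ?hF ?hG ?mulr0 ?addr0//; apply: KH.
Qed.

Lemma wandering_lin : linear_subspace wandering.
Proof.
split=> [|c F G [pF kF] [pG kG]].
  split; first exact: (lin0 perp_lin).
  rewrite (linon0 VL (@vbshiftP R r)); exact: (lin0 KL).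
split; first exact: (linP perp_lin).
by case: pF => HF _; case: pG => HG _; rewrite vbshiftP//; apply: (linP KL).
Qed.

Lemma perp_iter m F : perp F -> perp (iter m (@vTz R r) F).
Proof. by move=> pF; elim: m => //= m; apply: perp_vTz. Qed.

Lemma wandering_sub F : wandering F -> H2r F. Proof. by case=> -[]. Qed.

(** For m > 0 the product z^m F is z times an element of the complement of K, to which
    wandering vectors are orthogonal. *)
Lemma wandering_shift m n F G : wandering F -> wandering G ->
  vip (iter m (@vTz R r) F) (iter n (@vTz R r) G) = if m == n then vip F G else 0.
Proof.
move=> wF wG; have HT l X : H2r X -> H2r (iter l (@vTz R r) X).
  by move=> HX; elim: l => //= l; apply: vTz_in.
have HF := wandering_sub wF; have HG := wandering_sub wG.
have zero l X Y : wandering X -> wandering Y -> vip (iter l.+1 (@vTz R r) X) Y = 0.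
  move=> wX [[HY _] KY]; have pX : perp X by case: wX.
  rewrite iterS vip_vTz//; first by have [_] := perp_iter l pX; apply.
  by move=> i; apply/vanalytic/HT; case: pX.
elim: m n => [|m IH] [|n] //.
- rewrite (ipC hV (HT n.+1 _ HG) (HT 0 _ HF)) [iter 0 _ _]/= zero// rmorph0.
  by [].
- by rewrite [iter 0 _ _]/= zero.
- by rewrite !iterS vip_vTz2 ?IH ?eqSS//; apply: HT.
Qed.

(** If y in the complement of K is orthogonal to the wandering part, then
    projecting the backward shift of y on K shows that y is the shift of an
    element of the complement. *)
Lemma wold_step y : perp y -> (forall w, wandering w -> vip y w = 0) ->
  exists2 n, perp n & y = vTz n.
Proof.
move=> py yw; have [Hy hy] := py; have Hb := vbshift_in Hy.
have [k Kk hk] := projection hV Kc Hb; have Hk := KH Kk.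
pose n := vbshift y - k; have pn : perp n by split=> //; exact: (linB VL).
have [Hn hn] := pn; have pT := perp_vTz pn; have HT := vTz_in Hn.
pose w := y - vTz n.
have Hw : H2r w by apply: (linB VL).
have bw : vbshift w = k.
  by rewrite /w (linonB (@vbshiftP R r))// vbshift_vTz// /n opprB addrC subrK.
have ww : wandering w by split; [exact: (linB perp_lin)|rewrite bw].
have w0 : w = 0.
  apply: (hilbert_def hV) => //; rewrite /sqnorm {1}/w (ipBl hV)// yw// vip_vTz//.
    by rewrite bw hn// subrr re0.
  by move=> i; apply: vanalytic.
by exists n => //; apply/eqP; rewrite -subr_eq0 -/w w0.
Qed.

Section Symbol.
Variables (q : nat) (th : 'I_q -> disc R -> 'cV[C]_r).
Hypothesis wth : forall j, wandering (th j).
Hypothesis oth : orthonormal H2r vip th.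
Let Hth j : H2r (th j). Proof. by case: oth. Qed.
Local Notation H2q := (@vhardy R q).
Local Notation qnsq := (sqnorm (@vip R q)).

Definition symbol z : 'M[C]_(r, q) := \matrix_(i, j) th j z i ord0.

Definition sh m j := iter m (@vTz R r) (th j).
Lemma sh_in m j : H2r (sh m j).
Proof. by rewrite /sh; elim: m => //= m; apply: vTz_in. Qed.
Lemma sh_at m j z i : sh m j z i ord0 = (z : C) ^+ m * th j z i ord0.
Proof.
elim: m => [|m IH]; first by rewrite expr0 mul1r.
by rewrite /sh iterS /vTz mxE -/(sh m j) IH exprS mulrA.
Qed.

(** Expansions along the shifts z^m th_j: the multiple of the symbol by a vector
    function with coefficients c is the sum of its layers. *)
Definition layer (c : 'I_q -> C) m := \sum_j c j *: sh m j.
Lemma sh_orthonormal m : orthonormal H2r vip (sh m).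
Proof.
split=> [j|j k]; first exact: sh_in.
by rewrite wandering_shift// eqxx; case: oth => _ ->.
Qed.
Lemma layer_in c m : H2r (layer c m). Proof. exact: (span_in hV (sh_orthonormal m)). Qed.
Lemma layer_orth c d m n : m != n -> vip (layer c m) (layer d n) = 0.
Proof.
move=> mn; rewrite /layer (ip_suml hV); last 2 first.
- exact: layer_in.
- by move=> j _; apply/(linZ VL)/sh_in.
apply: big1 => j _; rewrite (ip_sumr hV); last 2 first.
- exact/(linZ VL)/sh_in.
- by move=> k _; apply/(linZ VL)/sh_in.
apply: big1 => k _; have Hs := sh_in m j; have Hs' := sh_in n k.
rewrite (ipZl hV) ?(ipZr hV)//; last exact: (linZ VL).
by rewrite wandering_shift// (negbTE mn) !mulr0.
Qed.

Definition partial (c : nat -> 'I_q -> C) n := \sum_(m < n) layer (c m) m.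
Lemma partial_in c n : H2r (partial c n).
Proof. by apply: (lin_sum VL) => m _; apply: layer_in. Qed.
Lemma vnsq_partial c n : vnsq (partial c n) = series (fun m => \sum_j sqn (c m j)) n.
Proof.
elim: n => [|n IH]; first by rewrite /partial big_ord0 (nsq0 hV) series0.
rewrite seriesSr -IH /partial big_ord_recr /= -/(partial c n).
have Hp := partial_in c n; have Hl := layer_in (c n) n.
have ort : vip (partial c n) (layer (c n) n) = 0.
  rewrite /partial (ip_suml hV)//; last by move=> m _; exact: layer_in.
  by apply: big1 => m _; rewrite layer_orth// ltn_eqF.
rewrite (nsqD hV)// ort re0 mulr0 addr0.
by rewrite [vnsq (layer _ _)](nsq_span hV (sh_orthonormal n)).
Qed.
Lemma vnsq_partialB c m n : (m <= n)%N ->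
  vnsq (partial c n - partial c m) = \sum_(m <= l < n) \sum_j sqn (c l j).
Proof.
move=> mn; pose c' l j := if (l < m)%N then 0 else c l j.
have -> : partial c n - partial c m = partial c' n.
  rewrite /partial -!(big_mkord xpredT (fun l => layer (c l) l)).
  rewrite -(big_mkord xpredT (fun l => layer (c' l) l)).
  rewrite (big_cat_nat (leq0n m) mn)//= [RHS](big_cat_nat (leq0n m) mn)//= [X in X - _]addrC addrK.
  rewrite [X in _ = X + _]big_nat [X in _ = X + _]big1 ?add0r => [|l lm].
    rewrite !big_nat; apply: eq_bigr => l /andP[ml _]; congr layer.
    by apply/funext => j; rewrite /c' ltnNge ml.
  by move: lm => /andP[_ lm]; rewrite /layer big1// => j _; rewrite /c' lm scale0r.
rewrite vnsq_partial seriesOE -(big_mkord xpredT (fun l => \sum_j sqn (c' l j))).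
rewrite (big_cat_nat (leq0n m) mn)//= [X in X + _]big_nat [X in X + _]big1 ?add0r => [|l lm].
  rewrite !big_nat; apply: eq_bigr => l /andP[ml _].
  by apply: eq_bigr => j _; rewrite /c' ltnNge ml.
by move: lm => /andP[_ lm]; rewrite big1// => j _; rewrite /c' lm sqn0.
Qed.

Lemma vnsqE_cvg p (h : disc R -> 'cV[C]_p) : vhardy h ->
  series (fun m => \sum_j sqn (coef (vcomp h j) m)) @ \oo --> sqnorm (@vip R p) h.
Proof.
move=> Hh; rewrite vnsqE.
have -> : series (fun m => \sum_j sqn (coef (vcomp h j) m)) =
     fun n => \sum_j series (fun m => sqn (coef (vcomp h j) m)) n.
  apply/funext => n; rewrite seriesOE exchange_big; apply: eq_bigr => i _ /=.
  by rewrite seriesOE.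
exact: (cvgR_sum (fun j => nsq_cvg (vhardy_comp j Hh))).
Qed.

(** Multiplication by the symbol is a contraction, as the limit of orthogonal
    expansions along the shifts of the wandering vectors. *)
Lemma symbol_mul h : H2q h -> [/\ H2r (fun z => symbol z *m h z),
  vnsq (fun z => symbol z *m h z) <= qnsq h &
  forall k, H2r k -> (forall m j, vip k (sh m j) = 0) -> vip k (fun z => symbol z *m h z) = 0].
Proof.
move=> Hh; pose c m j := coef (vcomp h j) m.
have cl := vnsqE_cvg Hh.
have [y Hy hy] : exists2 y, H2r y & forall e : R, 0 < e -> exists N, forall n, (N <= n)%N ->
    vnsq (partial c n - y) < e.
  apply: (hilbert_complete hV (partial_in c)) => e e0.
  have [N hN] := cauchy_tail cl e0; exists N => m n Nm Nn.
  wlog mn : m n Nm Nn / (n <= m)%N.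
    move=> W; have [/W->//|/ltnW/W h'] := leqP n m.
    by rewrite (nsqBC hV); [exact: h'|exact: partial_in|exact: partial_in].
  by rewrite vnsq_partialB// (le_lt_trans (ler_norm _))// hN.
have partial_at n z i : vcomp (partial c n) i z =
    \sum_j symbol z i j * series (fun m => c m j * (z : C) ^+ m) n.
  rewrite /vcomp /partial; elim: n => [|n IH].
    by rewrite big_ord0 mxE big1// => j _; rewrite series0 mulr0.
  rewrite big_ord_recr /= mxE IH.
  have -> : layer (c n) n z i ord0 = \sum_j symbol z i j * (c n j * (z : C) ^+ n).
    rewrite /layer fct_sumE summxE; apply: eq_bigr => j _.
    have -> : (c n j *: sh n j) z i ord0 = c n j * sh n j z i ord0 by rewrite [LHS]mxE.
    by rewrite sh_at mxE mulrA mulrC.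
  by rewrite -big_split; apply: eq_bigr => j _ /=; rewrite seriesSr mulrDr.
have yE : (fun z => symbol z *m h z) = y.
  apply: vcomp_eq => i; apply/funext => z; rewrite /vcomp mxE.
  have lim : (fun n => vcomp (partial c n) i z) @ \oo --> \sum_j symbol z i j * h z j ord0.
    rewrite (_ : (fun n => _) = fun n => \sum_j symbol z i j * series (fun m => c m j * (z : C) ^+ m) n).
      apply: (@cvgC_sum R q (fun j n => symbol z i j * series (fun m => c m j * (z : C) ^+ m) n)) => j.
      by apply: cvgCZ; exact: (@H2_ps R _ (vhardy_comp j Hh) z).
    by apply/funext => n; rewrite partial_at.
  apply: cvgC_uniq lim _; apply/cvgCP => e e0.
  pose B := 1 - sqn (z : C); have B0 : 0 < B by rewrite subr_gt0 disc_sqn.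
  have e1 : 0 < e ^+ 2 * B by rewrite mulr_gt0// exprn_gt0.
  have [N hN] := hy _ e1; exists N => n Nn.
  have Hd := linB VL (partial_in c n) Hy.
  have -> : vcomp (partial c n) i z - y z i ord0 = vcomp (partial c n - y) i z by rewrite vcompB.
  rewrite nr_lt_sqn// (le_lt_trans (eval_bound z (vhardy_comp i Hd)))//.
  by rewrite ltr_pdivrMr// (le_lt_trans (vnsq_comp i Hd))// hN.
rewrite yE; split=> //.
  apply/ler_addgt0Pr => e e0.
  have hp n : hnorm vip (partial c n) <= Num.sqrt (qnsq h).
    rewrite /hnorm ler_wsqrtr// vnsq_partial; apply: cvg_series_le cl n => m.
    by apply: sumr_ge0 => j _; apply: sqn_ge0.
  have hq0 : 0 <= qnsq h by apply: (nsq_ge0 (vhardy_hilbert R q)).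
  have hle : hnorm vip y <= Num.sqrt (qnsq h).
    apply/ler_addgt0Pr => d d0; have [N hN] := hy _ (exprn_gt0 2 d0).
    have Hp := partial_in c N; have Hd := linB VL Hy Hp.
    have -> : y = partial c N + (y - partial c N) by rewrite addrC subrK.
    rewrite (le_trans (hnD hV Hp Hd))// lerD// ltW// (hn_lt hV)//.
    by rewrite (nsqBC hV)//; exact: hN.
  rewrite -(hn2 hV)// ler_wpDr ?(ltW e0)// -[leRHS]sqr_sqrtr//.
  by rewrite ler_pXn2r ?nnegrE ?hn_ge0 ?sqrtr_ge0.
move=> k Hk hk; apply: nr_eq0; apply/eqP; rewrite eq_le nr_ge0 andbT.
have ko n : vip k (partial c n) = 0.
  rewrite /partial (ip_sumr hV)//; last by move=> m _; exact: layer_in.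
  apply: big1 => m _; rewrite /layer (ip_sumr hV)//; last by move=> j _; apply/(linZ VL)/sh_in.
  by apply: big1 => j _; rewrite (ipZr hV) ?hk ?mulr0//; apply: sh_in.
apply/ler_addgt0Pr => e e0; rewrite add0r.
have d0 : 0 < e / (hnorm vip k + 1) by rewrite divr_gt0// ltr_wpDl ?hn_ge0.
have [N hN] := hy _ (exprn_gt0 2 d0).
have Hp := partial_in c N; have Hd := linB VL Hy Hp.
have -> : vip k y = vip k (y - partial c N) by rewrite (ipBr hV)// ko subr0.
rewrite (le_trans (nr_ip hV Hk Hd))//.
have : hnorm vip (y - partial c N) <= e / (hnorm vip k + 1).
  by rewrite ltW// (hn_lt hV)// (nsqBC hV)//; exact: hN.
have k1 : 0 < hnorm vip k + 1 by rewrite ltr_wpDl ?hn_ge0.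
rewrite ler_pdivlMr//; have := hn_ge0 vip k; have := hn_ge0 vip (y - partial c N).
by set a := hnorm _ _; set b := hnorm _ k; nra.
Qed.

(** Testing the contraction on the kernel function at z times the vector v. *)
Lemma symbol_contractive z (v : 'cV[C]_q) :
  \sum_i sqn ((symbol z *m v) i ord0) <= \sum_j sqn (v j ord0).
Proof.
have [k [Hk rep k0 _]] := repro_kernel z.
set ka := sqnorm ip k in k0.
have kz : k z = rc ka by rewrite rep// (ip_nsq hH).
pose h := mkv (fun j => v j ord0 *: k).
have Hh : H2q h by apply: vhardy_mkv => j; apply: (linZ (hilbert_lin hH)).
have [HT Tle _] := symbol_mul Hh.
set T := fun z => _ in HT Tle.
have hn : qnsq h = ka * \sum_j sqn (v j ord0).
  rewrite vnsqE mulr_sumr; apply: eq_bigr => j _.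
  by rewrite vcomp_mkv (nsqZ hH)// mulrC.
have Tz i : T z i ord0 = rc ka * (symbol z *m v) i ord0.
  have -> : T z = rc ka *: (symbol z *m v).
    rewrite /T scalemxAr; congr (_ *m _); apply/matrixP => a b; rewrite ord1 !mxE.
    have -> : (v a ord0 *: k) z = v a ord0 * k z by [].
    by rewrite kz mulrC.
  by rewrite mxE.
have : \sum_i sqn (T z i ord0) <= ka * (ka * \sum_j sqn (v j ord0)).
  rewrite -hn (le_trans _ (ler_wpM2l (ltW k0) Tle))// vnsqE mulr_sumr ler_sum// => i _.
  have Hi := vhardy_comp i HT.
  have -> : T z i ord0 = ip (vcomp T i) k by rewrite -rep.
  by rewrite mulrC; apply: (cauchy_schwarz hH).
under eq_bigr do rewrite Tz sqnM sqn_rc.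
by rewrite -mulr_sumr expr2 -mulrA !ler_pM2l.
Qed.

Lemma cvnormE p (v : 'cV[C]_p) : cvnorm v = sqrtC (rc (\sum_i sqn (v i ord0))).
Proof. by rewrite /cvnorm rc_sum; congr sqrtC; apply: eq_bigr => i _; rewrite normr2E. Qed.

Lemma symbol_Hinfty : Hinfty symbol.
Proof.
split=> [i j|].
  rewrite (_ : (fun z => symbol z i j) = vcomp (th j) i); first exact: vanalytic.
  by apply/funext => z; rewrite mxE.
exists 1 => z v; rewrite mul1r !cvnormE ler_sqrtC ?rc_le; first exact: symbol_contractive.
all: by rewrite qualifE /= -rc0 rc_le sumr_ge0// => i _; apply: sqn_ge0.
Qed.

Lemma sh_symbol m j : exists2 h, H2q h & sh m j = fun z => symbol z *m h z.
Proof.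
exists (iter m (@vTz R q) (vconst (delta_mx j ord0))).
  by elim: m => [|m IH]; [exact: vconst_in|exact: vTz_in].
apply/funext => z; apply/matrixP => i k; rewrite ord1 sh_at.
have -> : iter m (@vTz R q) (vconst (delta_mx j ord0)) z = (z : C) ^+ m *: delta_mx j ord0.
  elim: m => [|m IH]; first by rewrite expr0 scale1r.
  by rewrite iterS /vTz IH scalerA exprS.
rewrite -scalemxAr mxE; congr (_ * _).
rewrite mxE (bigD1 j)//= big1 ?addr0 => [|l lj]; rewrite !mxE ?eqxx ?mulr1//.
by rewrite (negbTE lj) mulr0.
Qed.

Hypothesis bth : forall w, wandering w -> exists c : 'I_q -> C, w = \sum_j c j *: th j.

(** The complement L has no part outside the span of the shifts of the wandering
    vectors: by the Wold step y is divisible by z within L, again and again, so all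
    its coefficients vanish. *)
Lemma perp_sh0 y : perp y -> (forall m j, vip y (sh m j) = 0) -> y = 0.
Proof.
move=> py hy; have Hy : H2r y by case: py.
apply: vcomp_eq => i; rewrite vcomp0; apply: H2_eq.
- exact: vhardy_comp.
- exact: (lin0 (hilbert_lin hH)).
rewrite coef0; apply/funext => k; elim: k y py hy Hy => [|k IH] y py hy Hy.
all: have [n pn yE] : exists2 n, perp n & y = vTz n.
1,3: apply: wold_step => // w /bth[c ->]; rewrite (ip_sumr hV)//;
  [by apply: big1 => j _; rewrite (ipZr hV)// (hy 0 j) mulr0
  |by move=> j _; apply: (linZ VL)].
all: have Hn : H2r n by case: pn.
all: rewrite yE vcomp_vTz coef_Tz//=; try exact: vanalytic.
apply: IH => // m j.
by rewrite -vip_vTz2 -?yE; [exact: (hy m.+1 j)| |exact: sh_in].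
Qed.

(** The multiples of the symbol lie in the complement of K, and the shifts of the
    wandering vectors, which are such multiples, span it. *)
Lemma model_space_symbol : model_space symbol = K.
Proof.
apply/seteqP; split=> [X|X KX]; rewrite /model_space /ominus /= vhardy_H2v vip_ipv.
  move=> [HX hX].
  have [k Kk hk] := projection hV Kc HX; have Hk := KH Kk.
  suff /eqP : X - k = 0 by rewrite subr_eq0 => /eqP ->.
  apply: perp_sh0 => [|m j]; first by split=> //; apply: (linB VL).
  have p : perp (sh m j) by apply: perp_iter; case: (wth j).
  rewrite (ipBl hV)//; last exact: sh_in.
  have -> : vip k (sh m j) = 0.
    by rewrite (ipC hV (sh_in m j) Hk); case: p => _ ->; rewrite ?rmorph0.
  rewrite subr0; apply: hX; have [h Hh ->] := sh_symbol m j.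
  by exists h => //; rewrite vhardy_H2v.
split; first exact: KH.
move=> _ [h Hh <-]; rewrite vhardy_H2v in Hh.
have [_ _] := symbol_mul Hh; apply; first exact: KH.
move=> m j; have p : perp (sh m j) by apply: perp_iter; case: (wth j).
by rewrite (ipC hV (sh_in m j) (KH KX)); case: p => _ ->; rewrite ?rmorph0.
Qed.

(** Wandering vectors are orthogonal to the constants, which K contains. *)
Lemma symbol_at0 : (forall w, K (vconst w)) -> symbol (disc0 R) = 0.
Proof.
move=> Kw; apply/matrixP => i j; rewrite !mxE.
have [[_ h] _] := wth j; have := h _ (Kw (delta_mx i ord0)).
rewrite vip_const; last by move=> k; apply: vanalytic.
rewrite (bigD1 i)//= big1 ?addr0 => [|k ki]; rewrite mxE ?eqxx/= ?rmorph1 ?mulr1//.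
by rewrite (negbTE ki) rmorph0 mulr0.
Qed.

End Symbol.
End BeurlingLax.

(** * Means over circles *)

Section Parseval.
Variable R : realType.
Local Notation C := (Cx R).
Local Notation mu := (@lebesgue_measure R).

Lemma re_expi (t : R) : re (expi t) = cos t. Proof. by []. Qed.
Lemma im_expi (t : R) : im (expi t) = sin t. Proof. by []. Qed.
Lemma sqn_expi (t : R) : sqn (expi t) = 1.
Proof. by rewrite /sqn re_expi im_expi cos2Dsin2. Qed.
Lemma expiD (s t : R) : expi (s + t) = expi s * expi t.
Proof.
apply: cx_eq; rewrite ?reM ?imM !re_expi !im_expi ?cosD ?sinD//.
by rewrite addrC.
Qed.
Lemma expi0 : expi 0 = 1 :> C.
Proof. by apply: cx_eq; rewrite ?re_expi ?im_expi ?cos0 ?sin0. Qed.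
Lemma expiMn (t : R) n : expi (t *+ n) = expi t ^+ n.
Proof. by elim: n => [|n IH]; rewrite ?expi0// mulrS expiD exprS IH. Qed.

(** F has mean value c: it has a primitive which grows by c times the length over
    every multiple of the period. With the primitive at hand, integrals over periods
    are evaluated by the fundamental theorem of calculus. *)
Definition mean_value (F : R -> R) (c : R) := continuous F /\
  exists G : R -> R, (forall t : R, is_derive t 1 G (F t)) /\
    forall t N, G (t + (pi *+ 2) *+ N) = G t + c * ((pi *+ 2) *+ N).

Lemma mean_valueD F1 F2 c1 c2 : mean_value F1 c1 -> mean_value F2 c2 ->
  mean_value (F1 \+ F2) (c1 + c2).
Proof.
move=> [C1 [G1 [h1 p1]]] [C2 [G2 [h2 p2]]]; split.
  by move=> t; apply: continuousD; [exact: C1|exact: C2].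
exists (G1 \+ G2); split=> [t|t N] /=; first exact: (@is_deriveD _ _ _ G1 G2 t 1 _ _ (h1 t) (h2 t)).
by rewrite p1 p2; ring.
Qed.

Lemma mean_value_cst (c : R) : mean_value (fun _ => c) c.
Proof.
split; first by move=> t; apply: cvg_cst.
exists (fun t => c * t); split=> [t|t N]; last by rewrite mulrDr.
have h := @is_deriveZ R _ _ id c t 1 1 (is_derive_id _ _).
rewrite /GRing.scale /= mulr1 in h.
exact: h.
Qed.

Lemma mean_value_osc (x : C) m : mean_value (fun t => re (x * (expi (t *+ m.+1))^*)) 0.
Proof.
have E t : re (x * (expi (t *+ m.+1))^*) = re x * cos (t *+ m.+1) + im x * sin (t *+ m.+1).
  by rewrite reM reJ imJ re_expi im_expi; ring.
have dm (t : R) : is_derive t (1 : R) (fun t => t *+ m.+1) (m.+1%:R).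
  rewrite (_ : (fun t => _) = (fun t => m.+1%:R * t)); last by apply/funext => s; rewrite mulr_natl.
  have h := @is_deriveZ R _ _ id m.+1%:R t 1 1 (is_derive_id _ _).
  rewrite /GRing.scale /= mulr1 in h; exact: h.
have cm : continuous (fun t : R => t *+ m.+1).
  by move=> t; apply/differentiable_continuous/derivable1_diffP; case: (dm t).
split.
  rewrite (_ : (fun t => _) = fun t => re x * cos (t *+ m.+1) + im x * sin (t *+ m.+1)); last exact/funext.
  move=> t; apply: cvgD; apply: cvgM; try exact: cvg_cst.
    by apply: continuous_comp; [exact: cm|exact: continuous_cos].
  by apply: continuous_comp; [exact: cm|exact: continuous_sin].
have m0 : m.+1%:R != 0 :> R by rewrite pnatr_eq0.
exists (fun t => re x / m.+1%:R * sin (t *+ m.+1) + - (im x / m.+1%:R) * cos (t *+ m.+1)).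
split=> [t|t N].
  have hs : is_derive t (1 : R) (fun t => sin (t *+ m.+1)) (m.+1%:R * cos (t *+ m.+1)).
    apply: is_derive_eq (@is_derive1_comp R (@sin R) (fun t => t *+ m.+1) t _ _ (is_derive_sin _) (dm t)) _.
    by rewrite mulrC.
  have hc : is_derive t (1 : R) (fun t => cos (t *+ m.+1)) (m.+1%:R * - sin (t *+ m.+1)).
    apply: is_derive_eq (@is_derive1_comp R (@cos R) (fun t => t *+ m.+1) t _ _ (is_derive_cos _) (dm t)) _.
    by rewrite mulrC.
  have h1 := @is_deriveZ R _ _ _ (re x / m.+1%:R) t 1 _ hs.
  have h2 := @is_deriveZ R _ _ _ (- (im x / m.+1%:R)) t 1 _ hc.
  have h := is_deriveD h1 h2.
  rewrite E; apply: is_derive_eq h _.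
  by rewrite /GRing.scale /=; field.
rewrite mul0r addr0 mulrnDl -[(_ *+ N) *+ _]mulrnA.
by rewrite (periodicn (@sinD2pi R)) (periodicn (@cosD2pi R)).
Qed.

Lemma mean_value_sum n (F : 'I_n -> R -> R) (c : 'I_n -> R) :
  (forall i, mean_value (F i) (c i)) -> mean_value (fun t => \sum_i F i t) (\sum_i c i).
Proof.
elim: n F c => [|n IH] F c h.
  rewrite big_ord0 (_ : (fun t => _) = fun _ => 0); first exact: mean_value_cst.
  by apply/funext => t; rewrite big_ord0.
rewrite big_ord_recl (_ : (fun t => _) = F ord0 \+ (fun t => \sum_(i < n) F (lift ord0 i) t)).
  by apply: mean_valueD => //; apply: IH.
by apply/funext => t; rewrite big_ord_recl.
Qed.

Definition trigpoly (c : nat -> C) n (t : R) := series (fun k => c k * expi t ^+ k) n.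

(** Adding a term to the sum changes its squared modulus by a constant and by
    oscillating terms of mean 0. *)
Lemma mean_value_trigpoly c n :
  mean_value (fun t => sqn (trigpoly c n t)) (series (fun k => sqn (c k)) n).
Proof.
elim: n => [|n IH].
  rewrite series0 (_ : (fun t => _) = fun _ => 0); first exact: mean_value_cst.
  by apply/funext => t; rewrite /trigpoly series0 sqn0.
have h (k : 'I_n) : mean_value (fun t => re (2 * c k * (c n)^* * (expi (t *+ (n - k)))^*)) 0.
  by rewrite -(subSS k n) subSn//; exact: mean_value_osc.
have := mean_valueD (mean_valueD IH (mean_value_cst (sqn (c n)))) (mean_value_sum h).
rewrite big1// addr0 -seriesSr; congr mean_value; apply/funext => t /=.
rewrite /trigpoly seriesSr.
have sqnDE (x y : C) : sqn (x + y) = sqn x + sqn y + re (2 * x * y^*).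
  by rewrite -[2 : C]/(1 + 1 : C) /sqn !reimE; ring.
rewrite sqnDE sqnM sqnX sqn_expi expr1n mulr1; congr (_ + _).
rewrite -re_sum; congr re; rewrite seriesOE mulr_sumr mulr_suml; apply: eq_bigr => k _.
have en : expi t ^+ n = expi t ^+ (n - k) * expi t ^+ k.
  by rewrite -exprD subnK// ltnW.
rewrite [X in c n * X]en expiMn rmorphM/= rmorphM/=.
have e1 : expi t ^+ k * (expi t ^+ k)^* = 1 by rewrite mulJ sqnX sqn_expi expr1n.
rewrite -[LHS]mulr1 -e1; move: (expi t ^+ k) (expi t ^+ (n - k)) (c k) (c n) => x y z w.
by ring.
Qed.

Lemma mean_value_integral F c (a : R) N : mean_value F c ->
  (\int[mu]_(t in `[a, (a + (pi *+ 2) *+ N.+1)%R]) (F t)%:E = (c * ((pi *+ 2) *+ N.+1))%:E)%E.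
Proof.
move=> [CF [G [dG pG]]].
have p0 : 0 < (pi *+ 2) *+ N.+1 :> R by rewrite pmulrn_lgt0// pmulrn_lgt0// pi_gt0.
have Gc t : {for t, continuous G}.
  by apply/differentiable_continuous/derivable1_diffP; case: (dG t).
rewrite (@continuous_FTC2 _ F G).
- by rewrite pG -EFinB addrC addKr.
- by rewrite ltrDl.
- exact: continuous_subspaceT.
- split=> [t _||]; first by case: (dG t).
    by apply: cvg_at_right_filter; apply: Gc.
  by apply: cvg_at_left_filter; apply: Gc.
- by move=> t _; rewrite derive1E; case: (dG t).
Qed.

End Parseval.

(** * Values on circles and dilations *)

Section Radial.
Variable R : realType.
Local Notation C := (Cx R).
Local Notation mu := (@lebesgue_measure R).
Implicit Types (f h : disc R -> C).
Local Notation H2 := (@hardy R).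
Local Notation ip := (@hip R).
Local Notation nsq := (sqnorm ip).
Let hH := H2_hilbert R.
Let HL := hilbert_lin hH.

Definition pt (rho t : R) : disc R := to_disc (rc rho * expi t).

Lemma nr_expi (t : R) : nr (expi t) = 1.
Proof. by rewrite /nr sqn_expi sqrtr1. Qed.

Lemma pt_val (rho t : R) : 0 <= rho -> rho < 1 -> (pt rho t : C) = rc rho * expi t.
Proof.
move=> r0 r1; rewrite /pt /to_disc /disc_val insubdK//.
have : `|rc rho * expi t| < 1 by rewrite normrE nrM nr_rc ger0_norm// nr_expi mulr1 -rc1 rc_lt.
by [].
Qed.

Lemma nr_pt (rho t : R) : 0 <= rho -> rho < 1 -> nr (pt rho t : C) = rho.
Proof. by move=> r0 r1; rewrite pt_val// nrM nr_expi mulr1 nr_rc ger0_norm. Qed.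

(** The dilation h(rho z). *)
Definition dil (rho : R) h := fn (fun k => coef h k * rc rho ^+ k).

Section Dilation.
Variables (rho : R) (h : disc R -> C).
Hypotheses (r0 : 0 <= rho) (r1 : rho < 1) (Hh : H2 h).

Lemma dil_term k : sqn (coef h k * rc rho ^+ k) <= sqn (coef h k).
Proof.
rewrite sqnM sqnX sqn_rc ler_piMr ?sqn_ge0// exprn_ile1 ?sqr_ge0//.
by rewrite expr_le1// ltW.
Qed.

Lemma dil_l2 : l2 (fun k => coef h k * rc rho ^+ k).
Proof.
have [B hB] := H2_l2 Hh; exists B => n; apply: le_trans (hB n).
by rewrite !seriesOE ler_sum// => k _; apply: dil_term.
Qed.

Lemma dil_in : H2 (dil rho h). Proof. exact/H2_fn/dil_l2. Qed.
Lemma coef_dil : coef (dil rho h) = fun k => coef h k * rc rho ^+ k.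
Proof. exact/coef_fn/dil_l2. Qed.

Lemma nsq_dil : nsq (dil rho h) <= nsq h.
Proof.
apply: nsq_le; first exact: dil_in.
move=> n; rewrite coef_dil; apply: le_trans (nsq_series n Hh).
by rewrite !seriesOE ler_sum// => k _; apply: dil_term.
Qed.

Lemma dil_pt (s t : R) : 0 <= s -> s < 1 -> dil rho h (pt s t) = h (pt (rho * s) t).
Proof.
move=> s0 s1; have rs0 : 0 <= rho * s by rewrite mulr_ge0.
have rs1 : rho * s < 1 by rewrite mulr_ilt1.
have h1 : series (fun k => coef h k * rc rho ^+ k * (pt s t : C) ^+ k) @ \oo --> dil rho h (pt s t).
  exact: (@fn_l2 _ _ dil_l2 (pt s t)).
have h2 : series (fun k => coef h k * (pt (rho * s) t : C) ^+ k) @ \oo --> h (pt (rho * s) t).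
  exact: (@H2_ps _ _ Hh (pt (rho * s) t)).
have E : (fun k => coef h k * rc rho ^+ k * (pt s t : C) ^+ k) =
    fun k => coef h k * (pt (rho * s) t : C) ^+ k.
  apply/funext => k; rewrite (pt_val t s0 s1) (pt_val t rs0 rs1) rcM.
  by rewrite -mulrA -exprMn mulrA.
by rewrite E in h1; exact: cvgC_uniq h1 h2.
Qed.

Lemma trigpoly_cvg t : (fun n => trigpoly (fun k => coef h k * rc rho ^+ k) n t) @ \oo --> h (pt rho t).
Proof.
have h2 : series (fun k => coef h k * (pt rho t : C) ^+ k) @ \oo --> h (pt rho t).
  exact: (@H2_ps _ _ Hh (pt rho t)).
have E : (fun k => coef h k * (pt rho t : C) ^+ k) = fun k => coef h k * rc rho ^+ k * expi t ^+ k.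
  by apply/funext => k; rewrite (pt_val t r0 r1) exprMn mulrA.
by rewrite E in h2.
Qed.

Lemma measurable_trigpoly c n (D : set R) : measurable D ->
  measurable_fun D (fun t : R => sqn (trigpoly c n t)).
Proof.
move=> mD; apply: measurable_funTS; apply: continuous_measurable_fun.
by have [] := mean_value_trigpoly c n.
Qed.

Lemma measurable_pt (D : set R) : measurable D ->
  measurable_fun D (fun t : R => sqn (h (pt rho t))).
Proof.
move=> mD; pose c k := coef h k * rc rho ^+ k.
apply: (@measurable_fun_cvg _ _ _ D (fun n t => sqn (trigpoly c n t))).
  by move=> n; apply: measurable_trigpoly.
by move=> t _; apply: (cvg_sqn (@trigpoly_cvg t)).
Qed.

Lemma trigpoly_bound : exists B : R, forall n t,
  sqn (trigpoly (fun k => coef h k * rc rho ^+ k) n t) <= B.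
Proof.
have [B hB] := l2_bdd (H2_l2 Hh); exists ((B * (1 - rho)^-1) ^+ 2) => n t.
have B0 : 0 <= B by rewrite (le_trans (nr_ge0 (coef h 0))).
have q0 : 0 <= B * (1 - rho)^-1 by rewrite mulr_ge0// invr_ge0 subr_ge0 ltW.
rewrite -nr_le_sqn//.
rewrite (@le_trans _ _ (B * series (fun k => rho ^+ k) n))//; last first.
  by rewrite ler_wpM2l// geo_le.
rewrite /trigpoly !seriesOE mulr_sumr (le_trans (nr_sum _ _ _))// ler_sum// => k _.
rewrite !nrM !nrX nr_expi expr1n mulr1 nr_rc ger0_norm//.
by rewrite ler_wpM2r// exprn_ge0.
Qed.

(** The partial sums of the Taylor series converge on the circle of radius rho and are
    uniformly bounded there, so their means converge. *)
Lemma parseval (a : R) N :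
  (\int[mu]_(t in `[a, (a + (pi *+ 2) *+ N.+1)%R]) (sqn (h (pt rho t)))%:E =
   (nsq (dil rho h) * ((pi *+ 2) *+ N.+1))%:E)%E.
Proof.
pose c k := coef h k * rc rho ^+ k.
pose D : set R := `[a, (a + (pi *+ 2) *+ N.+1)%R]%classic.
have mD : measurable D by exact: measurable_itv.
have [B hB] := trigpoly_bound.
have Dfin : (mu D < +oo)%E by apply: compact_finite_measure; exact: segment_compact.
have [|||||_ _ lim] := @dominated_convergence _ _ R mu D mD
  (fun n t => (sqn (trigpoly c n t))%:E) (fun t => (sqn (h (pt rho t)))%:E) (cst B%:E).
- by move=> n; apply/measurable_EFinP; apply: measurable_trigpoly.
- by apply/measurable_EFinP; apply: measurable_pt.
- apply: aeW => t _; apply: cvg_EFin; first exact: nearW.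
  exact: (cvg_sqn (@trigpoly_cvg t)).
- by apply: continuous_compact_integrable; [exact: segment_compact|move=> ?; exact: cvg_cst].
- by apply: aeW => t n _; rewrite /= lee_fin ger0_norm ?sqn_ge0.
have Hd := nsq_cvg dil_in; rewrite coef_dil in Hd.
rewrite -(cvg_lim _ lim)//; apply: cvg_lim => //.
rewrite (_ : (fun n => _) = fun n => (series (fun k => sqn (c k)) n * ((pi *+ 2) *+ N.+1))%:E).
  apply: cvg_EFin; first exact: nearW.
  by apply: cvgM; [exact: Hd|exact: cvg_cst].
apply/funext => n; apply: mean_value_integral; exact: mean_value_trigpoly.
Qed.

End Dilation.
End Radial.

(** * Radial maximal estimates *)

Section Maximal.
Variable R : realType.
Local Notation C := (Cx R).
Local Notation mu := (@lebesgue_measure R).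
Implicit Types (f h : disc R -> C).
Local Notation H2 := (@hardy R).
Local Notation ip := (@hip R).
Local Notation nsq := (sqnorm ip).
Let hH := H2_hilbert R.

(** The factor 1/4 is far from optimal, but it needs only the mean value theorem below
    pi/4 and monotonicity above. *)
Lemma sin_ge (y : R) : 0 <= y -> y <= pi / 2 -> y / 4 <= sin y.
Proof.
move=> y0 y1; have p0 := pi_gt0 R; have p2 := pihalf_lt2 R.
have q0 : 0 <= pi / 4 :> R by lra.
have [c4 s4] : (cos (pi / 4) : R) ^+ 2 = 2^-1 /\ (sin (pi / 4) : R) ^+ 2 = 2^-1.
  have := cos_mulr2n (pi / 4 : R).
  have -> : (pi / 4 : R) *+ 2 = pi / 2 by rewrite -mulr_natr; field.
  rewrite cos_pihalf => e; have := cos2Dsin2 (pi / 4 : R).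
  by move: e; rewrite -mulr_natr; set a := cos _ ^+ 2; set b := sin _ ^+ 2 => h1 h2; split; lra.
have cge : 2^-1 <= (cos (pi / 4) : R).
  have : 0 <= (cos (pi / 4) : R) by apply: cos_ge0_pihalf; lra.
  by move: c4; set a := cos _ => ? ?; nra.
have sge : 2^-1 <= (sin (pi / 4) : R).
  have : 0 <= (sin (pi / 4) : R) by apply: sin_ge0_pi; lra.
  by move: s4; set a := sin _ => ? ?; nra.
have [yq|yq] := leP y (pi / 4).
  have [|c cy] := @MVT_segment R (@sin R) (@cos R) 0 y y0 (fun x _ => is_derive_sin x).
    by apply: continuous_subspaceT; exact: continuous_sin.
  rewrite sin0 !subr0 => ->; move: cy; rewrite in_itv /= => /andP[c0 c1].
  have : cos (pi / 4) <= cos c :> R.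
    rewrite le_eqVlt; have [->|cp] := eqVneq c (pi / 4); first by rewrite eqxx.
    rewrite ltr_cos ?in_itv //=; try by apply/andP; split; lra.
    by rewrite orbC lt_neqAle cp/=; lra.
  by nra.
have : sin (pi / 4) <= sin y :> R.
  by apply/ltW; rewrite ltr_sin ?in_itv //=; apply/andP; split; lra.
by lra.
Qed.

(** The squared modulus of 1 - s e^(ix) equals (1 - s)^2 + 4 s sin(x/2)^2. *)
Lemma kernel_ge (s x : R) : 2^-1 <= s -> s < 1 -> `|x| <= pi ->
  ((1 - s) ^+ 2 + x ^+ 2) / 32 <= sqn (1 - rc s * expi x : C).
Proof.
move=> s2 s1 xp; set y := `|x| / 2.
have y0 : 0 <= y by rewrite divr_ge0.
have sy : y / 4 <= sin y by apply: sin_ge => //; rewrite /y; lra.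
have cx : cos x = 1 - 2 * sin y ^+ 2.
  rewrite -cos_norm (_ : `|x| = y *+ 2); last by rewrite -mulr_natr /y; field.
  by rewrite cos_mulr2n -mulr_natr cos2sin2; ring.
have -> : sqn (1 - rc s * expi x) = (1 - s) ^+ 2 + 4 * s * sin y ^+ 2.
  have := cos2Dsin2 x; rewrite /sqn !reimE re_expi im_expi cx.
  by move: (sin x) (sin y) => u v; nra.
have yx : y ^+ 2 = x ^+ 2 / 4 by rewrite /y expr_div_n real_normK ?num_real//; field.
have : (y / 4) ^+ 2 <= sin y ^+ 2.
  by rewrite ler_pXn2r// nnegrE; lra.
have := sqr_ge0 (1 - s); have := sqr_ge0 x.
rewrite expr_div_n yx; move: (sin y ^+ 2) ((1 - s) ^+ 2) (x ^+ 2) => u v w; nra.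
Qed.

(** F is the quotient of h by 1 - b z with b = (s / rho) e^(-it). On the circle of
    radius rho the divisor is 1 - s e^(i(th - t)), so the mean of the squared modulus
    of F is a Poisson integral of that of h; evaluating F at the point of radius
    rho s, where the divisor is 1 - s^2, bounds h there. *)
Lemma poisson_bound h (rho s t : R) : H2 h -> 0 < s -> s < rho -> rho < 1 ->
  exists F, [/\ H2 F, sqn (h (pt (rho * s) t)) <= (1 - s ^+ 2) * nsq (dil rho F) &
    forall th, sqn (F (pt rho th)) * sqn (1 - rc s * expi (th - t) : C) = sqn (h (pt rho th))].
Proof.
move=> Hh s0 sr r1; have r0 : 0 < rho by apply: lt_trans sr.
have s1 : s < 1 by apply: lt_trans r1.
have rs0 : 0 <= rho * s by rewrite mulr_ge0// ltW.
have rs1 : rho * s < 1 by rewrite mulr_ilt1// ltW.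
pose b : C := rc (s / rho) * (expi t)^*.
have b1 : nr b < 1.
  by rewrite /b nrM nrJ nr_expi mulr1 nr_rc ger0_norm ?divr_ge0 ?(ltW s0) ?(ltW r0)// ltr_pdivrMr// mul1r.
have Tc x : H2 x -> nsq (Tz x) <= nsq x by move=> Hx; rewrite nsq_Tz.
have [F [HF FE _]] := neumann hH (@H2_Tz R) (fun c x y _ _ => TzP c x y) Tc b1 Hh.
have Fz z : F z * (1 - b * (z : C)) = h z.
  rewrite -FE; have -> : (F - b *: Tz F) z = F z - b * ((z : C) * F z) by [].
  by move: (F z) (z : C) => x y; ring.
have bpt th : b * (rc rho * expi th) = rc s * expi (th - t).
  have -> : expi (th - t) = expi th * (expi t)^* :> C.
    rewrite expiD; congr (_ * _); apply: cx_eq; by rewrite ?reJ ?imJ ?re_expi ?im_expi ?cosN ?sinN.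
  rewrite /b mulrACA -rcM divfK ?gt_eqF//; congr (_ * _); exact: mulrC.
exists F; split=> //.
- have e : F (pt (rho * s) t) * (1 - rc (s ^+ 2)) = h (pt (rho * s) t).
    have bw : b * (pt (rho * s) t : C) = rc (s ^+ 2).
      rewrite pt_val// rcM [rc rho * _]mulrC -[rc s * rc rho * _]mulrA mulrCA bpt.
      by rewrite subrr expi0 mulr1 -rcM.
    by rewrite -Fz bw.
  rewrite -e sqnM -rc1 -rcN -rcD sqn_rc -(dil_pt (ltW r0) r1 HF t (ltW s0) s1).
  have := eval_bound (pt s t) (dil_in (ltW r0) r1 HF).
  have s21 : 0 < 1 - s ^+ 2 by rewrite subr_gt0 expr_lt1// ltW.
  have -> : sqn (pt s t : C) = s ^+ 2 by rewrite -nr2 nr_pt// ltW.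
  rewrite ler_pdivlMr// => h1; rewrite expr2 mulrA [leRHS]mulrC ler_pM2r//.
- move=> th; rewrite -sqnM -Fz pt_val ?(ltW r0)//; congr sqn; congr (_ * _).
  by rewrite bpt.
Qed.

Definition ringsq h (rho : R) : R -> R := fun t => sqn (h (pt rho t)).
(** Three periods, so that a full period around any angle between 0 and 2 pi is inside. *)
Definition ringD : set R := `[- (pi *+ 2), (- (pi *+ 2) + (pi *+ 2) *+ 3)%R]%classic.

Lemma ringD_sub (t : R) : 0 <= t -> t <= pi *+ 2 ->
  `[t - pi, (t - pi + (pi *+ 2) *+ 1)%R]%classic `<=` ringD.
Proof.
move=> t0 t1; have p0 := pi_gt0 R.
move=> x; rewrite /ringD /= !in_itv /= => /andP[x0 x1]; apply/andP; split; lra.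
Qed.

Section Ring.
Variables (h : disc R -> C) (rho : R).
Hypotheses (Hh : H2 h) (r0 : 0 <= rho) (r1 : rho < 1).
Local Notation W := (ringsq h rho).
Let W0 t : 0 <= W t. Proof. exact: sqn_ge0. Qed.
Let mR : measurable ringD. Proof. exact: measurable_itv. Qed.

Lemma ring_integral : (\int[mu]_(t in ringD) (W t)%:E <= (nsq h * ((pi *+ 2) *+ 3))%:E)%E.
Proof.
rewrite (parseval r0 r1 Hh) lee_fin ler_wpM2r ?nsq_dil//.
by rewrite mulrn_wge0// mulrn_wge0// pi_ge0.
Qed.

Lemma ring_locally_integrable : locally_integrable setT (W \_ ringD).
Proof.
apply: integrable_locally_restrict => //; apply/integrableP; split.
  apply/measurable_EFinP; exact: (measurable_pt r0 r1 Hh mR).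
under eq_integral do rewrite /= ger0_norm//.
by rewrite (le_lt_trans ring_integral)// ltry.
Qed.

Lemma maximal_ball (t M r : R) : (HL_maximal (W \_ ringD) t <= M%:E)%E -> 0 < r ->
  (\int[mu]_(y in ball t r) `|(W \_ ringD) y|%:E <= (M * (r *+ 2))%:E)%E.
Proof.
move=> hM rp.
have : (iavg (W \_ ringD) (ball t r) <= M%:E)%E.
  apply: le_trans hM; apply: ereal_sup_ubound; exists r => //=.
  by rewrite in_itv/= andbT.
rewrite /iavg lebesgue_measure_ball ?(ltW rp)//.
have r2 : 0 < r *+ 2 by rewrite pmulrn_lgt0.
by rewrite inver gt_eqF// muleC lee_pdivrMr// EFinM.
Qed.

(** The Poisson kernel at distance eta = 1 - s from the circle is dominated by a sum of
    indicator functions of the balls of radius 2^j eta with weights of order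
    4^(-j) / eta, and on each ball the mean is at most the maximal function. *)
Lemma maximal_bound (s t M : R) : 2^-1 <= s -> s < rho -> 0 <= t -> t <= pi *+ 2 ->
  (HL_maximal (W \_ ringD) t <= M%:E)%E -> sqn (h (pt (rho * s) t)) <= 1024 * M.
Proof.
move=> s2 sr t0 t1 hM.
have s0 : 0 < s by apply: lt_le_trans s2; rewrite invr_gt0.
have s1 : s < 1 by apply: lt_trans r1.
have [F [HF hF FE]] := poisson_bound t Hh s0 sr r1.
set eta := 1 - s; have eta0 : 0 < eta by rewrite subr_gt0.
have p0 := pi_gt0 R.
have M0 : 0 <= M.
  have := maximal_ball hM ltr01 => h1; have : (0 <= (M * (1 *+ 2))%:E)%E.
    by apply: le_trans h1; apply: integral_ge0 => y _; rewrite lee_fin.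
  by rewrite lee_fin; lra.
pose D := `[t - pi, (t - pi + (pi *+ 2) *+ 1)%R]%classic : set R.
have mD : measurable D by exact: measurable_itv.
have DR : D `<=` ringD by exact: ringD_sub.
have [J hJ] : exists J, pi < 2 ^+ J * eta.
  exists (Num.bound (pi / eta)); rewrite -ltr_pdivrMr//.
  have := @archi_boundP R (pi / eta); rewrite divr_ge0 ?(ltW p0) ?(ltW eta0)// => /(_ isT) h1.
  apply: lt_le_trans h1 _; rewrite -natrX ler_nat; exact/ltnW/ltn_expl.
pose a (j : nat) : R := 256 / 4 ^+ j / eta.
have a_gt0 j : 0 < a j.
  apply: divr_gt0 eta0; apply: divr_gt0; first by rewrite ltr0n.
  by apply: exprn_gt0; rewrite ltr0n.
have a0 j : 0 <= a j := ltW (a_gt0 j).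
pose B (j : nat) : set R := ball t (2 ^+ j * eta).
have mB j : measurable (B j) by exact: measurable_ball.
have rB j : 0 < 2 ^+ j * eta by rewrite mulr_gt0 ?exprn_gt0.
pose V := W \_ ringD.
have mVr A : measurable A -> measurable_fun A (fun y => `|V y|).
  move=> mA; apply: measurableT_comp => //.
  by apply: measurable_funTS; have [] := ring_locally_integrable.
have mV A : measurable A -> measurable_fun A (EFin \o (fun y => `|V y|)).
  by move=> mA; apply/measurable_EFinP; exact: mVr.
(* Only the smallest dyadic ball that contains y is needed. *)
have pw y : D y -> (1 - s ^+ 2) * sqn (F (pt rho y)) <=
    \sum_(j < J.+1) a j * (`|V y| * \1_(B j) y).
  move=> Dy; have VE : `|V y| = W y.
    by rewrite /V patchE mem_set ?ger0_norm//; apply: DR.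
  set x := y - t.
  have xp : `|x| <= pi.
    move: Dy; rewrite /D /= in_itv/= ler_norml /x => /andP[y0 y1]; apply/andP; split; lra.
  have K := kernel_ge s2 s1 xp; have FEy := FE y; rewrite -/x in FEy.
  set k := sqn (1 - _) in K FEy.
  have den : 0 < eta ^+ 2 + x ^+ 2 by rewrite ltr_wpDr ?sqr_ge0 ?exprn_gt0.
  have q0 : 0 <= sqn (F (pt rho y)) by apply: sqn_ge0.
  have main : (1 - s ^+ 2) * sqn (F (pt rho y)) <= 64 * eta / (eta ^+ 2 + x ^+ 2) * W y.
    rewrite mulrAC ler_pdivlMr// -[W y]FEy.
    have e2 : 1 - s ^+ 2 <= 2 * eta by rewrite /eta; nra.
    have : sqn (F (pt rho y)) * (eta ^+ 2 + x ^+ 2) <= sqn (F (pt rho y)) * (32 * k).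
      by rewrite ler_wpM2l//; move: K; rewrite -/eta; lra.
    have : 0 <= 1 - s ^+ 2 by rewrite subr_ge0 expr_le1// ltW.
    have : 0 <= sqn (F (pt rho y)) * (eta ^+ 2 + x ^+ 2) by rewrite mulr_ge0// ltW.
    move: (sqn _) (eta ^+ 2 + _) (1 - _) q0 e2 => q e u hq he h1 h2 h3.
    rewrite -mulrA; apply: (@le_trans _ _ (2 * eta * (q * e))); first by rewrite ler_wpM2r.
    have -> : 64 * eta * (q * k) = 2 * eta * (q * (32 * k)) by ring.
    by rewrite ler_wpM2l// mulr_ge0// ltW.
  apply: le_trans main _; rewrite VE.
  have xJ : `|x| < 2 ^+ J * eta by apply: le_lt_trans xp _.
  have Bx j : \1_(B j) y = (`|x| < 2 ^+ j * eta)%R%:R :> R.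
    rewrite indicE; have -> : (y \in B j) = (`|x| < 2 ^+ j * eta)%R.
      rewrite /B -ball_normE /ball_ /x [in RHS]distrC.
      by apply/idP/idP; [rewrite inE|move=> ?; rewrite inE].
    by [].
  have [j [jJ xj hj]] : exists j : nat, [/\ (j < J.+1)%N, `|x| < 2 ^+ j * eta &
      64 * eta / (eta ^+ 2 + x ^+ 2) <= a j].
    have exj : exists j, `|x| < 2 ^+ j * eta by exists J.
    pose j := ex_minn exj; have [xj jmin] : `|x| < 2 ^+ j * eta /\ forall i, `|x| < 2 ^+ i * eta -> (j <= i)%N.
      by rewrite /j; case: ex_minnP => i hi mi; split.
    exists j; split=> //; first by rewrite ltnS; apply: jmin.
    rewrite ler_pdivrMr// /a.
    have [j0|j0] := posnP j.
      rewrite j0 expr0 divr1 mulrAC ler_pdivlMr//.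
      by have := sqr_ge0 x; nra.
    have : 2 ^+ j.-1 * eta <= `|x|.
      by rewrite leNgt; apply/negP => /jmin; rewrite -ltnS prednK// ltnn.
    have -> : (4 : R) ^+ j = 4 * (2 ^+ j.-1) ^+ 2.
      by rewrite -[in LHS](prednK j0) exprS -exprM mulnC exprM; congr (_ * _ ^+ _); ring.
    have t0' : 0 < (2 : R) ^+ j.-1 by apply: exprn_gt0.
    have -> : x ^+ 2 = `|x| ^+ 2 by rewrite real_normK ?num_real.
    move: (2 ^+ j.-1) t0' => u u0 hu.
    have : (u * eta) ^+ 2 <= `|x| ^+ 2 by rewrite ler_pXn2r// nnegrE ?mulr_ge0// ltW.
    move=> hx; rewrite [leRHS]mulrAC ler_pdivlMr// [leRHS]mulrAC ler_pdivlMr ?mulr_gt0 ?exprn_gt0//.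
    have -> : 64 * eta * eta * (4 * u ^+ 2) = 256 * (u * eta) ^+ 2 by ring.
    by have := sqr_ge0 eta; move: hx; move: ((u * eta) ^+ 2) (eta ^+ 2) (`|x| ^+ 2) => *; lra.
  have Bj : \1_(B j) y = 1 :> R by rewrite Bx xj.
  rewrite (bigD1 (Ordinal jJ))// [\1_(B (Ordinal jJ)) y]Bj mulr1 ler_wpDr//; last by rewrite ler_wpM2r.
  by apply: sumr_ge0 => i _; rewrite mulr_ge0// mulr_ge0//.
have bd j : (\int[mu]_(y in D) (a j * (`|V y| * \1_(B j) y))%:E <= (512 * M / 2 ^+ j)%:E)%E.
  under eq_integral do rewrite EFinM.
  rewrite ge0_integralZl_EFin//; last first.
    apply/measurable_EFinP; apply: measurable_funM; first exact: mVr.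
    by apply: measurable_indic; exact: mB.
  have -> : (512 * M / 2 ^+ j)%:E = ((a j)%:E * (M * ((2 ^+ j * eta) *+ 2))%:E)%E.
    rewrite -EFinM; congr _%:E; rewrite /a.
    have -> : (4 : R) ^+ j = (2 ^+ j) ^+ 2 by rewrite -exprM mulnC exprM; congr (_ ^+ _); ring.
    have : (2 : R) ^+ j != 0 by rewrite gt_eqF// exprn_gt0.
    by move: (2 ^+ j) => u u0; field; rewrite u0 gt_eqF.
  rewrite lee_pmul2l; [|by []|by rewrite lte_fin a_gt0].
  apply: le_trans (maximal_ball hM (rB j)).
  have -> : (fun y => (`|V y| * \1_(B j) y)%:E) = (EFin \o (fun y => `|V y|)) \_ (B j).
    by apply/funext => y; rewrite /= patchE indicE; case: ifP => _; rewrite ?mulr1 ?mulr0.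
  rewrite -integral_mkcondr; apply: ge0_subset_integral => //.
  - exact: (measurableI _ _ mD (mB j)).
  - exact: mB.
  - exact: (mV _ (mB j)).
  - by move=> y _; rewrite /= lee_fin.
have : (((1 - s ^+ 2) * (nsq (dil rho F) * ((pi *+ 2) *+ 1)))%:E <= (1024 * M)%:E)%E.
  rewrite EFinM -(parseval r0 r1 HF (t - pi) 0) -ge0_integralZl_EFin//; last 3 first.
  - by move=> y _; rewrite lee_fin sqn_ge0.
  - by apply/measurable_EFinP; exact: measurable_pt.
  - by rewrite subr_ge0 expr_le1// ltW.
  apply: (@le_trans _ _ (\int[mu]_(y in D) (\sum_(j < J.+1) (a j * (`|V y| * \1_(B j) y))%:E))%E).
    apply: ge0_le_integral => //.
    - by move=> y _; rewrite -EFinM lee_fin mulr_ge0 ?sqn_ge0// subr_ge0 expr_le1// ltW.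
    - by apply: emeasurable_funM => //; apply/measurable_EFinP; exact: measurable_pt.
    - apply: emeasurable_sum => i; apply/measurable_EFinP; apply: measurable_funM => //.
      apply: measurable_funM; first exact: mVr.
      by apply: measurable_indic; exact: mB.
    - by move=> y Dy; rewrite -EFinM sumEFin lee_fin; exact: pw.
  rewrite ge0_integral_sum//; last 2 first.
  - move=> i; apply/measurable_EFinP; apply: measurable_funM => //.
    apply: measurable_funM; first exact: mVr.
    by apply: measurable_indic; exact: mB.
  - by move=> i y _; rewrite lee_fin mulr_ge0// mulr_ge0.
  apply: (@le_trans _ _ (\sum_(j < J.+1) (512 * M / 2 ^+ j)%:E)%E).
    by apply: lee_sum => i _; exact: bd.
  rewrite sumEFin lee_fin.
  have := @geo_le R 2^-1 J.+1 ltac:(by rewrite invr_ge0) ltac:(lra).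
  rewrite seriesOE; have -> : (1 - 2^-1)^-1 = 2 :> R by field.
  move=> h1; rewrite (_ : 1024 * M = 512 * M * 2); last by ring.
  under eq_bigr do rewrite -exprVn.
  rewrite -mulr_sumr; apply: ler_wpM2l h1.
  by apply: mulr_ge0 M0; exact: ler0n.
rewrite lee_fin => h1; apply: le_trans hF _; apply: le_trans h1.
have p2 := pi_ge2 R.
rewrite mulrA ler_peMr ?mulr_ge0//; last by rewrite mulr1n; lra.
- by rewrite subr_ge0 expr_le1// ltW.
- by apply: (nsq_ge0 hH); apply: dil_in.
Qed.

End Ring.
End Maximal.

(** * Radial limits almost everywhere *)

Section RadialLimits.
Variable R : realType.
Local Notation C := (Cx R).
Local Notation mu := (@lebesgue_measure R).
Implicit Types (f h : disc R -> C).
Local Notation H2 := (@hardy R).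
Local Notation ip := (@hip R).
Local Notation nsq := (sqnorm ip).
Let hH := H2_hilbert R.
Let HL := hilbert_lin hH.

Definition rad (m : nat) : R := 1 - m.+2%:R^-1.
Lemma rad_ge0 m : 0 <= rad m.
Proof. by rewrite subr_ge0 invf_le1// ler1n. Qed.
Lemma rad_lt1 m : rad m < 1.
Proof. by rewrite gtrBl invr_gt0. Qed.
Lemma rad_cvg (x : R) : x < 1 -> exists N, forall m, (N <= m)%N -> x < rad m.
Proof.
move=> x1; have [|N hN] := @invS_small R (1 - x); first by rewrite subr_gt0.
exists N => m Nm; have := hN m.+1 (leqW Nm); rewrite /rad; set a := _^-1; lra.
Qed.

(** B is the limit inferior of the level sets of the maximal functions of h on circles
    which increase to the unit circle, whose measures are bounded by the weak type
    inequality. A point of radius x is reached from every circle of radius beyond the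
    square root of x. *)
Lemma maximal_set : exists2 K : R, 0 < K & forall h (c : R), H2 h -> 0 < c -> exists B : set R,
  [/\ measurable B, (mu B <= (K / c * nsq h)%:E)%E &
  forall t x : R, 0 <= t -> t <= pi *+ 2 -> 3 / 4 <= x -> x < 1 ->
    c < sqn (h (pt x t)) -> B t].
Proof.
have [A A0 hA] : exists2 A : R, 0 < A & A = 1024 by exists 1024; [rewrite ltr0n|exact: erefl].
have p6 : 0 < (pi *+ 2) *+ 3 :> R by rewrite pmulrn_lgt0// pmulrn_lgt0// pi_gt0.
set P := _ *+ 3 in p6.
exists (3 * A * P) => [|h c Hh c0]; first by rewrite mulr_gt0// mulr_gt0.
pose d := c / A; have d0 : 0 < d by apply: divr_gt0.
pose V m := ringsq h (rad m) \_ (@ringD R).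
have lV m : locally_integrable setT (V m).
  exact: (ring_locally_integrable Hh (rad_ge0 m) (rad_lt1 m)).
pose G m : set R := [set t | (HL_maximal (V m) t > d%:E)%E].
have mG m : measurable (G m).
  rewrite -[G m]setTI; apply: emeasurable_fun_o_infty => //.
  exact: (measurable_HL_maximal (lV m)).
have muG m : (mu (G m) <= (3 * A * P / c * nsq h)%:E)%E.
  apply: le_trans (maximal_inequality (lV m) d0) _.
  have -> : 3 * A * P / c * nsq h = (3 / d) * (nsq h * P).
    by rewrite /d; field; rewrite !gt_eqF.
  rewrite [leRHS]EFinM lee_pmul2l; [|by []|by rewrite lte_fin divr_gt0].
  apply: le_trans (ring_integral Hh (rad_ge0 m) (rad_lt1 m)).
  have -> : (fun y => `|(V m y)%:E|%E) = (EFin \o ringsq h (rad m)) \_ (@ringD R).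
    apply/funext => y; rewrite /V /= !patchE; case: ifP => _; rewrite /= ?normr0//.
    by rewrite ger0_norm// sqn_ge0.
  by rewrite -integral_mkcond.
pose E M : set R := \bigcap_(m in [set m | (M <= m)%N]) G m.
have mE M : measurable (E M) by apply: bigcap_measurable => //; exists M => /=.
have muE M : (mu (E M) <= (3 * A * P / c * nsq h)%:E)%E.
  apply: le_trans (muG M); apply: le_measure; [rewrite inE; exact: mE|rewrite inE; exact: mG|].
  by move=> t Et; apply: Et; exact: leqnn.
exists (\bigcup_M E M); split.
- by apply: bigcup_measurable => M _; exact: mE.
- have ndE : nondecreasing_seq E.
    by move=> m n mn; apply/subsetPset => t Et k /= nk; apply: Et; apply: leq_trans nk.
  have lim := @nondecreasing_cvg_mu _ _ _ mu _ mE (bigcup_measurable (fun M _ => mE M)) ndE.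
  rewrite -(cvg_lim _ lim)//; apply: lime_le; first by apply/cvg_ex; eexists; exact: lim.
  by apply: nearW => M; exact: muE.
move=> t x t0 t1 x0 x1 hx.
have x0' : 0 < x by apply: lt_le_trans x0; lra.
have sx : Num.sqrt x < 1 by rewrite -[ltRHS]sqrtr1 ltr_sqrt.
have [M hM] := rad_cvg sx; exists M => // m /= Mm; rewrite /G /=.
have rm := hM m Mm; have r1 := rad_lt1 m.
have r0 : 0 < rad m by apply: le_lt_trans rm; apply: sqrtr_ge0.
rewrite ltNge; apply/negP => hHL.
have xr : x < rad m * rad m.
  rewrite -[x]sqr_sqrtr ?(ltW x0')// -expr2 ltr_pXn2r// nnegrE ?sqrtr_ge0//.
  exact: ltW.
have s2 : 2^-1 <= x / rad m by rewrite ler_pdivlMr//; move: x0 r1; lra.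
have sr : x / rad m < rad m by rewrite ltr_pdivrMr.
have := maximal_bound Hh (rad_ge0 m) r1 s2 sr t0 t1 hHL.
rewrite mulrCA divff ?gt_eqF// mulr1 -hA.
have -> : A * d = c by rewrite /d mulrC divfK// gt_eqF.
by rewrite leNgt hx.
Qed.

Definition oscillates f (e t : R) := forall x0 : R, x0 < 1 -> exists x y : R,
  [/\ x0 < x < 1, x0 < y < 1 & e <= nr (f (pt x t) - f (pt y t))].

Lemma polynomial_radial f n (t e : R) : 0 < e -> exists x0 : R, [/\ 3 / 4 <= x0, x0 < 1 &
  forall x y : R, x0 < x < 1 -> x0 < y < 1 ->
   nr (series (fun k => coef f k * (pt x t : C) ^+ k) n -
       series (fun k => coef f k * (pt y t : C) ^+ k) n) < e].
Proof.
move=> e0; pose A := \sum_(k < n) nr (coef f k) * k%:R.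
have A0 : 0 <= A by apply: sumr_ge0 => k _; rewrite mulr_ge0 ?nr_ge0.
have A1 : 0 < A + 1 by lra.
pose x0 := Num.max (3 / 4) (1 - e / (A + 1)).
have q0 : 0 < e / (A + 1) by rewrite divr_gt0.
have x01 : x0 < 1 by rewrite gt_max; apply/andP; split; lra.
have x03 : 3 / 4 <= x0 by rewrite le_max lexx.
exists x0; split=> // x y /andP[xx x1] /andP[yy y1].
have pw (z : R) k : x0 < z -> z < 1 -> 1 - z ^+ k <= k%:R * (1 - x0).
  move=> zx z1; have z0 : 0 <= z by lra.
  elim: k => [|k IH]; first by rewrite expr0 subrr mul0r.
  rewrite exprS -[k.+1%:R]natr1 mulrDl mul1r.
  have zk1 : z ^+ k <= 1 by rewrite exprn_ile1// ltW.
  have zk0 : 0 <= z ^+ k by rewrite exprn_ge0.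
  move: IH zk1 zk0; move: (z ^+ k) => w; move: (k%:R * _) => u; nra.
have xk (z : R) k : x0 < z -> z < 1 -> (pt z t : C) ^+ k = rc (z ^+ k) * expi t ^+ k.
  by move=> zx z1; rewrite pt_val//; [rewrite exprMn rcX | lra].
have : nr (series (fun k => coef f k * (pt x t : C) ^+ k) n -
       series (fun k => coef f k * (pt y t : C) ^+ k) n) <= A * (1 - x0).
  rewrite !seriesOE -sumrB (le_trans (nr_sum _ _ _))// /A mulr_suml ler_sum// => k _.
  rewrite -mulrBr !xk// -mulrBl !nrM nrX nr_expi expr1n mulr1 -mulrA ler_wpM2l ?nr_ge0//.
  rewrite -rcN -rcD nr_rc ler_norml.
  have := pw x k xx x1; have := pw y k yy y1.
  have hz (z : R) : x0 < z -> z < 1 -> z ^+ k <= 1.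
    by move=> zx z1; rewrite exprn_ile1 ?(ltW z1)//; lra.
  have := hz x xx x1; have := hz y yy y1.
  move: (x ^+ k) (y ^+ k) (k%:R * _) => u v w *; apply/andP; split; lra.
move=> hle; apply: le_lt_trans hle _.
have hb : 1 - x0 <= e / (A + 1) by rewrite lerBlDr addrC -lerBlDr le_max lexx orbT.
have eq : (A + 1) * (e / (A + 1)) = e by rewrite mulrC divfK// gt_eqF.
have := ler_wpM2l A0 hb; move: eq q0; move: (e / _) => q; lra.
Qed.

(** Oscillation does not see the Taylor polynomial of degree below n, so it comes from
    z^n times the n-th backward shift of f, which is small in norm and hence, by the
    maximal estimate, small in modulus outside a set of small measure. *)
Lemma oscillates_negligible f (e : R) : H2 f -> 0 < e ->
  mu.-negligible [set t | 0 <= t <= pi *+ 2 /\ oscillates f e t].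
Proof.
move=> Hf e0; pose c := (e / 8) ^+ 2; have c0 : 0 < c by apply: exprn_gt0; lra.
have Hn n : H2 (iter n (@bshift R) f) by apply: H2_iter_bshift.
have [K K0 hK] := maximal_set.
have /choice[B hB] n := hK _ _ (Hn n) c0.
have expand n z : f z = series (fun k => coef f k * (z : C) ^+ k) n +
    (z : C) ^+ n * iter n (@bshift R) f z.
  elim: n => [|n IH]; first by rewrite series0 expr0 mul1r add0r.
  rewrite IH seriesSr -addrA exprSr -mulrA iterS bshift_at// coef_iter_bshift// addn0.
  congr (_ + _); move: (iter n _ _ z) (coef f n) ((z : C) ^+ n) => a b w; ring.
exists (\bigcap_n B n); split.
- by apply: bigcap_measurable => [|n _]; [exists 0%N|case: (hB n)].
- have mI : measurable (\bigcap_n B n).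
    by apply: bigcap_measurable => [|n _]; [exists 0%N|case: (hB n)].
  apply/eqP; rewrite eq_le measure_ge0 andbT.
  apply/lee_addgt0Pr => d d0; rewrite add0e.
  have Kc0 : 0 < K / c by apply: divr_gt0.
  have [N hN] := bshift_stable Hf (divr_gt0 d0 Kc0).
  have [mB muB _] := hB N.
  apply: le_trans (_ : mu (B N) <= _)%E.
    apply: le_measure; [rewrite inE; exact: mI|rewrite inE; exact: mB|].
    by move=> t Bt; exact: Bt.
  apply: le_trans muB _; rewrite lee_fin.
  by have := hN N (leqnn N); rewrite ltr_pdivlMr// mulrC => /ltW.
move=> t /= [/andP[t0 t1] osc] n _; have [_ _ hBn] := hB n.
have e2 : 0 < e / 2 by lra.
have [x0 [x03 x01 px]] := @polynomial_radial f n t _ e2.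
have [x [y [xx yy exy]]] := osc _ x01.
have key z : x0 < z < 1 -> e / 4 <= nr (iter n (@bshift R) f (pt z t)) -> B n t.
  move=> /andP[zx z1] hz; apply: (hBn t z) => //; first by lra.
  apply: (@lt_le_trans _ _ ((e / 4) ^+ 2)).
    by rewrite ltr_pXn2r// ?nnegrE; lra.
  by rewrite -nr2 ler_pXn2r// ?nnegrE ?nr_ge0//; lra.
have [hx|hx] := leP (e / 4) (nr (iter n (@bshift R) f (pt x t))); first exact: key hx.
have [hy|hy] := leP (e / 4) (nr (iter n (@bshift R) f (pt y t))); first exact: key hy.
exfalso; have := px x y xx yy; move: exy.
rewrite (expand n (pt x t)) (expand n (pt y t)).
have b z : x0 < z < 1 -> nr ((pt z t : C) ^+ n * iter n (@bshift R) f (pt z t)) <=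
    nr (iter n (@bshift R) f (pt z t)).
  move=> /andP[zx z1]; rewrite nrM nrX nr_pt//; last by lra.
  by rewrite ler_piMl ?nr_ge0// exprn_ile1 ?(ltW z1)//; lra.
have := b x xx; have := b y yy.
set p := series _ n; set q := series _ n; set u := (pt x t : C) ^+ n * _; set v := (pt y t : C) ^+ n * _.
have := nrD (p - q) (u - v); have := nrD u (- v); rewrite nrN.
have -> : p - q + (u - v) = p + u - (q + v) by rewrite opprD addrACA.
by move: hx hy; lra.
Qed.

Lemma cvg_at_leftP (F : R -> C) (l : C) : F s @[s --> (1 : R)^'-] --> l <->
  forall e : R, 0 < e -> exists2 x0 : R, x0 < 1 & forall s, x0 < s < 1 -> nr (F s - l) < e.
Proof.
split=> [/cvgrPdist_lt h e e0|h].
  have e0' : 0 < rc e by rewrite -rc0 rc_lt.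
  have := h _ e0'; rewrite near_withinE => /nbhs_ballP[d /= d0 hd].
  exists (1 - d); first by rewrite gtrBl.
  move=> s /andP[s0 s1]; rewrite nrB -rc_lt -normrE; apply: hd => //=.
  by rewrite -ball_normE /ball_ /= ger0_norm; lra.
apply/cvgrPdist_lt => e e0; have eE := ge0_rcE (ltW e0).
have [|x0 x01 hx] := h (re e); first by rewrite -rc_lt -eE.
rewrite near_withinE; apply/nbhs_ballP; exists (1 - x0) => /=; first by rewrite subr_gt0.
move=> s; rewrite -ball_normE /ball_ /= => sx s1; rewrite normrE eE rc_lt nrB; apply: hx.
rewrite s1 andbT; have := ler_norm (1 - s); lra.
Qed.

(** Where f does not oscillate by 1/(j+1) for any j it satisfies the Cauchy criterion. *)
Lemma radial_limit_ae f : H2 f ->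
  {ae mu, forall t : R, t \in `[0, 2 * pi] -> exists l : C, f (pt s t) @[s --> (1 : R)^'-] --> l}.
Proof.
move=> Hf.
have : mu.-negligible (\bigcup_j [set t | 0 <= t <= pi *+ 2 /\ oscillates f j.+1%:R^-1 t]).
  by apply: negligible_bigcup => j; apply: oscillates_negligible => //; rewrite invr_gt0.
apply: negligibleS => t /= nt; apply: contrapT => no; apply: nt => tI.
have t01 : 0 <= t <= pi *+ 2 by move: tI; rewrite in_itv/= mulr_natl.
have cau (e : R) : 0 < e -> exists2 x0 : R, x0 < 1 & forall x y, x0 < x < 1 -> x0 < y < 1 ->
    nr (f (pt x t) - f (pt y t)) < e.
  move=> e0; have [j hj] := invS_small e0; apply: contrapT => nx; apply: no.
  exists j => //; split=> // x0 x01; apply: contrapT => nxy; apply: nx.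
  exists x0 => // x y hx hy; rewrite ltNge; apply/negP => exy; apply: nxy.
  exists x, y; split=> //; apply: le_trans exy; exact/ltW/hj.
have [l hl] : exists l : C, (fun m => f (pt (rad m) t)) @ \oo --> l.
  apply: cauchyC => e /cau[x0 x01 hx]; have [N hN] := rad_cvg x01.
  by exists N => m n Nm Nn; apply: hx; rewrite hN ?rad_lt1.
exists l; apply/cvg_at_leftP => e e0; have e2 : 0 < e / 2 by lra.
have [x0 x01 hx] := cau _ e2; exists x0 => // s hs.
have /cvgCP/(_ _ e2)[N1 h1] := hl; have [N2 h2] := rad_cvg x01.
pose m := maxn N1 N2.
have a1 := h1 m (leq_maxl _ _).
have a2 : nr (f (pt s t) - f (pt (rad m) t)) < e / 2.
  by apply: hx => //; rewrite h2 ?leq_maxr// rad_lt1.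
have := nrD (f (pt s t) - f (pt (rad m) t)) (f (pt (rad m) t) - l).
by rewrite addrA subrK; lra.
Qed.

End RadialLimits.

(** * Contractive symbols with unit columns are inner *)

Section Inner.
Variables (R : realType) (r q : nat) (Th : disc R -> 'M[Cx R]_(r, q)).
Local Notation C := (Cx R).
Local Notation mu := (@lebesgue_measure R).
Local Notation H2 := (@hardy R).
Local Notation ip := (@hip R).
Local Notation nsq := (sqnorm ip).
Let entry i j : disc R -> C := fun z => Th z i j.
Hypothesis HTh : forall i j, H2 (fun z => Th z i j).
Hypothesis contr : forall z (v : 'cV[C]_q),
  \sum_i sqn ((Th z *m v) i ord0) <= \sum_j sqn (v j ord0).
Hypothesis unit_col : forall j, \sum_i nsq (fun z => Th z i j) = 1.

Let L : R := (pi *+ 2) *+ 1.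
Let D : set R := `[0, (0 + (pi *+ 2) *+ 1)%R]%classic.
Let mD : measurable D. Proof. exact: measurable_itv. Qed.
Let L0 : 0 < L. Proof. by rewrite /L mulr1n pmulrn_lgt0// pi_gt0. Qed.

Lemma sqn_axpy (a b c : C) :
  sqn (a + c^* * b) = sqn a + sqn c * sqn b + 2 * re (c^* * (a^* * b)).
Proof. by rewrite /sqn !reimE; ring. Qed.

Lemma col_le1 z j : \sum_i sqn (Th z i j) <= 1.
Proof.
have := contr z (delta_mx j ord0); rewrite (bigD1 j (P := xpredT) (F := fun k => sqn (_ k _)))//=.
rewrite [X in _ + X]big1 => [|k kj]; last by rewrite mxE (negbTE kj) sqn0.
rewrite mxE !eqxx /= sqn1 addr0; apply: le_trans.
rewrite le_eqVlt; apply/orP; left; apply/eqP; apply: eq_bigr => i _; congr sqn.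
rewrite mxE (bigD1 j)//= big1 ?addr0 => [|k kj]; rewrite mxE ?eqxx ?mulr1//.
by rewrite (negbTE kj) mulr0.
Qed.

(** The mean of the squared norm of a column over the circle of radius rad m tends to
    the squared norm of the column in the Hardy space. The first K coefficients carry
    almost all of it, and a factor of at least rad m ^ (2 K) is left of it. *)
Lemma dil_mass_cvg j : (fun m => \sum_i nsq (dil (rad R m) (entry i j))) @ \oo --> (1 : R).
Proof.
apply/cvgRP => e e0; have e2 : 0 < e / 2 by lra.
have lim : series (fun k => \sum_i sqn (coef (entry i j) k)) @ \oo --> (1 : R).
  rewrite -(unit_col j).
  rewrite (_ : series _ = fun n => \sum_i series (fun k => sqn (coef (entry i j) k)) n).
    exact: (cvgR_sum (fun i => nsq_cvg (HTh i j))).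
  apply/funext => n; rewrite seriesOE exchange_big; apply: eq_bigr => i _ /=.
  by rewrite seriesOE.
have /cvgRP/(_ _ e2)[K hK] := lim; have {hK} := hK K (leqnn K).
rewrite seriesOE exchange_big /=; set T := \sum_i _ => hT.
have [N hN] : exists N, forall m, (N <= m)%N -> 1 - e / 2 < rad R m ^+ (K * 2).
  have [|N hN] := @rad_cvg R (1 - (e / 2) / (K * 2).+1%:R).
    by rewrite gtrBl divr_gt0.
  exists N => m Nm; have := hN m Nm; have r0 := rad_ge0 R m; have r1 := rad_lt1 R m.
  set p := (K * 2)%N; have bern k : 1 - k%:R * (1 - rad R m) <= rad R m ^+ k.
    elim: k => [|k IH]; first by rewrite expr0 mul0r subr0.
    rewrite exprSr -[k.+1%:R]natr1 mulrDl mul1r.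
    have : rad R m ^+ k <= 1 by rewrite exprn_ile1// ltW.
    have : 0 <= rad R m ^+ k by rewrite exprn_ge0.
    by move: IH; move: (_ ^+ k) (k%:R * _) => u v; nra.
  move=> h; apply: lt_le_trans (bern p).
  have p1 : 0 < p.+1%:R :> R by rewrite ltr0n.
  have : (1 - rad R m) * p.+1%:R < e / 2 by rewrite -ltr_pdivlMr// ltrBlDr addrC -ltrBlDr.
  rewrite -[p.+1%:R]natr1 mulrDr mulr1 [p%:R * _]mulrC.
  by move: ((1 - rad R m) * p%:R) => u; lra.
exists N => m Nm; rewrite ltr_norml.
have r0 := rad_ge0 R m; have r1 := rad_lt1 R m.
have up : \sum_i nsq (dil (rad R m) (entry i j)) <= 1.
  by rewrite -(unit_col j) ler_sum// => i _; exact: (nsq_dil r0 r1 (HTh i j)).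
have low : rad R m ^+ (K * 2) * T <= \sum_i nsq (dil (rad R m) (entry i j)).
  rewrite /T mulr_sumr ler_sum// => i _.
  have Hd := dil_in r0 r1 (HTh i j); apply: le_trans (nsq_series K Hd).
  rewrite (coef_dil r0 r1 (HTh i j)) seriesOE mulr_sumr ler_sum// => k _.
  rewrite sqnM sqnX sqn_rc mulrC ler_wpM2l ?sqn_ge0//.
  rewrite -exprM mulnC; apply: ler_wiXn2l => //; first exact: ltW.
  by rewrite leq_mul2l/= ltnW.
have := hN m Nm; move: hT; rewrite distrC => /ltr_normlP[_ hT] hr.
have T1 : T <= 1.
  by have := cvg_series_le (fun k => sumr_ge0 _ (fun i _ => sqn_ge0 (coef (entry i j) k))) lim K;
    rewrite seriesOE exchange_big.
apply/andP; split; last by lra.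
have : (1 - e / 2) * T <= rad R m ^+ (K * 2) * T.
  apply: ler_wpM2r (ltW hr).
  by apply: sumr_ge0 => i _; apply: sumr_ge0 => k _; exact: sqn_ge0.
have : e / 2 * T <= e / 2 by rewrite ler_piMr// ltW.
by lra.
Qed.

(** Fatou applied to the defect 1 - |column|^2, which is nonnegative, on circles
    of radius tending to 1: the integrals of the defect tend to 0. *)
Lemma column_unit_ae j : {ae mu, forall t, D t -> forall w : 'I_r -> C,
  (forall i, (fun m => Th (pt (rad R m) t) i j) @ \oo --> w i) -> \sum_i sqn (w i) = 1}.
Proof.
pose u m t : R := \sum_i sqn (Th (pt (rad R m) t) i j).
have u0 m t : 0 <= u m t by apply: sumr_ge0 => i _; apply: sqn_ge0.
have mu_ m : measurable_fun D (u m).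
  apply: measurable_sum => i.
  exact: (measurable_pt (rad_ge0 R m) (rad_lt1 R m) (HTh i j) mD).
pose v m t : R := 1 - u m t.
have v0 m t : 0 <= v m t by rewrite subr_ge0; exact: col_le1.
have mv m : measurable_fun D (v m) by apply: measurable_funB.
pose S m := \sum_i nsq (dil (rad R m) (entry i j)).
have Iu m : (\int[mu]_(t in D) (u m t)%:E = (S m * L)%:E)%E.
  under eq_integral do rewrite /u -sumEFin.
  rewrite ge0_integral_sum//; last 2 first.
  - move=> i; apply/measurable_EFinP.
    exact: (measurable_pt (rad_ge0 R m) (rad_lt1 R m) (HTh i j) mD).
  - by move=> i t _; rewrite lee_fin sqn_ge0.
  rewrite /S mulr_suml -sumEFin; apply: eq_bigr => i _.
  exact: (parseval (rad_ge0 R m) (rad_lt1 R m) (HTh i j) 0 0).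
have Iv m : (\int[mu]_(t in D) (v m t)%:E = ((1 - S m) * L)%:E)%E.
  have : (\int[mu]_(t in D) ((v m t)%:E + (u m t)%:E) = (1 * L)%:E)%E.
    rewrite -(mean_value_integral 0 0 (mean_value_cst (1 : R))).
    by apply: eq_integral => t _; rewrite -EFinD /v subrK.
  have v0' t : D t -> (0 <= (v m t)%:E)%E by rewrite lee_fin.
  have mv' : measurable_fun D (fun t => (v m t)%:E) by apply/measurable_EFinP; exact: mv.
  have mu' : measurable_fun D (fun t => (u m t)%:E) by apply/measurable_EFinP; exact: mu_.
  have u0' t : D t -> (0 <= (u m t)%:E)%E by rewrite lee_fin.
  rewrite (@ge0_integralD _ _ R mu D mD _ _ v0' mv' u0' mu').
  rewrite Iu; case: (\int[mu]_(t in D) (v m t)%:E)%E => [x||]//.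
  by move=> [h]; congr (_%:E); rewrite mulrBl -h addrK.
have vlim : ((fun m => \int[mu]_(t in D) (v m t)%:E) @ \oo --> 0)%E.
  rewrite (_ : (fun m => _) = fun m => ((1 - S m) * L)%:E); last exact/funext.
  apply: cvg_EFin; first exact: nearW.
  have h := dil_mass_cvg j; apply/cvgRP => e e0.
  have eL : 0 < e / L by apply: divr_gt0.
  have /cvgRP/(_ _ eL)[N hN] := h; exists N => m /hN.
  by rewrite /= subr0 normrM (gtr0_norm L0) distrC ltr_pdivlMr.
have Fz : (\int[mu]_(t in D) limn_einf (fun m => (v m t)%:E) <= 0)%E.
  have h := @fatou _ _ R mu D mD (fun m t => (v m t)%:E)
    (fun m => (measurable_EFinP _ _).2 (mv m)) (fun m t _ => v0 m t).
  apply: le_trans h _; by have [-> _] := cvg_limn_einf_sup vlim.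
have g0 t : (0 <= limn_einf (fun m => (v m t)%:E))%E.
  rewrite limn_einf_lim; apply: lime_ge; first exact: is_cvg_einfs.
  by apply: nearW => m; apply: le_ereal_inf_tmp => _ [k _ <-]; rewrite lee_fin.
have mg : measurable_fun D (fun t => limn_einf (fun m => (v m t)%:E)).
  rewrite (_ : (fun t => _) = fun t => oppe (limn_esup (fun m => (- v m t)%:E))).
    apply: measurableT_comp => //.
    apply: (@measurable_fun_limn_esup _ _ _ D (fun m t => (- v m t)%:E)) => m.
    by apply/measurable_EFinP; apply: measurableT_comp.
  apply/funext => t; rewrite -limn_einfN; congr limn_einf.
  by apply/funext => m /=; rewrite opprK.
have : ae_eq mu D (fun t => limn_einf (fun m => (v m t)%:E)) (cst 0%E).
  have h := ae_eq_integral_abs mu mD mg; apply: (h.1).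
  apply/eqP; rewrite eq_le integral_ge0 ?andbT//.
  by under eq_integral do rewrite gee0_abs//.
apply: filterS => t ht Dt w hw; have := ht Dt.
have ul : (fun m => (v m t)%:E) @ \oo --> (1 - \sum_i sqn (w i))%:E.
  apply: cvg_EFin; first exact: nearW.
  apply: cvgB; first exact: cvg_cst.
  by apply: (@cvgR_sum R r (fun i m => sqn (Th (pt (rad R m) t) i j))) => i; apply: (cvg_sqn (hw i)).
by have [-> _] := cvg_limn_einf_sup ul; case=> /eqP; rewrite subr_eq0 => /eqP.
Qed.

Lemma radial_seq f t (l : C) : f (pt s t) @[s --> (1 : R)^'-] --> l ->
  (fun m => f (pt (rad R m) t) : C) @ \oo --> l.
Proof.
move=> /(cvg_at_leftP (fun s => f (pt s t)) l) h; apply/cvgCP => e /h[x0 x01 hx].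
have [N hN] := rad_cvg x01; exists N => m Nm; apply: hx.
by rewrite hN// rad_lt1.
Qed.

(** With x the inner product of the columns j and k, the bound for the vector
    e_j + conj(x) e_k reads 1 + 3 |x|^2 <= 1 + |x|^2. *)
Lemma contraction_isometry (W : 'M[C]_(r, q)) :
  (forall v : 'cV[C]_q, \sum_i sqn ((W *m v) i ord0) <= \sum_j sqn (v j ord0)) ->
  (forall j, \sum_i sqn (W i j) = 1) -> map_mx Num.conj W^T *m W = 1%:M.
Proof.
move=> hW uW; apply/matrixP => j k; rewrite !mxE.
under eq_bigr do rewrite !mxE.
have [<-|jk] := eqVneq j k.
  rewrite -[RHS]rc1 -(uW j) rc_sum; apply: eq_bigr => i _.
  by rewrite mulrC mulJ.
set x := \sum_i _; rewrite mulr0n; apply: sqn_eq0.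
pose v : 'cV[C]_q := delta_mx j ord0 + x^* *: delta_mx k ord0.
have Wv i : (W *m v) i ord0 = W i j + x^* * W i k.
  rewrite /v mulmxDr -scalemxAr !mxE; congr (_ + _ * _).
    rewrite (bigD1 j)//= big1 ?addr0 => [|l lj]; rewrite mxE ?eqxx ?mulr1//.
    by rewrite (negbTE lj) mulr0.
  rewrite (bigD1 k)//= big1 ?addr0 => [|l lk]; rewrite mxE ?eqxx ?mulr1//.
  by rewrite (negbTE lk) mulr0.
have := hW v.
have -> : \sum_l sqn (v l ord0) = 1 + sqn x.
  rewrite (bigD1 j)//= (bigD1 k)//=; last by rewrite eq_sym.
  rewrite big1 => [|l /andP[lj lk]]; last first.
    by rewrite !mxE (negbTE lj) (negbTE lk) /= mulr0 addr0 sqn0.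
  rewrite !mxE !eqxx (negbTE jk) eq_sym (negbTE jk) /= mulr0 mulr1 !addr0 add0r sqn1.
  by rewrite sqnJ.
have -> : \sum_i sqn ((W *m v) i ord0) = 1 + sqn x + 2 * sqn x.
  have E i : sqn ((W *m v) i ord0) = sqn (W i j) + sqn x * sqn (W i k) +
      2 * re (x^* * ((W i j)^* * W i k)).
    by rewrite Wv sqn_axpy.
  under eq_bigr do rewrite E.
  rewrite 2!big_split /= uW -mulr_sumr uW mulr1 -mulr_sumr -re_sum -mulr_sumr -/x.
  by rewrite [x^* * x]mulrC mulJ re_rc.
have := sqn_ge0 x; move: (sqn x) => a *; apply/eqP; rewrite eq_le; apply/andP; split; lra.
Qed.

Let aeS (P Q : R -> Prop) : (forall t, P t -> Q t) -> {ae mu, forall t, P t} ->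
  {ae mu, forall t, Q t}.
Proof. by move=> PQ; apply: filterS PQ; exact: (ae_filter_ringOfSetsType mu). Qed.

Let aeS2 (P1 P2 Q : R -> Prop) : (forall t, P1 t -> P2 t -> Q t) ->
  {ae mu, forall t, P1 t} -> {ae mu, forall t, P2 t} -> {ae mu, forall t, Q t}.
Proof. by move=> PQ; apply: filterS2 PQ; exact: (ae_filter_ringOfSetsType mu). Qed.

(** Radial limits of contractions are contractions, and their columns have norm 1. *)
Lemma inner_ae : {ae mu, forall t : R, t \in `[0, 2 * pi] ->
  exists2 W, radial_limit Th t W & map_mx Num.conj W^T *m W = 1%:M}.
Proof.
have h1 : {ae mu, forall t : R, forall n : nat, forall (i : 'I_r) (j : 'I_q), i = n :> nat ->
    t \in `[0, 2 * pi] -> exists l : C, Th (pt s t) i j @[s --> (1 : R)^'-] --> l}.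
  apply: ae_foralln => n.
  have : {ae mu, forall t : R, forall m : nat, forall (i : 'I_r) (j : 'I_q), i = n :> nat -> j = m :> nat ->
    t \in `[0, 2 * pi] -> exists l : C, Th (pt s t) i j @[s --> (1 : R)^'-] --> l}.
    apply: ae_foralln => m.
    have [nr|nr] := ltnP n r; last by apply: aeW => t i j ei; move: (ltn_ord i); rewrite ei ltnNge nr.
    have [mq|mq] := ltnP m q; last by apply: aeW => t i j _ ej; move: (ltn_ord j); rewrite ej ltnNge mq.
    have := radial_limit_ae (HTh (Ordinal nr) (Ordinal mq)).
    apply: aeS => t ht i j ei ej.
    have -> : i = Ordinal nr by exact: val_inj.
    by have -> : j = Ordinal mq by exact: val_inj.
  by apply: aeS => t ht i j ei; apply: (ht j).
have h2 : {ae mu, forall t : R, forall n : nat, forall j : 'I_q, j = n :> nat -> D t ->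
    forall w : 'I_r -> C, (forall i, (fun m => Th (pt (rad R m) t) i j) @ \oo --> w i) ->
    \sum_i sqn (w i) = 1}.
  apply: ae_foralln => n.
  have [nq|nq] := ltnP n q; last by apply: aeW => t j ej; move: (ltn_ord j); rewrite ej ltnNge nq.
  have := column_unit_ae (Ordinal nq); apply: aeS => t ht j ej.
  by have -> : j = Ordinal nq by exact: val_inj.
apply: (aeS2 _ h1 h2) => t l1 l2 tI.
have Dt : D t by move: tI; rewrite /D /= !in_itv/= add0r mulr1n mulr_natl.
have /choice[w hw] : forall ij : 'I_r * 'I_q, exists l : C, Th (pt s t) ij.1 ij.2 @[s --> (1 : R)^'-] --> l.
  by move=> [i j]; apply: (l1 i i j).
pose W : 'M[C]_(r, q) := \matrix_(i, j) w (i, j).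
have lW i j : Th (pt s t) i j @[s --> (1 : R)^'-] --> W i j by rewrite mxE; exact: (hw (i, j)).
have sW i j := radial_seq (f := entry i j) (lW i j).
exists W; first by move=> i j; exact: lW.
apply: contraction_isometry => [v|j]; last by apply: (l2 j j) => // i; exact: sW.
have lim : (fun m => \sum_i sqn ((Th (pt (rad R m) t) *m v) i ord0)) @ \oo -->
    \sum_i sqn ((W *m v) i ord0).
  apply: (@cvgR_sum R r (fun i m => sqn ((Th (pt (rad R m) t) *m v) i ord0))) => i.
  apply: cvg_sqn; rewrite mxE.
  rewrite (_ : (fun m => _) = fun m => \sum_k Th (pt (rad R m) t) i k * v k ord0).
    apply: (@cvgC_sum R q (fun k m => Th (pt (rad R m) t) i k * v k ord0)) => k.
    exact: (cvgCM (sW i k) (cvgCc _)).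
  by apply/funext => m; rewrite mxE.
by apply: cvgR_le lim _ => m; exact: contr.
Qed.

(** At a single point of the circle there is an isometry from q to r dimensions. *)
Lemma inner_dim : (q <= r)%N.
Proof.
have [B [mB B0 hB]] := inner_ae.
have : ~ (D `<=` B).
  move=> DB; have : (mu D <= mu B)%E by apply: le_measure; rewrite ?inE.
  rewrite B0 leNgt => /negP; apply.
  have h := mean_value_integral 0 0 (mean_value_cst (1 : R)).
  by rewrite -[mu D]mul1e -integral_cst// h lte_fin mul1r.
move=> /existsNP[t /not_implyP[Dt Bt]].
have [W _ WW] : exists2 W : 'M[C]_(r, q), radial_limit Th t W & map_mx Num.conj W^T *m W = 1%:M.
  have : (t \in `[0, 2 * pi]) by move: Dt; rewrite /D /= !in_itv/= add0r mulr1n mulr_natl.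
  by apply: contrapT => h; apply: Bt; apply: hB => h'; apply: h => /h'.
exact: mulmx1_min WW.
Qed.

End Inner.

(** * Products of analytic functions *)

Section Products.
Variable R : realType.
Local Notation C := (Cx R).
Implicit Types (f g : disc R -> C) (z : disc R).
Local Notation H2 := (@hardy R).
Local Notation ip := (@hip R).

Definition conv (a b : nat -> C) m := \sum_(i < m.+1) a i * b (m - i)%N.

Lemma series_conv (u v : nat -> C) n :
  series (conv u v) n = \sum_(i < n) u i * series v (n - i)%N.
Proof.
elim: n => [|n IH]; first by rewrite series0 big_ord0.
have E : \sum_(i < n) u i * series v (n - i)%N = \sum_(i < n.+1) u i * series v (n - i)%N.
  by rewrite big_ord_recr /= subnn series0 mulr0 addr0.
rewrite seriesSr IH E -big_split; apply: eq_bigr => i _ /=.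
by rewrite subSn ?seriesSr ?mulrDr// -ltnS ltn_ord.
Qed.

Lemma geometric_tail (v : nat -> C) (B s : R) k d : 0 <= s -> s < 1 -> 0 <= B ->
  (forall i, nr (v i) <= B * s ^+ i) -> nr (series v (k + d)%N - series v k) <= B * s ^+ k / (1 - s).
Proof.
move=> s0 s1 B0 hv.
apply: (@le_trans _ _ (B * s ^+ k * series (fun i => s ^+ i) d)); last first.
  by rewrite ler_wpM2l ?mulr_ge0 ?exprn_ge0// geo_le.
elim: d => [|d IH]; first by rewrite addn0 subrr nr0 series0 mulr0.
rewrite addnS !seriesSr mulrDr addrAC (le_trans (nrD _ _))// lerD// -mulrA -exprD.
exact: hv.
Qed.

(** The Cauchy product. With s the fourth root of |z|, both sequences of terms are
    at most a constant times s^(2 k), and the partial sums of the convolution differ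
    from the products of the partial sums by a multiple of s^n. *)
Lemma analytic_mul f g : analytic f -> analytic g -> analytic (fun z => f z * g z).
Proof.
move=> [a ha] [b hb]; exists (conv a b) => z.
pose s := Num.sqrt (Num.sqrt (nr (z : C))); pose t := s ^+ 2.
have s0 : 0 <= s by exact: sqrtr_ge0.
have s1 : s < 1.
  by rewrite /s -[ltRHS]sqrtr1 ltr_sqrt ?ltr01// -[ltRHS]sqrtr1 ltr_sqrt ?ltr01 ?disc_nr.
have t0 : 0 <= t by exact: exprn_ge0.
have t1 : t < 1 by rewrite /t exprn_ilt1.
have zt : nr (z : C) = t * t.
  by rewrite /t -!expr2 /s -exprM -[LHS]sqr_sqrtr ?nr_ge0// -[X in X ^+ 2]sqr_sqrtr ?sqrtr_ge0// -exprM.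
have [A A0 hA] := ps_bound ha t0 t1; have [B B0 hB] := ps_bound hb t0 t1.
pose u k := a k * (z : C) ^+ k; pose v k := b k * (z : C) ^+ k.
have bd (c : nat -> C) K k : nr (c k) * t ^+ k <= K -> nr (c k * (z : C) ^+ k) <= K * t ^+ k.
  by move=> h; rewrite nrM nrX zt exprMn mulrA ler_wpM2r ?exprn_ge0.
have hu k : nr (u k) <= A * t ^+ k by exact/bd/hA.
have ts k : t ^+ k <= s ^+ k by rewrite /t -exprM; apply: ler_wiXn2l => //; [exact: ltW|exact: leq_pmull].
have hv k : nr (v k) <= B * s ^+ k.
  by apply: le_trans (bd _ _ _ (hB k)) _; rewrite ler_wpM2l.
have -> : series (fun k => conv a b k * (z : C) ^+ k) = series (conv u v).
  apply/funext => n; rewrite !seriesOE; apply: eq_bigr => m _; rewrite /conv mulr_suml.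
  apply: eq_bigr => i _; rewrite /u /v mulrACA -exprD subnKC// -ltnS.
  exact: ltn_ord.
have lim := cvgCM (ha z) (hb z).
have diff n : nr (series (conv u v) n - series u n * series v n) <= A * B / (1 - s) ^+ 2 * s ^+ n.
  rewrite series_conv seriesOE mulr_suml -sumrB (le_trans (nr_sum _ _ _))//.
  apply: (@le_trans _ _ (\sum_(i < n) A * B / (1 - s) * s ^+ n * s ^+ i)).
    apply: ler_sum => i _; have i_n : (i <= n)%N by rewrite ltnW.
    rewrite -mulrBr nrM nrB; have := geometric_tail (n - i) i s0 s1 B0 hv; rewrite subnK// => h.
    apply: le_trans (ler_pM (nr_ge0 _) (nr_ge0 _) (hu i) h) _.
    rewrite /t -exprM mulSn mul1n exprD le_eqVlt; apply/orP; left; apply/eqP.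
    have -> : s ^+ n = s ^+ (n - i) * s ^+ i by rewrite -exprD subnK.
    ring.
  rewrite -mulr_sumr -seriesOE expr2 invfM mulrA [leRHS]mulrAC.
  by rewrite ler_wpM2l ?geo_le// !mulr_ge0// ?exprn_ge0// invr_ge0 subr_ge0 ltW.
set K := A * B / _ in diff.
have K0 : 0 <= K by rewrite /K !mulr_ge0// invr_ge0 exprn_ge0// subr_ge0 ltW.
apply/cvgCP => e e0; have e2 : 0 < e / 2 by lra.
have eK : 0 < e / 2 / (K + 1) by rewrite divr_gt0// ltr_wpDl.
have /cvgRP/(_ _ eK)[N1 h1] := geo_lim s0 s1; have /cvgCP/(_ _ e2)[N2 h2] := lim.
exists (maxn N1 N2) => n; rewrite geq_max => /andP[/h1 n1 /h2 n2].
rewrite subr0 ger0_norm ?exprn_ge0// ltr_pdivlMr ?ltr_wpDl// in n1.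
rewrite -(subrK (series u n * series v n) (series (conv u v) n)) -addrA.
rewrite (le_lt_trans (nrD _ _))// [ltRHS](_ : e = e / 2 + e / 2); last by lra.
apply: ltrD n2; apply: le_lt_trans (diff n) (le_lt_trans _ n1).
by rewrite mulrC ler_wpM2l ?exprn_ge0// lerDl.
Qed.

(** Applied to the components g of the multiples of a matrix function, of which only
    analyticity is at hand. *)
Lemma ip_bshift f g : H2 f -> analytic g -> ip (bshift f) g = ip f (Tz g).
Proof.
move=> Hf hg; rewrite !hipE coef_Tz// coef_bshift//.
set u := series (fun k => coef f k.+1 * _).
have E : (fun n => series (fun k => coef f k * (shift_seq (coef g) k)^*) n.+1) = u.
  by apply/funext => n; rewrite seriesSl /= rmorph0 mulr0 add0r.
by congr (get _); apply/funext => l; apply/propext; rewrite -E cvgCS.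
Qed.

Lemma ip_constl (w : C) f : analytic f -> ip (fun _ => w) f = w * (f (disc0 R))^*.
Proof.
move=> hf; rewrite hipE (coefE (const_ps w)); apply: cvgC_lim; apply/cvgCS.
rewrite (_ : (fun n => _) = fun _ => w * (f (disc0 R))^*); first exact: cvgCc.
by apply/funext => n; rewrite seriesSl -coef_at0// seriesOE big1 ?addr0// => i _; rewrite mul0r.
Qed.

End Products.

(** * The representation of nearly invariant subspaces *)

Section Assembly.
Variables (R : realType) (n : nat) (a : 'I_n -> disc R) (M : set (disc R -> Cx R)).
Local Notation C := (Cx R).
Local Notation H2 := (@hardy R).
Local Notation ip := (@hip R).
Local Notation nsq := (sqnorm ip).
Let hH := H2_hilbert R.
Let HL := hilbert_lin hH.
Hypothesis ha : exists j, a j = 0 :> C.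
Hypothesis Mc : closed_subspace H2 ip M.
Let MH := closed_sub Mc.
Let ML := closed_lin Mc.
Let N : set (disc R -> C) := M `&` mulH2 (blaschke a).

Lemma blaschke_multiple_at0 f : mulH2 (blaschke a) f -> f (disc0 R) = 0.
Proof.
move=> /mulH2P[h _ ->]; have [j aj] := ha.
by rewrite /blaschke (bigD1 j)//= aj subrr !mul0r.
Qed.

(** The intersection of M with the kernels of bounded functionals. *)
Lemma multiples_closed : closed_subspace H2 ip N.
Proof.
have [E [EP [B hB] EN]] := blaschke_functionals a.
have [_ _ Mcl] := (closedP hH M).1 Mc.
apply/(closedP hH); split.
- by move=> f [/MH].
- split.
    split; first exact: (lin0 ML).
    apply/EN; first exact: (lin0 HL).
    by move=> j; have := EP (-1) 0 0 j (lin0 HL) (lin0 HL); rewrite scaler0 addr0 mulN1r addNr.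
  move=> c f h [Mf /EN f0] [Mh /EN h0]; split; first exact: (linP ML).
  apply/EN; first exact/MH/(linP ML).
  by move=> j; rewrite EP ?f0 ?h0 ?mulr0 ?addr0//; exact: MH.
move=> f Hf hf; split.
  by apply: Mcl => // e e0; have [y [My _]] := hf e e0; exists y.
apply/EN => // j; apply: nr_eq0; apply/eqP; rewrite eq_le nr_ge0 andbT leNgt.
apply/negP => d0; pose e := nr (E f j) / (`|B| + 1).
have B1 : 0 < `|B| + 1 by rewrite ltr_wpDl.
have e0 : 0 < e by rewrite divr_gt0.
have [|y [My Ny] fy] := hf (e ^+ 2); first by rewrite exprn_gt0.
have Hy := MH My; have Hd := linB HL Hf Hy.
have Ey : E (f - y) j = E f j.
  have -> : f - y = (-1) *: y + f by rewrite scaleN1r addrC.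
  by rewrite EP// ((EN _ Hy).1 Ny) mulr0 add0r.
rewrite -(hn_lt hH)// in fy.
have := hB _ j Hd; rewrite Ey leNgt => /negP; apply.
have -> : nr (E f j) = (`|B| + 1) * e by rewrite mulrC divfK// gt_eqF.
have hn0 := hn_ge0 ip (f - y); have := ler_norm B.
by move: (hnorm _ _) fy hn0 => x; nra.
Qed.

(** More than n vectors have a nontrivial combination f in the common kernel of the n
    functionals. Then f lies in the subspace to which it is orthogonal, so f = 0. *)
Lemma defect_dim m (g : 'I_m -> disc R -> C) :
  (forall i, ominus M ip N (g i)) -> orthonormal H2 ip g -> (m <= n)%N.
Proof.
move=> Wg og; have [E [EP _ EN]] := blaschke_functionals a.
have WL := ominus_lin hH MH (closed_sub multiples_closed) ML.
rewrite leqNgt; apply/negP => nm.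
pose A : 'M[C]_(m, n) := \matrix_(i, j) E (g i) j.
have : kermx A != 0.
  by rewrite -mxrank_eq0 mxrank_ker subn_eq0 -ltnNge (leq_ltn_trans (rank_leq_col A)).
move=> /rowV0Pn[v /sub_kermxP vA v0].
pose f := \sum_i v ord0 i *: g i.
have Hf : H2 f by exact: (span_in hH og).
have Wf : ominus M ip N f by apply: (lin_sum WL) => i _; exact: (linZ WL).
have Nf : N f.
  split; first by case: Wf.
  apply/EN => // j; have := congr1 (fun B : 'rV_n => B ord0 j) vA; rewrite !mxE => <-.
  have EP' c x y : H2 x -> H2 y -> (E (c *: x + y) j : C^o) = c *: (E x j : C^o) + E y j.
    exact: EP.
  rewrite (linon_sum HL EP'); last by case: og.
  by apply: eq_bigr => i _; rewrite mxE.
have f0 : f = 0.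
  by apply: (hilbert_def hH) => //; rewrite /sqnorm (Wf.2 _ Nf) re0.
case/eqP: v0; apply/rowP => i; rewrite mxE.
by rewrite -(ip_span hH og (v ord0) i) -/f f0 (ip0l hH)//; case: og.
Qed.

Lemma model_spaceP (r q : nat) (Theta : disc R -> 'M[C]_(r, q)) k : model_space Theta k <->
  vhardy k /\ forall h, vhardy h -> vip k (fun z => Theta z *m h z) = 0.
Proof.
rewrite /model_space /ominus /mulH2v /= !vhardy_H2v vip_ipv.
split=> -[Hk hk]; split=> //; first by move=> h Hh; apply: hk; exists h.
by move=> _ [h Hh <-]; exact: hk.
Qed.

(** The constant e_i lies in the model space and J e_i = g_i, so that the coordinates
    of k(0) are the inner products of J k with the g_i. They vanish when J k is a
    multiple of the Blaschke product. Then k = z S* k for the backward shift S*, and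
    J k = z J (S* k). *)
Lemma represented_nearly_invariant (r q : nat) (Theta : disc R -> 'M[C]_(r, q))
    (g : 'I_r -> disc R -> C) :
  (forall i j, analytic (fun z => Theta z i j)) -> Theta (disc0 R) = 0 ->
  (forall i, ominus M ip N (g i)) ->
  row_apply g @` model_space Theta = M ->
  (forall x y, model_space Theta x -> model_space Theta y ->
     ip (row_apply g x) (row_apply g y) = vip x y) ->
  forall f, N f -> M (Tz_star f).
Proof.
move=> aT T0 Wg JM Jip f [Mf Nf].
have aTh h i : vhardy h -> analytic (vcomp (fun z => Theta z *m h z) i).
  move=> Hh; rewrite (_ : vcomp _ _ = \sum_j (fun z => Theta z i j * vcomp h j z)).
    apply: (@lin_sum R _ (@analytic R)) => [|j _]; first split.
    - by exists (fun _ => 0); exact: ps0.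
    - by move=> c x y [u hu] [v hv]; exists (fun k => c * u k + v k); exact: (@psP R c x y u v hu hv).
    - by apply: analytic_mul => //; apply/H2_analytic/vhardy_comp.
  by apply/funext => z; rewrite /vcomp mxE fct_sumE.
have constK i : model_space Theta (vconst (delta_mx i ord0)).
  apply/model_spaceP; split=> [|h Hh]; first exact: vconst_in.
  rewrite vipE big1// => j _; have aj := aTh h j Hh; rewrite ip_constl//.
  by rewrite /vcomp T0 mul0mx mxE rmorph0 mulr0.
have Jconst i : row_apply g (vconst (delta_mx i ord0)) = g i.
  apply/funext => z; rewrite /row_apply /vconst (bigD1 i)//= big1 => [|j ji]; rewrite mxE.
    by rewrite !eqxx mulr1 addr0.
  by rewrite (negbTE ji) mulr0.
have [k Kk kf] : (row_apply g @` model_space Theta) f by rewrite JM.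
have [Hk hk] := (model_spaceP _ _).1 Kk.
have Hf := MH Mf.
have k0 : k (disc0 R) = 0.
  apply/matrixP => i j; rewrite ord1 mxE.
  have := Jip _ _ Kk (constK i); rewrite Jconst kf (ipC hH _ Hf); last by case: (Wg i) => /MH.
  rewrite (Wg i).2 // rmorph0 vip_const => [|l]; last exact/H2_analytic/vhardy_comp.
  rewrite (bigD1 i)//= big1 => [|l li]; last by rewrite mxE (negbTE li) rmorph0 mulr0.
  by rewrite mxE !eqxx rmorph1 mulr1 addr0.
have Kb : model_space Theta (vbshift k).
  apply/model_spaceP; split=> [|h Hh]; first exact: vbshift_in.
  rewrite -(hk (vTz h)); last exact: vTz_in.
  rewrite !vipE; apply: eq_bigr => i _; rewrite vcomp_vbshift ip_bshift; last exact: aTh.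
    congr ip; apply/funext => z; rewrite /Tz /vcomp /vTz -scalemxAr [RHS]mxE//.
  exact: vhardy_comp.
have Mb : M (row_apply g (vbshift k)) by rewrite -JM; exists (vbshift k).
suff -> : Tz_star f = row_apply g (vbshift k) by [].
rewrite Tz_starE// -[RHS]bshift_Tz; last exact: MH.
congr bshift; rewrite -kf -{1}(vTz_vbshift Hk k0); apply/funext => z.
by rewrite /row_apply /Tz /vTz mulr_sumr; apply: eq_bigr => i _; rewrite mxE mulrCA.
Qed.

Hypothesis ninv : forall f, N f -> M (Tz_star f).

Section Representation.
Variables (r : nat) (g : 'I_r -> disc R -> C).
Hypothesis bg : orthonormal_basis ip (ominus M ip N) g.

Let Wg i : ominus M ip N (g i). Proof. by case: bg. Qed.
Let gM i : M (g i). Proof. by case: (Wg i). Qed.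
Let og : orthonormal H2 ip g. Proof. by split=> [i|]; [exact/MH|case: bg]. Qed.

(** The defect space is spanned by g, and its complement in M consists of multiples. *)
Lemma onres_multiple f : M f -> N (f - onproj ip g f).
Proof.
move=> Mf; have Nc := multiples_closed.
have [y [Ny Wy]] := ominus_split hH Nc (fun x => @proj1 _ _) MH ML Mf.
have Hy := closed_sub Nc Ny; have [c fy] : exists c : 'I_r -> C, f - y = \sum_i c i *: g i.
  by case: bg => _ _; apply.
suff -> : onproj ip g f = f - y by rewrite subKr.
rewrite /onproj fy; apply: eq_bigr => i _; congr (_ *: _).
have -> : f = (f - y) + y by rewrite subrK.
rewrite (ipDl hH) ?fy//; [|exact: (span_in hH og)|exact/MH].
rewrite (ip_span hH og) (ipC hH _ Hy); last exact/MH.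
by rewrite (Wg i).2// rmorph0 addr0.
Qed.

Lemma cshift_in f : M f -> M (cshift g f).
Proof.
move=> /onres_multiple Nf; rewrite /cshift -Tz_starE; first exact: ninv.
exact: (closed_sub multiples_closed).
Qed.

Lemma Tz_cshift f : M f -> Tz (cshift g f) = f - onproj ip g f.
Proof.
move=> /onres_multiple Nf; have Hf := closed_sub multiples_closed Nf.
rewrite /cshift Tz_bshift// coef_at0; last exact: H2_analytic.
by apply: blaschke_multiple_at0; case: Nf.
Qed.

Let K : set (disc R -> 'cV[C]_r) := ktr g @` M.

Lemma transform_shift F : K F -> K (vbshift F).
Proof.
move=> [f Mf <-]; exists (cshift g f); first exact: cshift_in.
exact: (ktr_cshift og Mc cshift_in Tz_cshift).
Qed.

Lemma transform_const w : K (vconst w).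
Proof.
have Kc := ktr_closed og Mc gM cshift_in Tz_cshift; have KL := closed_lin Kc.
have -> : vconst w = \sum_i w i ord0 *: vconst (delta_mx i ord0).
  apply/funext => z; rewrite fct_sumE /vconst [LHS]matrix_sum_delta.
  by apply: eq_bigr => i _; rewrite big_ord1.
apply: (lin_sum KL) => i _; apply: (linZ KL).
by exists (g i) => //; exact: (ktr_g og Mc gM cshift_in Tz_cshift).
Qed.

(** The transforms of the elements of M form a closed subspace which is invariant under
    the backward shift. Its wandering vectors have a finite orthonormal basis because
    the symbol of any orthonormal family of them is inner, hence has at most r columns. *)
Lemma representation_exists : exists q (Theta : disc R -> 'M[C]_(r, q)),
  [/\ (q <= r)%N, inner_function Theta /\ Theta (disc0 R) = 0,
      M = row_apply g @` model_space Theta &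
      unitary (model_space Theta) vip M ip (row_apply g)].
Proof.
have hV := vhardy_hilbert R r.
have Kc : closed_subspace (@vhardy R r) vip K := ktr_closed og Mc gM cshift_in Tz_cshift.
have cols q (th : 'I_q -> disc R -> 'cV[C]_r) : orthonormal (@vhardy R r) vip th ->
    (forall i j, H2 (fun z => symbol th z i j)) /\
    (forall j, \sum_i nsq (fun z => symbol th z i j) = 1).
  move=> oth; have sE i j : (fun z => symbol th z i j) = vcomp (th j) i.
    by apply/funext => z; rewrite mxE.
  split=> [i j|j]; first by rewrite sE; apply: vhardy_comp; case: oth.
  under eq_bigr do rewrite sE.
  by rewrite -vnsqE /sqnorm; case: oth => _ ->; rewrite eqxx re1.
have [q [th [qr bth]]] : exists q (th : 'I_q -> disc R -> 'cV[C]_r),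
    (q <= r)%N /\ orthonormal_basis vip (wandering K) th.
  apply: (orthonormal_basis_exists hV) => [F||]; first exact: wandering_sub.
    exact: (wandering_lin Kc).
  move=> m th wth oth; have [h1 h2] := cols _ _ oth.
  exact: (inner_dim h1 (symbol_contractive Kc transform_shift wth oth) h2).
have [wth ipth gen] := bth.
have oth : orthonormal (@vhardy R r) vip th by split=> // j; exact: wandering_sub (wth j).
have [h1 h2] := cols _ _ oth.
have mK := model_space_symbol Kc transform_shift wth oth gen.
have JM : row_apply g @` K = M.
  apply/seteqP; split=> [_ [_ [f Mf <-] <-]|f Mf].
    by rewrite (row_ktr og Mc cshift_in Tz_cshift).
  by exists (ktr g f); [exists f|exact: (row_ktr og Mc cshift_in Tz_cshift)].
exists q, (symbol th); rewrite mK; split=> //.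
  split; last exact: (symbol_at0 wth oth transform_const).
  split; first exact: (symbol_Hinfty Kc transform_shift wth oth).
  exact: (inner_ae h1 (symbol_contractive Kc transform_shift wth oth) h2).
split=> // [c x y _ _|_ _ [f Mf <-] [h Mh <-]].
  apply/funext => z; rewrite [RHS](_ : _ = c * row_apply g x z + row_apply g y z)// /row_apply.
  rewrite mulr_sumr -big_split; apply: eq_bigr => i _ /=.
  by rewrite !mxE mulrDr mulrCA.
by rewrite !(row_ktr og Mc cshift_in Tz_cshift)// (vip_ktr og Mc gM cshift_in Tz_cshift).
Qed.

End Representation.
End Assembly.

Theorem theorem1p5 (R : realType) (n : nat) (a : 'I_n -> disc R)
  (ha : exists j, a j = 0 :> Cx R)
  (M : set (disc R -> Cx R))
  (hM : closed_subspace H2 ip M) (hM0 : M <> [set 0]) :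
  nearly_Tz_star_invariant (blaschke a) M <->
  exists (r' r : nat) (Theta : disc R -> 'M[Cx R]_(r, r'))
         (g : 'I_r -> disc R -> Cx R),
    [/\ (r' <= r <= n)%N,
        inner_function Theta /\ Theta (disc0 R) = 0,
        orthonormal_basis ip (ominus M ip (M `&` mulH2 (blaschke a))) g,
        M = row_apply g @` model_space Theta &
        unitary (model_space Theta) ipv M ip (row_apply g)].
Proof.
move: hM; rewrite /nearly_Tz_star_invariant hardy_H2 hip_ip => Mc.
split=> [ninv|[q [r [Th [g [_ [[[aT _] _] T0] bg _ [_ JM Jip]]]]]]]; last first.
  rewrite vip_ipv in Jip; have Wg : forall i, ominus M (@hip R) (M `&` mulH2 (blaschke a)) (g i).
    by case: bg.
  exact: (represented_nearly_invariant Mc aT T0 Wg JM Jip).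
have hH := H2_hilbert R; have Nc := multiples_closed a Mc.
have MH := closed_sub Mc; have ML := closed_lin Mc.
pose W := ominus M (@hip R) (M `&` mulH2 (blaschke a)).
have [||r [g [rn bg]]] :=
  orthonormal_basis_exists hH (W := W) (n := n) _ _ (defect_dim Mc).
- by move=> f [/MH].
- exact: (ominus_lin hH MH (closed_sub Nc) ML).
have [q [Th [qr inner JM JU]]] := representation_exists ha Mc ninv bg.
exists q, r, Th, g; rewrite vip_ipv qr rn; split=> //.
Qed.
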